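(* Let smooth initial data (A) for an A-surface $f$ and smooth initial data (W) for a Weingarten transform $f^+$ of $f$ be given. Let $f^\epsilon$ be the canonical discrete A-surfaces for (A), normalized by $f^\epsilon(0)=f(0)$, and let $(f^\epsilon)^+$ be their canonical discrete Weingarten transforms for (W). Then for some $r>0$ the discrete A-nets $(f^\epsilon)^+:\mathcal{B}^\epsilon(r)\to\mathbb{R}^3$ (defined for all sufficiently small $\epsilon>0$) converge, as $\epsilon\to0$, to the unique Weingarten transform $f^+:\mathcal{B}(r)\to\mathbb{R}^3$ of $f$ with the initial data (W). The convergence is with the order $O(\epsilon)$ in $C^\infty(\mathcal{B}(r))$.
   Context: Put $\mathcal{B}_1=\mathbb{R}\times\{0\}$, $\mathcal{B}_2=\{0\}\times\mathbb{R}$, $\mathcal{B}(r)=[0,r]^2$, $\mathcal{B}^\epsilon(r)=(\epsilon\mathbb{Z})^2\cap[0,r]^2$, $\mathcal{B}_i^\epsilon=\mathcal{B}_i\cap(\epsilon\mathbb{Z})^2$. On $(\epsilon\mathbb{Z})^2$: $(\tau_i f)(u)=f(u+\epsilon e_i)$, $\delta_i=\epsilon^{-1}(\tau_i-1)$, $\delta^\alpha=\delta_1^{\alpha_1}\delta_2^{\alpha_2}$. An A-surface $f$ in $\mathbb{R}^3$ (surface parametrized along asymptotic lines) is described by its Lelieuvre normal field $n$ through $\partial_1f=\partial_1n\times n$, $\partial_2f=n\times\partial_2n$, where $\partial_1\partial_2n=q_{12}n$. Initial data (A): two smooth curves $n|_{\mathcal{B}_1}$, $n|_{\mathcal{B}_2}$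 in $\mathbb{R}^3$ with a common point $n(0)$, and a smooth function $q_{12}:\mathbb{R}^2\to\mathbb{R}$ (together with a value $f(0)$ fixing the translation). Canonical discrete A-surfaces for (A): $n^\epsilon:(\epsilon\mathbb{Z})^2\to\mathbb{R}^3$ solves $\tau_1\tau_2n^\epsilon+n^\epsilon=a_{12}^\epsilon(\tau_1n^\epsilon+\tau_2n^\epsilon)$ with $n^\epsilon=n$ on $\mathcal{B}_i^\epsilon$, $a_{12}^\epsilon=1+\frac12\epsilon^2q_{12}$; and $\delta_1f^\epsilon=\delta_1n^\epsilon\times n^\epsilon$, $\delta_2f^\epsilon=n^\epsilon\times\delta_2n^\epsilon$. Weingarten transform: $f^+$ is an A-surface such that the line through $f(u)$ and $f^+(u)$ is tangent to both surfaces at the corresponding points. In terms of normal fields, $f^+=f+n^+\times n$, where $n^+$ is a Moutard transform of $n$: $\partial_1n^++\partial_1n=p_1(n^+-n)$, $\partial_2n^+-\partial_2n=p_2(n^++n)$, $\partial_1p_2=\partial_2p_1=-q_{12}+p_1p_2$. Initial data (W): a point $n^+(0)\in\mathbb{R}^3$ and smooth real functions $p_1|_{\mathcal{B}_1}$, $p_2|_{\mathcal{B}_2}$; the Weingarten transform with initial data (W) is the one so obtained. Canonical discrete Weingarten transforms for (W): $(f^\epsilon)^+=f^\epsilon+(n^\epsilon)^+\times n^\epsilon$, where (dropping $\epsilon$) $\tau_1n^+-n=b_1(n^+-\tau_1n)$, $\tau_2n^++n=b_2(n^++\tau_2n)$, $\dfrac{\tau_2b_1}{b_1}=\dfrac{\tau_1b_2}{b_2}=\dfrac{1}{(b_1+b_2)a_{12}-b_1b_2}$,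 with $(n^\epsilon)^+(0)=n^+(0)$ and $b_i^\epsilon(u)=1+\epsilon p_i(u)$ for $u\in\mathcal{B}_i^\epsilon$. Convergence $g^\epsilon\to g$ with the order $O(\epsilon)$ in $C^\infty(\mathcal{B}(r))$ means: for every multi-index $\alpha$ there is $c_\alpha$ such that $|\delta^\alpha(g^\epsilon-g)(u)|\le c_\alpha\epsilon$ for all sufficiently small $\epsilon>0$ and all $u\in\mathcal{B}^\epsilon(r)$ at which this difference quotient is defined on $\mathcal{B}^\epsilon(r)$. *)

(* Defs.v *)
(* Concrete real numbers of Stdlib, with Coquelicot. *)
From Stdlib Require Export Reals.
From Coquelicot Require Export Coquelicot.
Open Scope R_scope.

(* The norm that Coquelicot infers on R3 is the Euclidean one. *)
Notation R3 := (R * R * R)%type.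

Definition c1 (v : R3) : R := fst (fst v).
Definition c2 (v : R3) : R := snd (fst v).
Definition c3 (v : R3) : R := snd v.

Definition dot (v w : R3) : R := c1 v * c1 w + c2 v * c2 w + c3 v * c3 w.

Definition cross (v w : R3) : R3 :=
  (c2 v * c3 w - c3 v * c2 w,
   c3 v * c1 w - c1 v * c3 w,
   c1 v * c2 w - c2 v * c1 w).

Definition smooth1 (h : R -> R) : Prop := forall m x, ex_derive_n h m x.

Definition smooth1_vec (h : R -> R3) : Prop :=
  smooth1 (fun x => c1 (h x)) /\ smooth1 (fun x => c2 (h x)) /\
  smooth1 (fun x => c3 (h x)).

(* [ex_diff_n] at a single point does not require the derivatives to exist at
   nearby points, hence the neighbourhood. *)
Definition smooth_at (F : R -> R -> R) (x y : R) : Prop :=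
  locally_2d (fun s t => forall m, ex_diff_n F m s t) x y.

Definition smooth2 (F : R -> R -> R) : Prop := forall x y, smooth_at F x y.

Definition in_square (r x y : R) : Prop := 0 <= x <= r /\ 0 <= y <= r.

(* A smooth function on the closed square is represented by a total function
   that is smooth on some neighbourhood of the square.  Its values outside the
   square are irrelevant, and its partial derivatives at boundary points are
   determined by its values inside. *)
Definition smooth_on (r : R) (F : R -> R -> R) : Prop :=
  forall x y, in_square r x y -> smooth_at F x y.

Definition smooth_on_vec (r : R) (F : R -> R -> R3) : Prop :=
  smooth_on r (fun x y => c1 (F x y)) /\ smooth_on r (fun x y => c2 (F x y)) /\
  smooth_on r (fun x y => c3 (F x y)).

Definition partial_vec (i j : nat) (F : R -> R -> R3) (x y : R) : R3 :=
  (partial_derive i j (fun s t => c1 (F s t)) x y,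
   partial_derive i j (fun s t => c2 (F s t)) x y,
   partial_derive i j (fun s t => c3 (F s t)) x y).

Record A_data := {
  curve1 : R -> R3;
  curve2 : R -> R3;
  q12 : R -> R -> R;
  f0 : R3;
  curve1_smooth : smooth1_vec curve1;
  curve2_smooth : smooth1_vec curve2;
  q12_smooth : smooth2 q12;
  curves_meet : curve1 0 = curve2 0 }.

Record W_data := {
  np0 : R3;
  p1_axis : R -> R;
  p2_axis : R -> R;
  p1_axis_smooth : smooth1 p1_axis;
  p2_axis_smooth : smooth1 p2_axis }.

(* [f] is an A-surface on [0,r]^2 with Lelieuvre normal field [n]. *)
Record A_surface (r : R) (q : R -> R -> R) (n f : R -> R -> R3) : Prop := {
  As_q_smooth : smooth_on r q;
  As_n_smooth : smooth_on_vec r n;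
  As_f_smooth : smooth_on_vec r f;
  As_moutard : forall x y, in_square r x y ->
    partial_vec 1 1 n x y = scal (q x y) (n x y);
  As_lelieuvre1 : forall x y, in_square r x y ->
    partial_vec 1 0 f x y = cross (partial_vec 1 0 n x y) (n x y);
  As_lelieuvre2 : forall x y, in_square r x y ->
    partial_vec 0 1 f x y = cross (n x y) (partial_vec 0 1 n x y) }.

Record A_surface_with_data (r : R) (A : A_data) (n f : R -> R -> R3) : Prop := {
  Ad_surface : A_surface r (q12 A) n f;
  Ad_axis1 : forall x, 0 <= x <= r -> n x 0 = curve1 A x;
  Ad_axis2 : forall y, 0 <= y <= r -> n 0 y = curve2 A y;
  Ad_origin : f 0 0 = f0 A }.

Record moutard_transform (r : R) (q : R -> R -> R) (n np : R -> R -> R3)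
    (p1 p2 : R -> R -> R) : Prop := {
  Mt_np_smooth : smooth_on_vec r np;
  Mt_p1_smooth : smooth_on r p1;
  Mt_p2_smooth : smooth_on r p2;
  Mt_eq1 : forall x y, in_square r x y ->
    plus (partial_vec 1 0 np x y) (partial_vec 1 0 n x y)
    = scal (p1 x y) (minus (np x y) (n x y));
  Mt_eq2 : forall x y, in_square r x y ->
    minus (partial_vec 0 1 np x y) (partial_vec 0 1 n x y)
    = scal (p2 x y) (plus (np x y) (n x y));
  Mt_p2_d1 : forall x y, in_square r x y ->
    partial_derive 1 0 p2 x y = - q x y + p1 x y * p2 x y;
  Mt_p1_d2 : forall x y, in_square r x y ->
    partial_derive 0 1 p1 x y = - q x y + p1 x y * p2 x y }.

(* [fp] is, on [0,r]^2, a Weingarten transform with initial data [W] of the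
   A-surface [f] with Lelieuvre normal field [n].  The line through [f] and
   [fp] has direction [np x n], which is orthogonal to both normal fields. *)
Definition weingarten_transform (r : R) (A : A_data) (W : W_data)
    (n f fp : R -> R -> R3) : Prop :=
  exists (np : R -> R -> R3) (p1 p2 : R -> R -> R),
    moutard_transform r (q12 A) n np p1 p2 /\
    np 0 0 = np0 W /\
    (forall x, 0 <= x <= r -> p1 x 0 = p1_axis W x) /\
    (forall y, 0 <= y <= r -> p2 0 y = p2_axis W y) /\
    (forall x y, in_square r x y ->
       fp x y = plus (f x y) (cross (np x y) (n x y))) /\
    (exists qp : R -> R -> R, A_surface r qp np fp).

(* Since (eps Z)^2 meets [0,r]^2 only in points (k eps, l eps) with k, l
   natural numbers, lattice functions are indexed by pairs of naturals; only
   their values at indices satisfying [in_grid] matter. *)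
Definition in_grid (eps r : R) (k l : nat) : Prop :=
  INR k * eps <= r /\ INR l * eps <= r.

Definition delta1 (eps : R) (g : nat -> nat -> R3) (k l : nat) : R3 :=
  scal (/ eps) (minus (g (S k) l) (g k l)).
Definition delta2 (eps : R) (g : nat -> nat -> R3) (k l : nat) : R3 :=
  scal (/ eps) (minus (g k (S l)) (g k l)).
Definition delta (eps : R) (i j : nat) (g : nat -> nat -> R3)
  : nat -> nat -> R3 :=
  Nat.iter i (delta1 eps) (Nat.iter j (delta2 eps) g).

Definition a12 (A : A_data) (eps : R) (k l : nat) : R :=
  1 + / 2 * eps ^ 2 * q12 A (INR k * eps) (INR l * eps).

Record discrete_A_surface (A : A_data) (eps r : R) (n f : nat -> nat -> R3)
  : Prop := {
  dA_axis1 : forall k, in_grid eps r k 0 -> n k 0%nat = curve1 A (INR k * eps);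
  dA_axis2 : forall l, in_grid eps r 0 l -> n 0%nat l = curve2 A (INR l * eps);
  dA_moutard : forall k l, in_grid eps r (S k) (S l) ->
    plus (n (S k) (S l)) (n k l)
    = scal (a12 A eps k l) (plus (n (S k) l) (n k (S l)));
  dA_lelieuvre1 : forall k l, in_grid eps r (S k) l ->
    delta1 eps f k l = cross (delta1 eps n k l) (n k l);
  dA_lelieuvre2 : forall k l, in_grid eps r k (S l) ->
    delta2 eps f k l = cross (n k l) (delta2 eps n k l);
  dA_origin : f 0%nat 0%nat = f0 A }.

(* The two inequations exclude divisions by zero. *)
Record discrete_moutard_transform (A : A_data) (W : W_data) (eps r : R)
    (n np : nat -> nat -> R3) (b1 b2 : nat -> nat -> R) : Prop := {
  dM_eq1 : forall k l, in_grid eps r (S k) l ->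
    minus (np (S k) l) (n k l) = scal (b1 k l) (minus (np k l) (n (S k) l));
  dM_eq2 : forall k l, in_grid eps r k (S l) ->
    plus (np k (S l)) (n k l) = scal (b2 k l) (plus (np k l) (n k (S l)));
  dM_b_neq0 : forall k l, in_grid eps r (S k) (S l) ->
    b1 k l <> 0 /\ b2 k l <> 0;
  dM_den_neq0 : forall k l, in_grid eps r (S k) (S l) ->
    (b1 k l + b2 k l) * a12 A eps k l - b1 k l * b2 k l <> 0;
  dM_b1 : forall k l, in_grid eps r (S k) (S l) ->
    b1 k (S l) / b1 k l
    = 1 / ((b1 k l + b2 k l) * a12 A eps k l - b1 k l * b2 k l);
  dM_b2 : forall k l, in_grid eps r (S k) (S l) ->
    b2 (S k) l / b2 k l
    = 1 / ((b1 k l + b2 k l) * a12 A eps k l - b1 k l * b2 k l);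
  dM_origin : np 0%nat 0%nat = np0 W;
  dM_b1_axis : forall k, in_grid eps r k 0 ->
    b1 k 0%nat = 1 + eps * p1_axis W (INR k * eps);
  dM_b2_axis : forall l, in_grid eps r 0 l ->
    b2 0%nat l = 1 + eps * p2_axis W (INR l * eps) }.

Definition discrete_weingarten_transform (A : A_data) (W : W_data) (eps r : R)
    (n f fp : nat -> nat -> R3) : Prop :=
  exists (np : nat -> nat -> R3) (b1 b2 : nat -> nat -> R),
    discrete_moutard_transform A W eps r n np b1 b2 /\
    (forall k l, in_grid eps r k l ->
       fp k l = plus (f k l) (cross (np k l) (n k l))).

Definition adjacent (k l i j : nat) : Prop :=
  (i = k /\ (j = S l \/ l = S j)) \/ (j = l /\ (i = S k \/ k = S i)).

(* Every vertex is coplanar with its neighbours in the grid. *)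
Definition discrete_A_net (eps r : R) (f : nat -> nat -> R3) : Prop :=
  forall k l, in_grid eps r k l ->
    exists v : R3, v <> zero /\
      forall i j, in_grid eps r i j -> adjacent k l i j ->
        dot v (minus (f i j) (f k l)) = 0.

(* [at_right 0] is the filter "for all sufficiently small eps > 0". *)
Definition converges_Cinf_Oeps (r : R) (geps : R -> nat -> nat -> R3)
    (g : R -> R -> R3) : Prop :=
  forall i j : nat, exists c : R, at_right 0 (fun eps =>
    forall k l : nat, in_grid eps r (i + k) (j + l) ->
      norm (delta eps i j
              (fun k' l' => minus (geps eps k' l')
                                  (g (INR k' * eps) (INR l' * eps))) k l)
      <= c * eps).

(* Main.v *)
(** The substitution p_i = - (d_i th) / th, and b_i = th / (tau_i th) on the lattice,
    linearises the problem: th is a scalar solution of the same Moutard equation as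
    n, and M = th n^+ satisfies d_1 M = d_1 th n - th d_1 n, d_2 M = th d_2 n - d_2 th n,
    so it is a quadrature, with the same discrete form; so is f.  Everything reduces
    to scalar Goursat problems for u_xy = q u and to integrating closed forms.

    For a smooth solution u and its discrete counterpart, the error divided by eps
    solves a discrete Goursat problem with bounded source.  Gronwall bounds it, and
    its difference quotients solve linear difference equations with bounded
    coefficients, hence are bounded at every order.  Such bounds are stable under
    sums, products and inverses, and therefore pass to f^+ = f + (M x n) / th. *)

From Stdlib Require Import Lra Lia FunctionalExtensionality Classical.
Require Import Defs.

(** The equations for [p1], [p2] and for [b1], [b2] are of Riccati type: solutions may blow up, and
    the discrete ones contain denominators that must stay away from zero uniformly in the mesh.
    After the linearisation the only such condition is that [th] does not vanish. Since [th] is 1 at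
    the origin, its modulus is at least 1/2 on a small square; this is one reason why [r] is small.
    The other is the Picard contraction for the Goursat problem. Its size depends on [q12] alone, so
    the coordinates of the normal field and [th] share one square.

    The constructed smooth objects live on an open box around the origin: the axes and the closed
    square are then interior, and two-sided derivatives make sense there.

    The statement speaks of arbitrary A-surfaces, Weingarten transforms and discrete solutions,
    which come without any [th]. Uniqueness is therefore proved for the original equations, the
    Riccati ones included, up to the boundary of the square; it identifies the given objects with
    those built from [th]. *)

(** * Functions of class C^N on an open box *)

Definition box (T x y : R) : Prop := Rabs x < T /\ Rabs y < T.

(* Throughout, a boolean direction is [true] for the first variable and [false]
   for the second. *)
Definition D (b : bool) (F : R -> R -> R) : R -> R -> R :=
  if b then fun x y => Derive (fun s => F s y) x
  else fun x y => Derive (fun t => F x t) y.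

Definition Ck (T : R) (N : nat) (F : R -> R -> R) : Prop :=
  forall x y, box T x y -> ex_diff_n F N x y.

Definition Cinf (T : R) (F : R -> R -> R) : Prop := forall N, Ck T N F.

(** The derivatives are named instead of being written [D b F]: calculus rules and integral
    equations then supply closed formulas for them, and [partials_D] translates back. *)
Definition partials (T : R) (F F1 F2 : R -> R -> R) : Prop :=
  forall x y, box T x y ->
    is_derive (fun s => F s y) x (F1 x y) /\ is_derive (F x) y (F2 x y).

Lemma box_open T x y : box T x y -> locally_2d (box T) x y.
Proof.
intros [Hx Hy].
assert (Hd : 0 < Rmin (T - Rabs x) (T - Rabs y)) by (apply Rmin_pos; lra).
exists (mkposreal _ Hd); simpl; intros u v Hu Hv.
pose proof (Rmin_l (T - Rabs x) (T - Rabs y)).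
pose proof (Rmin_r (T - Rabs x) (T - Rabs y)).
split; unfold Rabs in *; repeat destruct (Rcase_abs _); lra.
Qed.

Lemma box_locally T (P : R -> R -> Prop) x y :
  (forall u v, box T u v -> P u v) -> box T x y -> locally_2d P x y.
Proof.
intros H Hb. destruct (box_open _ _ _ Hb) as [d Hd].
exists d; intros u v Hu Hv; apply H, Hd; assumption.
Qed.

Lemma Ck_ext T N F G :
  (forall x y, box T x y -> F x y = G x y) -> Ck T N F -> Ck T N G.
Proof.
intros H HF x y Hb. apply ex_diff_n_ext_loc with F; [|exact (HF x y Hb)].
exact (box_locally _ _ _ _ H Hb).
Qed.

Lemma Ck_le T N F T' : T' <= T -> Ck T N F -> Ck T' N F.
Proof. intros H HF x y [Hx Hy]; apply HF; split; lra. Qed.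

Lemma Ck_cont T N F x y : Ck T N F -> box T x y -> continuity_2d_pt F x y.
Proof. intros H Hb; specialize (H x y Hb); destruct N; apply H. Qed.

Lemma Ck_partials T N F :
  Ck T (S N) F -> partials T F (D true F) (D false F).
Proof.
intros H x y Hb. destruct (H x y Hb) as (_ & H1 & H2 & _).
split; apply Derive_correct; assumption.
Qed.

Lemma Ck_D T N b F : Ck T (S N) F -> Ck T N (D b F).
Proof.
intros H x y Hb. destruct (H x y Hb) as (_ & _ & _ & H1 & H2).
destruct b; assumption.
Qed.

Lemma Ck_S T N F : Ck T (S N) F -> Ck T N F.
Proof. intros H x y Hb; apply ex_diff_n_m with (S N); [lia|exact (H x y Hb)]. Qed.

(** [ex_diff_n] asks for joint continuity, which the existence of partial derivatives does not give.
    A continuous first partial makes [F] differentiable at the point, hence continuous. *)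
Lemma partials_cont T F F1 F2 x y :
  partials T F F1 F2 ->
  (forall u v, box T u v -> continuity_2d_pt F1 u v) ->
  box T x y -> continuity_2d_pt F x y.
Proof.
intros HP H1 Hb. apply continuity_2d_pt_filterlim.
apply (filterdiff_continuous (fun u : R * R => F (fst u) (snd u)) (x, y)).
eexists; apply (is_derive_filterdiff F x y F1 (F2 x y)).
- apply (locally_2d_locally (fun u v => is_derive (fun z => F z v) u (F1 u v))).
  apply (box_locally T); [|exact Hb]. intros u v Huv; apply HP; assumption.
- apply HP; assumption.
- apply continuity_2d_pt_filterlim, H1, Hb.
Qed.

(** The engine of the regularity proofs: an induction on [N] in which the first derivatives are
    expressed by functions that the induction hypothesis covers. *)
Lemma Ck_intro T N F F1 F2 :
  partials T F F1 F2 -> Ck T N F1 -> Ck T N F2 -> Ck T (S N) F.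
Proof.
intros HP H1 H2 x y Hb. simpl.
assert (E1 : locally_2d (fun u v => F1 u v = Derive (fun z => F z v) u) x y).
{ apply (box_locally T); [|exact Hb]. intros u v Huv.
  symmetry; apply is_derive_unique, HP; assumption. }
assert (E2 : locally_2d (fun u v => F2 u v = Derive (fun z => F u z) v) x y).
{ apply (box_locally T); [|exact Hb]. intros u v Huv.
  symmetry; apply is_derive_unique, HP; assumption. }
repeat split.
- apply (partials_cont T F F1 F2); auto.
  intros u v Huv; apply (Ck_cont T N); assumption.
- exists (F1 x y); apply HP; assumption.
- exists (F2 x y); apply HP; assumption.
- apply ex_diff_n_ext_loc with (1 := E1), H1, Hb.
- apply ex_diff_n_ext_loc with (1 := E2), H2, Hb.
Qed.

Lemma Ck_0 T F :
  (forall x y, box T x y -> continuity_2d_pt F x y) -> Ck T 0 F.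
Proof. intros H x y Hb; split; auto. Qed.

Lemma partials_D T F F1 F2 x y :
  partials T F F1 F2 -> box T x y ->
  D true F x y = F1 x y /\ D false F x y = F2 x y.
Proof. intros HP Hb; split; apply is_derive_unique, HP, Hb. Qed.

Lemma partials_ext T F G F1 G1 F2 G2 :
  (forall x y, box T x y -> F x y = G x y) ->
  (forall x y, box T x y -> F1 x y = G1 x y) ->
  (forall x y, box T x y -> F2 x y = G2 x y) ->
  partials T F F1 F2 -> partials T G G1 G2.
Proof.
intros H H1 H2 HP x y Hb. rewrite <- H1, <- H2 by assumption.
pose proof (box_locally _ _ _ _ H Hb) as HL.
split.
- apply is_derive_ext_loc with (fun s => F s y); [|apply HP; assumption].
  apply (locally_2d_1d_const_y (fun u v => F u v = G u v)); exact HL.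
- apply is_derive_ext_loc with (fun s => F x s); [|apply HP; assumption].
  apply (locally_2d_1d_const_x (fun u v => F u v = G u v)); exact HL.
Qed.

Lemma partials_const T c :
  partials T (fun _ _ => c) (fun _ _ => 0) (fun _ _ => 0).
Proof. intros x y _; split; apply (is_derive_const c). Qed.

Lemma partials_plus T F F1 F2 G G1 G2 :
  partials T F F1 F2 -> partials T G G1 G2 ->
  partials T (fun x y => F x y + G x y) (fun x y => F1 x y + G1 x y)
    (fun x y => F2 x y + G2 x y).
Proof.
intros HF HG x y Hb. destruct (HF x y Hb), (HG x y Hb).
split;
  [refine (is_derive_plus (fun s => F s y) (fun s => G s y) _ _ _ _ _)
  |refine (is_derive_plus (F x) (G x) _ _ _ _ _)]; assumption.
Qed.

Lemma partials_minus T F F1 F2 G G1 G2 :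
  partials T F F1 F2 -> partials T G G1 G2 ->
  partials T (fun x y => F x y - G x y) (fun x y => F1 x y - G1 x y)
    (fun x y => F2 x y - G2 x y).
Proof.
intros HF HG x y Hb. destruct (HF x y Hb), (HG x y Hb).
split;
  [refine (is_derive_minus (fun s => F s y) (fun s => G s y) _ _ _ _ _)
  |refine (is_derive_minus (F x) (G x) _ _ _ _ _)]; assumption.
Qed.

Lemma partials_mult T F F1 F2 G G1 G2 :
  partials T F F1 F2 -> partials T G G1 G2 ->
  partials T (fun x y => F x y * G x y)
    (fun x y => F1 x y * G x y + F x y * G1 x y)
    (fun x y => F2 x y * G x y + F x y * G2 x y).
Proof.
intros HF HG x y Hb. destruct (HF x y Hb), (HG x y Hb).
split;
  [refine (is_derive_mult (fun s => F s y) (fun s => G s y) _ _ _ _ _ _)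
  |refine (is_derive_mult (F x) (G x) _ _ _ _ _ _)];
  try assumption; intros; apply Rmult_comm.
Qed.

Lemma partials_inv T F F1 F2 :
  (forall x y, box T x y -> F x y <> 0) -> partials T F F1 F2 ->
  partials T (fun x y => / F x y) (fun x y => - F1 x y * (/ F x y * / F x y))
    (fun x y => - F2 x y * (/ F x y * / F x y)).
Proof.
intros H0 HF x y Hb. destruct (HF x y Hb) as [H1 H2]. specialize (H0 x y Hb).
split.
- replace (- F1 x y * (/ F x y * / F x y)) with (- F1 x y / F x y ^ 2) by (field; auto).
  apply (is_derive_inv (fun s => F s y)); assumption.
- replace (- F2 x y * (/ F x y * / F x y)) with (- F2 x y / F x y ^ 2) by (field; auto).
  apply (is_derive_inv (F x)); assumption.
Qed.

Lemma Ck_const T N c : Ck T N (fun _ _ => c).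
Proof.
revert c; induction N as [|N IH]; intros c.
- apply Ck_0; intros; apply continuity_2d_pt_const.
- apply (Ck_intro _ _ _ _ _ (partials_const T c)); apply IH.
Qed.

Lemma Ck_plus T N F G :
  Ck T N F -> Ck T N G -> Ck T N (fun x y => F x y + G x y).
Proof.
revert F G; induction N as [|N IH]; intros F G HF HG.
- apply Ck_0; intros; apply continuity_2d_pt_plus; eapply Ck_cont; eassumption.
- apply (Ck_intro _ _ _ _ _
    (partials_plus _ _ _ _ _ _ _ (Ck_partials _ _ _ HF) (Ck_partials _ _ _ HG)));
    apply IH; apply Ck_D; assumption.
Qed.

Lemma Ck_minus T N F G :
  Ck T N F -> Ck T N G -> Ck T N (fun x y => F x y - G x y).
Proof.
revert F G; induction N as [|N IH]; intros F G HF HG.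
- apply Ck_0; intros; apply continuity_2d_pt_minus; eapply Ck_cont; eassumption.
- apply (Ck_intro _ _ _ _ _
    (partials_minus _ _ _ _ _ _ _ (Ck_partials _ _ _ HF) (Ck_partials _ _ _ HG)));
    apply IH; apply Ck_D; assumption.
Qed.

Lemma Ck_mult T N F G :
  Ck T N F -> Ck T N G -> Ck T N (fun x y => F x y * G x y).
Proof.
revert F G; induction N as [|N IH]; intros F G HF HG.
- apply Ck_0; intros; apply continuity_2d_pt_mult; eapply Ck_cont; eassumption.
- apply (Ck_intro _ _ _ _ _
    (partials_mult _ _ _ _ _ _ _ (Ck_partials _ _ _ HF) (Ck_partials _ _ _ HG)));
    apply Ck_plus; apply IH; try (apply Ck_D; assumption); apply Ck_S; assumption.
Qed.

Lemma Ck_opp T N F : Ck T N F -> Ck T N (fun x y => - F x y).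
Proof.
intros HF. apply Ck_ext with (fun x y => 0 - F x y); [intros; ring|].
apply Ck_minus; [apply Ck_const|assumption].
Qed.

Lemma Ck_inv T N F :
  (forall x y, box T x y -> F x y <> 0) -> Ck T N F ->
  Ck T N (fun x y => / F x y).
Proof.
intros H0; induction N as [|N IH]; intros HF.
- apply Ck_0; intros x y Hb; apply continuity_2d_pt_inv; [|auto].
  eapply Ck_cont; eassumption.
- pose proof (IH (Ck_S _ _ _ HF)) as HI.
  apply (Ck_intro _ _ _ _ _ (partials_inv _ _ _ _ H0 (Ck_partials _ _ _ HF)));
    (apply Ck_mult; [apply Ck_opp, Ck_D; assumption|apply Ck_mult; assumption]).
Qed.

Lemma Ck_swap T N F : Ck T N F -> Ck T N (fun x y => F y x).
Proof.
revert F; induction N as [|N IH]; intros F HF.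
- apply Ck_0; intros x y [Hx Hy] e.
  destruct (Ck_cont _ _ _ y x HF (conj Hy Hx) e) as [d Hd].
  exists d; intros; apply Hd; assumption.
- apply (Ck_intro T N _ (fun x y => D false F y x) (fun x y => D true F y x)).
  + intros x y [Hx Hy]. destruct (Ck_partials _ _ _ HF y x (conj Hy Hx)) as [H1 H2].
    split; assumption.
  + apply IH, Ck_D, HF.
  + apply IH, Ck_D, HF.
Qed.

Lemma Ck_1d T N (g : R -> R) :
  (forall m x, (m <= N)%nat -> ex_derive_n g m x) ->
  (forall x, continuous (Derive_n g N) x) ->
  Ck T N (fun x _ => g x).
Proof.
revert g; induction N as [|N IH]; intros g H Hc.
- apply Ck_0; intros x y _.
  apply (continuity_1d_2d_pt_comp g (fun u _ => u)); [|apply continuity_2d_pt_id1].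
  apply continuity_pt_filterlim, (Hc x).
- apply (Ck_intro T N _ (fun x _ => Derive g x) (fun _ _ => 0)).
  + intros x y _; split; [|apply (is_derive_const (g x))].
    apply Derive_correct, (H 1%nat x); lia.
  + assert (E : forall m x, Derive_n (Derive g) m x = Derive_n g (S m) x).
    { intros m x. change (Derive g) with (Derive_n g 1).
      rewrite Derive_n_comp; f_equal; lia. }
    apply IH.
    * intros [|m] x Hm; [exact I|].
      apply ex_derive_ext with (Derive_n g (S m)); [intros; now rewrite E|].
      apply (H (S (S m)) x); lia.
    * intros x. apply continuous_ext with (Derive_n g (S N)); [intros; now rewrite E|].
      apply Hc.
  + apply Ck_const.
Qed.

Lemma smooth1_Cinf T g : smooth1 g -> Cinf T (fun x _ => g x).
Proof.
intros H N. apply Ck_1d; [intros; apply H|].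
intros x; exact (ex_derive_continuous (Derive_n g N) x (H (S N) x)).
Qed.

Lemma smooth1_Cinf' T g : smooth1 g -> Cinf T (fun _ y => g y).
Proof. intros H N; apply (Ck_swap T N (fun x _ => g x)), smooth1_Cinf, H. Qed.

Lemma smooth2_Cinf T F : smooth2 F -> Cinf T F.
Proof.
intros H N x y _. exact (locally_2d_singleton _ _ _ (H x y) N).
Qed.

Lemma Cinf_smooth_on T r F : r < T -> Cinf T F -> smooth_on r F.
Proof.
intros Hr H x y [Hx Hy]. apply (box_locally T).
- intros u v Huv m; apply H, Huv.
- split; rewrite Rabs_pos_eq; lra.
Qed.

(** * Compactness bounds and integrals from the axes *)

(** Boundedness on the bottom edge is one-variable compactness. By uniform continuity [F] changes by
    less than 1 over a height [e / 2], so the bound grows by 1 for each horizontal strip of that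
    height, and finitely many strips cover the rectangle. *)
Lemma rect_bounded F a b c d :
  (forall x y, a <= x <= b -> c <= y <= d -> continuity_2d_pt F x y) ->
  exists M, 0 <= M /\
    forall x y, a <= x <= b -> c <= y <= d -> Rabs (F x y) <= M.
Proof.
intros H.
destruct (Rle_dec c d) as [Hcd|Hcd]; [|exists 0; split; [lra|intros; lra]].
destruct (uniform_continuity_2d F a b c d H (mkposreal 1 Rlt_0_1)) as [e He].
simpl in He.
assert (Hk : forall k : nat, exists M, 0 <= M /\ forall x y, a <= x <= b ->
  c <= y <= d -> y <= c + INR k * (e / 2) -> Rabs (F x y) <= M).
{ intros k; induction k as [|k [M [HM0 HM]]].
  - destruct (bounded_continuity (fun x => F x c) a b) as [M HM].
    { intros x Hx. apply filterlim_locally; intros eps.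
      destruct (H x c Hx ltac:(lra) eps) as [dd Hd].
      exists dd; intros y Hy; apply Hd; [exact Hy|].
      rewrite Rminus_diag, Rabs_R0; apply cond_pos. }
    exists (Rmax 0 M); split; [apply Rmax_l|].
    intros x y Hx Hy Hy'. simpl in Hy'.
    replace y with c by lra.
    apply Rle_trans with M; [left; exact (HM x Hx)|apply Rmax_r].
  - exists (M + 1); split; [lra|]. intros x y Hx Hy Hy'.
    rewrite S_INR in Hy'. pose proof (cond_pos e).
    destruct (Rle_dec y (c + e / 2)) as [Hs|Hs].
    + assert (Rabs (F x c) <= M).
      { apply HM; try lra. pose proof (pos_INR k). nra. }
      specialize (He x c x y Hx ltac:(lra) Hx Hy).
      rewrite Rminus_diag, Rabs_R0 in He.
      specialize (He (cond_pos e)).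
      assert (Rabs (y - c) < e) by (rewrite Rabs_pos_eq; lra).
      specialize (He H2). pose proof (Rabs_triang_inv (F x y) (F x c)). lra.
    + assert (Rabs (F x (y - e / 2)) <= M) by (apply HM; lra).
      specialize (He x (y - e / 2) x y Hx ltac:(lra) Hx Hy).
      rewrite Rminus_diag, Rabs_R0 in He.
      specialize (He (cond_pos e)).
      assert (Rabs (y - (y - e / 2)) < e) by (rewrite Rabs_pos_eq; lra).
      specialize (He H2).
      pose proof (Rabs_triang_inv (F x y) (F x (y - e / 2))). lra. }
pose proof (cond_pos e).
destruct (nfloor_ex ((d - c) / (e / 2))) as [k [_ Hk2]].
{ apply Rdiv_le_0_compat; lra. }
destruct (Hk (S k)) as [M [HM0 HM]]. exists M; split; [exact HM0|].
intros x y Hx Hy; apply HM; auto.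
rewrite S_INR.
apply Rlt_div_l in Hk2; lra.
Qed.

Lemma Ck_bounded T N F T' :
  Ck T N F -> T' < T ->
  exists M, 0 <= M /\
    forall x y, Rabs x <= T' -> Rabs y <= T' -> Rabs (F x y) <= M.
Proof.
intros HF HT.
destruct (rect_bounded F (- T') T' (- T') T') as [M [HM0 HM]].
- intros x y Hx Hy; apply (Ck_cont T N); [exact HF|].
  split; apply Rle_lt_trans with T'; auto; apply Rabs_le; assumption.
- exists M; split; [exact HM0|]; intros x y Hx Hy.
  apply Rabs_le_between in Hx; apply Rabs_le_between in Hy; auto.
Qed.

Lemma segment_abs y t : Rmin 0 y <= t <= Rmax 0 y -> Rabs t <= Rabs y.
Proof.
unfold Rmin, Rmax, Rabs; destruct (Rle_dec 0 y), (Rcase_abs t), (Rcase_abs y); lra.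
Qed.

Lemma RInt_bound f y M :
  ex_RInt f 0 y -> (forall t, Rabs t <= Rabs y -> Rabs (f t) <= M) ->
  Rabs (RInt f 0 y) <= Rabs y * M.
Proof.
intros Hf HM. destruct (Rle_dec 0 y) as [Hy|Hy].
- rewrite (Rabs_pos_eq y) by assumption.
  replace (y * M) with ((y - 0) * M) by ring.
  apply abs_RInt_le_const; auto. intros t Ht; apply HM.
  rewrite !Rabs_pos_eq; lra.
- apply Rnot_le_lt in Hy. rewrite (Rabs_left y) by assumption.
  rewrite <- (opp_RInt_swap f) by (apply ex_RInt_swap; exact Hf).
  change (Rabs (- RInt f y 0) <= - y * M). rewrite Rabs_Ropp.
  replace (- y * M) with ((0 - y) * M) by ring.
  apply abs_RInt_le_const; [lra|apply ex_RInt_swap; exact Hf|].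
  intros t Ht; apply HM. rewrite (Rabs_left y) by assumption.
  apply Rabs_le; lra.
Qed.

(** Integration starts on an axis, so that [I1 (I2 F)] is the double integral over the rectangle
    spanned by the origin and (x,y). It inverts the mixed derivative and vanishes on both axes. *)
Definition I1 (F : R -> R -> R) (x y : R) : R := RInt (fun s => F s y) 0 x.
Definition I2 (F : R -> R -> R) (x y : R) : R := RInt (F x) 0 y.

Lemma cont_slice T N F x y :
  Ck T N F -> box T x y -> continuous (F x) y.
Proof.
intros HF Hb. apply filterlim_locally; intros e.
destruct (Ck_cont _ _ _ _ _ HF Hb e) as [d Hd].
exists d; intros z Hz; apply Hd; [|exact Hz].
rewrite Rminus_diag, Rabs_R0; apply cond_pos.
Qed.

Lemma ex_RInt_slice T N F x y :
  Ck T N F -> box T x y -> ex_RInt (F x) 0 y.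
Proof.
intros HF [Hx Hy]. apply (ex_RInt_continuous (V := R_CompleteNormedModule)).
intros t Ht. apply (cont_slice T N); [exact HF|].
split; [exact Hx|apply segment_abs in Ht; lra].
Qed.

Lemma I2_derive2 T N F x y :
  Ck T N F -> box T x y -> is_derive (I2 F x) y (F x y).
Proof.
intros HF Hb. apply is_derive_RInt with 0; [|apply (cont_slice T N F x y); auto].
apply (locally_2d_1d_const_x (fun u v => is_RInt (F x) 0 v (I2 F x v)) x y).
destruct (box_open _ _ _ Hb) as [d Hd]. exists d; intros u v _ Hv.
apply (RInt_correct (F x)), (ex_RInt_slice T N); [exact HF|].
apply Hd; [rewrite Rminus_diag, Rabs_R0; apply cond_pos|exact Hv].
Qed.

(** The increment is split into a change of [x] under the integral, controlled by uniform continuity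
    on a compact segment, and a change of the upper limit at fixed [x], where [I2 F x] is
    differentiable. *)
Lemma I2_cont T F x y :
  Ck T 0 F -> box T x y -> continuity_2d_pt (I2 F) x y.
Proof.
intros HF Hb e. pose proof (cond_pos e) as He.
assert (HT : 0 < T) by (destruct Hb as [Hx _]; pose proof (Rabs_pos x); lra).
assert (Hb' := Hb); destruct Hb' as [Hx Hy].
set (T' := (Rabs y + T) / 2).
(* Multiplied by the length of the integration interval, which is below [T], this tolerance yields
   at most [e / 2]. *)
assert (He' : 0 < e / (2 * (T + 1))) by (apply Rdiv_lt_0_compat; lra).
destruct (uniform_continuity_2d_1d' F (- T') T' x) with (eps := mkposreal _ He')
  as [d1 H1].
{ intros t Ht. apply (Ck_cont T 0); [exact HF|].
  split; [exact Hx|]. apply Rle_lt_trans with T'; [apply Rabs_le; lra|unfold T'; lra]. }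
simpl in H1.
assert (Hc : continuous (I2 F x) y).
{ exact (ex_derive_continuous (I2 F x) y (ex_intro _ _ (I2_derive2 T 0 F x y HF Hb))). }
destruct (proj1 (filterlim_locally _ _) Hc (mkposreal (e / 2) ltac:(lra))) as [d2 H2].
destruct (box_open _ _ _ Hb) as [d3 H3].
assert (Hd : 0 < Rmin (Rmin d1 d2) (Rmin d3 (T' - Rabs y))).
{ repeat apply Rmin_pos; try apply cond_pos. unfold T'; lra. }
exists (mkposreal _ Hd); simpl; intros u v Hu Hv.
apply Rmin_Rgt_l in Hu as [Hu Hu3]; apply Rmin_Rgt_l in Hu as [Hu1 Hu2].
apply Rmin_Rgt_l in Hu3 as [Hu3 Hu4].
apply Rmin_Rgt_l in Hv as [Hv Hv3]; apply Rmin_Rgt_l in Hv as [Hv1 Hv2].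
apply Rmin_Rgt_l in Hv3 as [Hv3 Hv4].
specialize (H3 u v Hu3 Hv3).
assert (HvT : Rabs v <= T') by (pose proof (Rabs_triang_inv v y); lra).
specialize (H2 v Hv2). change (Rabs (I2 F x v - I2 F x y) < e / 2) in H2.
assert (Hbv : box T x v) by (split; [exact Hx|apply H3]).
assert (Rabs (I2 F u v - I2 F x v) <= Rabs v * (e / (2 * (T + 1)))).
{ unfold I2.
  assert (E : RInt (F u) 0 v - RInt (F x) 0 v = RInt (fun t => F u t - F x t) 0 v).
  { symmetry; apply (RInt_minus (F u) (F x));
      apply (ex_RInt_slice T 0); assumption. }
  rewrite E. apply RInt_bound.
  - apply (ex_RInt_minus (F u) (F x)); apply (ex_RInt_slice T 0); assumption.
  - intros t Ht. left.
    assert (Htt : - T' <= t <= T') by (apply Rabs_le_between; lra).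
    apply H1; auto.
    + pose proof (cond_pos d1); lra.
    + apply Rlt_le, Rabs_le_between in Hu1; lra.
    + rewrite Rminus_diag, Rabs_R0; apply cond_pos. }
assert (Rabs v * (e / (2 * (T + 1))) <= e / 2).
{ replace (e / 2) with ((T + 1) * (e / (2 * (T + 1)))) by (field; lra).
  apply Rmult_le_compat_r; [lra|]. destruct H3; lra. }
replace (I2 F u v - I2 F x y) with
  ((I2 F u v - I2 F x v) + (I2 F x v - I2 F x y)) by ring.
eapply Rle_lt_trans; [apply Rabs_triang|]. lra.
Qed.

Lemma I2_derive1 T F x y :
  Ck T 1 F -> box T x y ->
  is_derive (fun s => I2 F s y) x (I2 (D true F) x y).
Proof.
intros HF Hb. pose proof Hb as [Hx Hy].
destruct (box_open _ _ _ Hb) as [d Hd].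
apply (is_derive_RInt_param F 0 y x).
- exists d; intros u Hu t Ht. apply segment_abs in Ht.
  assert (Hub : box T u y).
  { apply Hd; [exact Hu|rewrite Rminus_diag, Rabs_R0; apply cond_pos]. }
  exists (D true F u t). apply (Ck_partials T 0 F HF).
  destruct Hub; split; lra.
- intros t Ht; apply segment_abs in Ht.
  apply (Ck_cont T 0 (D true F)); [apply Ck_D, HF|split; lra].
- exists d; intros u Hu.
  apply (ex_RInt_slice T 1); [exact HF|].
  apply Hd; [exact Hu|rewrite Rminus_diag, Rabs_R0; apply cond_pos].
Qed.

Lemma Ck_I2 T N F : Ck T N F -> Ck T N (I2 F).
Proof.
revert F; induction N as [|N IH]; intros F HF.
- apply Ck_0; intros x y Hb; apply (I2_cont T); assumption.
- apply (Ck_intro T N _ (I2 (D true F)) F).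
  + intros x y Hb; split.
    * apply (I2_derive1 T); [|exact Hb]. intros u v Huv.
      apply ex_diff_n_m with (S N); [lia|exact (HF u v Huv)].
    * apply (I2_derive2 T (S N)); assumption.
  + apply IH, Ck_D, HF.
  + apply Ck_S, HF.
Qed.

Lemma Ck_I1 T N F : Ck T N F -> Ck T N (I1 F).
Proof.
intros HF. apply (Ck_swap T N (I2 (fun x y => F y x))), Ck_I2.
apply (Ck_swap T N F), HF.
Qed.

Lemma I1_derive1 T N F x y :
  Ck T N F -> box T x y -> is_derive (fun s => I1 F s y) x (F x y).
Proof.
intros HF [Hx Hy].
apply (I2_derive2 T N (fun x y => F y x) y x); [apply (Ck_swap T N F), HF|split; auto].
Qed.

(** Only the partial derivative in the second variable enters. In the Goursat problem [F] is [I2] of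
    a source that is at that stage merely continuous, so nothing is known about its other
    partial. *)
Lemma I1_derive2 T F F2 x y :
  Ck T 0 F -> Ck T 0 F2 ->
  (forall u v, box T u v -> is_derive (F u) v (F2 u v)) ->
  box T x y -> is_derive (I1 F x) y (I1 F2 x y).
Proof.
intros HF HF2 HD Hb. pose proof Hb as [Hx Hy].
destruct (box_open _ _ _ Hb) as [d Hd].
assert (Hs : forall v, Rabs (v - y) < d -> Rabs v < T).
{ intros v Hv. apply (Hd x v); [rewrite Rminus_diag, Rabs_R0; apply cond_pos|exact Hv]. }
assert (E : forall u v, box T u v -> Derive (fun z => F u z) v = F2 u v).
{ intros u v Huv; apply is_derive_unique, HD, Huv. }
replace (I1 F2 x y) with (RInt (fun t => Derive (fun u => F t u) y) 0 x).
- apply (is_derive_RInt_param (fun v t => F t v) 0 x y).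
  + exists d; intros v Hv t Ht. apply segment_abs in Ht.
    exists (F2 t v); apply HD; split; [lra|apply Hs, Hv].
  + intros t Ht; apply segment_abs in Ht.
    apply continuity_2d_pt_ext_loc with (fun u v => F2 v u).
    * apply (box_locally T); [|split; lra].
      intros u v [Hu Hv]; symmetry; apply (E v u); split; assumption.
    * apply (Ck_cont T 0); [apply (Ck_swap T 0 F2), HF2|split; lra].
  + exists d; intros v Hv.
    apply (ex_RInt_slice T 0 (fun x y => F y x)); [apply (Ck_swap T 0 F), HF|].
    split; [apply Hs, Hv|exact Hx].
- apply RInt_ext; intros t Ht.
  apply E; split; [|exact Hy].
  assert (Rabs t <= Rabs x) by (apply segment_abs; lra). lra.
Qed.

Lemma Cinf_intro T F F1 F2 :
  partials T F F1 F2 -> Cinf T F1 -> Cinf T F2 -> Cinf T F.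
Proof. intros HP H1 H2 N; apply Ck_S; eapply Ck_intro; eauto. Qed.

Lemma Cinf_D T b F : Cinf T F -> Cinf T (D b F).
Proof. intros HF N; apply Ck_D, HF. Qed.

Lemma Cinf_partials T F : Cinf T F -> partials T F (D true F) (D false F).
Proof. intros HF; exact (Ck_partials T 0 F (HF 1%nat)). Qed.

(** * Potentials of closed forms and the Moutard equation *)

(** Poincare lemma on the box: integrate [P] along the first axis, then [S] vertically. In the
    derivative with respect to x, closedness turns the integral of [D true S] into that of
    [D false P], which is [P x y - P x 0]. *)
Lemma potential_exists T P S c :
  0 < T -> Cinf T P -> Cinf T S ->
  (forall x y, box T x y -> D false P x y = D true S x y) ->
  exists Phi, Cinf T Phi /\ Phi 0 0 = c /\ partials T Phi P S.
Proof.
intros HT HP HS Hcomp.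
set (Phi := fun x y => (c + I1 P x 0) + I2 S x y).
assert (Hp : partials T Phi P S).
{ intros x y [Hx Hy]. split.
  - replace (P x y) with ((0 + P x 0) + I2 (D true S) x y).
    + refine (is_derive_plus (fun s => c + I1 P s 0) (fun s => I2 S s y) _ _ _ _ _).
      * refine (is_derive_plus (fun _ => c) (fun s => I1 P s 0) _ _ _ _ _).
        -- apply (is_derive_const c).
        -- apply (I1_derive1 T 0); [apply HP|split; [exact Hx|rewrite Rabs_R0; exact HT]].
      * apply (I2_derive1 T); [apply HS|split; assumption].
    + assert (E : I2 (D true S) x y = P x y - P x 0).
      { unfold I2. rewrite <- (RInt_Derive (P x) 0 y).
        - apply RInt_ext; intros t Ht. symmetry; apply (Hcomp x t).
          split; [exact Hx|]. assert (Rabs t <= Rabs y) by (apply segment_abs; lra). lra.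
        - intros t Ht; apply segment_abs in Ht.
          exists (D false P x t). apply (Cinf_partials T P HP); split; lra.
        - intros t Ht; apply segment_abs in Ht.
          apply (cont_slice T 0 (D false P) x t); [apply Cinf_D, HP|split; lra]. }
      rewrite E; ring.
  - replace (S x y) with (0 + S x y) by ring.
    refine (is_derive_plus (fun _ => c + I1 P x 0) (I2 S x) _ _ _ _ _).
    + apply (is_derive_const (c + I1 P x 0)).
    + apply (I2_derive2 T 0); [apply HS|split; assumption]. }
exists Phi; split; [|split; [|exact Hp]].
- exact (Cinf_intro _ _ _ _ Hp HP HS).
- unfold Phi, I1, I2. rewrite !RInt_point. unfold zero; simpl; ring.
Qed.

(* Both mixed derivatives are recorded, which avoids appeals to Schwarz. *)
Definition moutard (T : R) (q u : R -> R -> R) : Prop :=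
  Cinf T u /\
  forall x y, box T x y ->
    D true (D false u) x y = q x y * u x y /\
    D false (D true u) x y = q x y * u x y.

(** In both cross derivatives the terms with [q] cancel, and D1 u D2 v - D2 u D1 v is left on either
    side. The coordinates of the surface and of [M] are potentials of this kind. *)
Lemma moutard_potential T q u v c :
  0 < T -> moutard T q u -> moutard T q v ->
  exists Phi, Cinf T Phi /\ Phi 0 0 = c /\
    partials T Phi (fun x y => D true u x y * v x y - u x y * D true v x y)
      (fun x y => u x y * D false v x y - D false u x y * v x y).
Proof.
intros HT [Hu Eu] [Hv Ev].
pose proof (Cinf_partials _ _ Hu) as Pu; pose proof (Cinf_partials _ _ Hv) as Pv.
assert (P2 : forall b F, Cinf T F ->
  partials T (D b F) (D true (D b F)) (D false (D b F))).
{ intros b F HF; apply Cinf_partials, Cinf_D, HF. }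
apply potential_exists; [exact HT| | |].
- intros N; apply Ck_minus; apply Ck_mult; try (apply Ck_D); auto.
- intros N; apply Ck_minus; apply Ck_mult; try (apply Ck_D); auto.
- intros x y Hb.
  rewrite (proj2 (partials_D _ _ _ _ x y (partials_minus _ _ _ _ _ _ _
    (partials_mult _ _ _ _ _ _ _ (P2 true _ Hu) Pv)
    (partials_mult _ _ _ _ _ _ _ Pu (P2 true _ Hv))) Hb)).
  rewrite (proj1 (partials_D _ _ _ _ x y (partials_minus _ _ _ _ _ _ _
    (partials_mult _ _ _ _ _ _ _ Pu (P2 false _ Hv))
    (partials_mult _ _ _ _ _ _ _ (P2 false _ Hu) Pv)) Hb)).
  destruct (Eu x y Hb) as [-> ->], (Ev x y Hb) as [-> ->]. ring.
Qed.

(* Clamping the arguments makes every Picard iterate total and globally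
   continuous, and leaves the equation unchanged on the box. *)
Definition clamp (T x : R) : R := Rmax (- T) (Rmin x T).

Lemma clamp_abs T x : 0 <= T -> Rabs (clamp T x) <= T.
Proof.
intros HT; unfold clamp, Rmax, Rmin.
destruct (Rle_dec x T), (Rle_dec _ _); apply Rabs_le; lra.
Qed.

Lemma clamp_id T x : Rabs x <= T -> clamp T x = x.
Proof.
intros H; apply Rabs_le_between in H; unfold clamp, Rmax, Rmin.
destruct (Rle_dec x T), (Rle_dec _ _); lra.
Qed.

Lemma clamp_lip T x y : Rabs (clamp T x - clamp T y) <= Rabs (x - y).
Proof.
unfold clamp, Rmax, Rmin; destruct (Rle_dec x T), (Rle_dec y T);
repeat match goal with
| |- context [Rle_dec ?a ?b] => destruct (Rle_dec a b)
end; unfold Rabs; repeat destruct (Rcase_abs _); lra.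
Qed.

Definition cont2 (F : R -> R -> R) : Prop := forall T, Ck T 0 F.

Lemma cont2_pt F : (forall x y, continuity_2d_pt F x y) -> cont2 F.
Proof. intros H T; apply Ck_0; intros; apply H. Qed.

Lemma pt_cont2 F x y : cont2 F -> continuity_2d_pt F x y.
Proof.
intros H; apply (Ck_cont (Rabs x + Rabs y + 1) 0); [apply H|].
pose proof (Rabs_pos x); pose proof (Rabs_pos y); split; lra.
Qed.

Lemma cont2_clamp T F : cont2 F -> cont2 (fun x y => F (clamp T x) (clamp T y)).
Proof.
intros HF; apply cont2_pt; intros x y e.
destruct (pt_cont2 F (clamp T x) (clamp T y) HF e) as [d Hd].
exists d; intros u v Hu Hv; apply Hd;
  (eapply Rle_lt_trans; [apply clamp_lip|assumption]).
Qed.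

Lemma cont2_bounded F T : cont2 F ->
  exists M, 0 <= M /\
    forall x y, Rabs x <= T -> Rabs y <= T -> Rabs (F x y) <= M.
Proof. intros HF; apply (Ck_bounded (T + 1) 0); [apply HF|lra]. Qed.

(** * Picard iteration for the Goursat problem *)

Section Picard.

Context (T Q : R) (q G : R -> R -> R).
Context (HT : 0 < T) (HQ : T * T * Q <= / 2).
Context (Hq : cont2 q) (HG : cont2 G).
Context (q_bound : forall x y, Rabs x <= T -> Rabs y <= T -> Rabs (q x y) <= Q).

(** Integral form of u_xy = q u. The double integral vanishes on the axes, so the boundary values
    are carried by [G]. *)
Definition picard_op (U : R -> R -> R) (x y : R) : R :=
  G (clamp T x) (clamp T y) +
  I1 (I2 (fun s t => q s t * U s t)) (clamp T x) (clamp T y).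

Lemma cont2_source U : cont2 U -> cont2 (fun s t => q s t * U s t).
Proof. intros HU S; apply Ck_mult; [apply Hq|apply HU]. Qed.

Lemma picard_op_cont U : cont2 U -> cont2 (picard_op U).
Proof.
intros HU S; apply Ck_plus; revert S; apply cont2_clamp; [exact HG|].
intros S; apply Ck_I1, Ck_I2, (cont2_source _ HU).
Qed.

Lemma ex_RInt_cont2 F x y : cont2 F -> ex_RInt (F x) 0 y.
Proof.
intros HF; apply (ex_RInt_slice (Rabs x + Rabs y + 1) 0); [apply HF|].
pose proof (Rabs_pos x); pose proof (Rabs_pos y); split; lra.
Qed.

Lemma cont2_swap F : cont2 F -> cont2 (fun x y => F y x).
Proof. intros HF S; apply Ck_swap, HF. Qed.

(** The clamped rectangle has sides at most [T], so a change of [U] by [M] changes the double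
    integral by at most [T * T * Q * M], and [HQ] makes this at most [M / 2]. *)
Lemma picard_op_contract U V M :
  cont2 U -> cont2 V -> (forall x y, Rabs (U x y - V x y) <= M) ->
  forall x y, Rabs (picard_op U x y - picard_op V x y) <= M / 2.
Proof.
intros HU HV HM x y. unfold picard_op.
set (x' := clamp T x); set (y' := clamp T y).
assert (Hx : Rabs x' <= T) by (apply clamp_abs; lra).
assert (Hy : Rabs y' <= T) by (apply clamp_abs; lra).
pose proof (cont2_source _ HU) as HqU; pose proof (cont2_source _ HV) as HqV.
set (A := fun s t => q s t * U s t) in *; set (B := fun s t => q s t * V s t) in *.
assert (HA2 : cont2 (I2 A)) by (intros S; apply Ck_I2, HqU).
assert (HB2 : cont2 (I2 B)) by (intros S; apply Ck_I2, HqV).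
pose proof (ex_RInt_cont2 _ y' x' (cont2_swap _ HA2)) as HA3.
pose proof (ex_RInt_cont2 _ y' x' (cont2_swap _ HB2)) as HB3.
replace (_ - _) with (I1 (I2 A) x' y' - I1 (I2 B) x' y') by ring.
assert (HM0 : 0 <= M) by (specialize (HM 0 0); pose proof (Rabs_pos (U 0 0 - V 0 0)); lra).
assert (HQ0 : 0 <= Q).
{ specialize (q_bound 0 0); rewrite Rabs_R0 in q_bound.
  pose proof (Rabs_pos (q 0 0)). specialize (q_bound ltac:(lra) ltac:(lra)); lra. }
assert (Hin : forall s, Rabs s <= Rabs x' -> Rabs (I2 A s y' - I2 B s y') <= T * (Q * M)).
{ intros s Hs. unfold I2.
  rewrite <- (RInt_minus (A s) (B s)) by (apply ex_RInt_cont2; assumption).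
  apply Rle_trans with (Rabs y' * (Q * M)).
  - apply (RInt_bound (fun t => minus (A s t) (B s t))).
    + apply (ex_RInt_minus (A s) (B s)); apply ex_RInt_cont2; assumption.
    + intros t Ht. change (Rabs (A s t - B s t) <= Q * M). unfold A, B.
      rewrite <- Rmult_minus_distr_l, Rabs_mult.
      apply Rmult_le_compat; try apply Rabs_pos; [apply q_bound; lra|apply HM].
  - apply Rmult_le_compat_r; [apply Rmult_le_pos; lra|exact Hy]. }
unfold I1.
rewrite <- (RInt_minus (fun s => I2 A s y') (fun s => I2 B s y')) by assumption.
apply Rle_trans with (Rabs x' * (T * (Q * M))).
- apply (RInt_bound (fun s => minus (I2 A s y') (I2 B s y'))); [|exact Hin].
  apply (ex_RInt_minus (fun s => I2 A s y') (fun s => I2 B s y')); assumption.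
- apply Rle_trans with (T * (T * (Q * M))).
  + apply Rmult_le_compat_r; [|exact Hx]. repeat apply Rmult_le_pos; lra.
  + replace (T * (T * (Q * M))) with (T * T * Q * M) by ring.
    replace (M / 2) with (/ 2 * M) by field.
    apply Rmult_le_compat_r; lra.
Qed.

Fixpoint picard (n : nat) : R -> R -> R :=
  match n with O => fun _ _ => 0 | S n => picard_op (picard n) end.

Lemma picard_cont n : cont2 (picard n).
Proof.
induction n as [|n IH]; [|exact (picard_op_cont _ IH)].
intros S; exact (Ck_const S 0 0).
Qed.

Lemma picard_op_clamp U x y :
  picard_op U (clamp T x) (clamp T y) = picard_op U x y.
Proof.
unfold picard_op; rewrite !(clamp_id T (clamp T _)) by (apply clamp_abs; lra).
reflexivity.
Qed.

Lemma picard_fixpoint : exists u, cont2 u /\ forall x y, u x y = picard_op u x y.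
Proof.
(* A bound on the square of half-width [T] is global, because [picard_op] sees its arguments only
   through [clamp]. *)
destruct (cont2_bounded (picard 1) T (picard_cont 1)) as [C [HC0 HC]].
assert (Hstep : forall n x y,
  Rabs (picard (S n) x y - picard n x y) <= C * (/ 2) ^ n).
{ induction n as [|n IH]; intros x y.
  - change (Rabs (picard_op (picard 0) x y - 0) <= C * 1).
    rewrite Rminus_0_r, Rmult_1_r, <- picard_op_clamp.
    apply (HC (clamp T x) (clamp T y)); apply clamp_abs; lra.
  - replace (C * (/ 2) ^ S n) with (C * (/ 2) ^ n / 2) by (simpl; field).
    exact (picard_op_contract _ _ _ (picard_cont (S n)) (picard_cont n) IH x y). }
(* The subtracted term lets the induction on [p] close: adding one more step [C * (/ 2) ^ (p + n)]
   replaces it by its half. *)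
assert (Htail : forall p n x y, Rabs (picard (p + n) x y - picard n x y)
  <= 2 * C * (/ 2) ^ n - 2 * C * (/ 2) ^ (p + n)).
{ induction p as [|p IH]; intros n x y.
  - simpl. rewrite !Rminus_diag, Rabs_R0; lra.
  - specialize (IH n x y). specialize (Hstep (p + n)%nat x y).
    change (S p + n)%nat with (S (p + n)).
    replace (picard (S (p + n)) x y - picard n x y) with
      ((picard (S (p + n)) x y - picard (p + n) x y) +
       (picard (p + n) x y - picard n x y)) by ring.
    eapply Rle_trans; [apply Rabs_triang|].
    replace ((/ 2) ^ S (p + n)) with (/ 2 * (/ 2) ^ (p + n)) by reflexivity. lra. }
assert (Hpow : forall n, 0 < (/ 2) ^ n) by (intros; apply pow_lt; lra).
assert (Hsmall : forall e, 0 < e -> exists n, 2 * C * (/ 2) ^ n < e).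
{ intros e He. assert (He' : 0 < e / (2 * C + 1)) by (apply Rdiv_lt_0_compat; lra).
  destruct (pow_lt_1_zero (/ 2)) with (y := e / (2 * C + 1)) as [n Hn];
    [rewrite Rabs_pos_eq; lra|exact He'|].
  exists n. specialize (Hn n (Nat.le_refl n)).
  rewrite Rabs_pos_eq in Hn by (left; auto).
  apply Rlt_div_r in Hn; [|lra]. specialize (Hpow n). nra. }
assert (Hmono : forall n p, (n <= p)%nat -> forall x y,
  Rabs (picard p x y - picard n x y) <= 2 * C * (/ 2) ^ n).
{ intros n p Hp x y. specialize (Htail (p - n)%nat n x y).
  replace (p - n + n)%nat with p in Htail by lia.
  specialize (Hpow p). nra. }
set (u := fun x y => real (Lim_seq (fun n => picard n x y))).
assert (Hlim : forall x y, is_lim_seq (fun n => picard n x y) (u x y)).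
{ intros x y. apply Lim_seq_correct', ex_lim_seq_cauchy_corr.
  intros e. destruct (Hsmall (e / 2)) as [N HN]; [pose proof (cond_pos e); lra|].
  exists N; intros n m Hn Hm.
  pose proof (Hmono N n Hn x y) as H1. pose proof (Hmono N m Hm x y) as H2.
  rewrite Rabs_minus_sym in H2.
  replace (picard n x y - picard m x y) with
    ((picard n x y - picard N x y) + (picard N x y - picard m x y)) by ring.
  eapply Rle_lt_trans; [apply Rabs_triang|]. lra. }
assert (Hu : forall n x y, Rabs (u x y - picard n x y) <= 2 * C * (/ 2) ^ n).
{ intros n x y.
  assert (HL : is_lim_seq (fun p => Rabs (picard (p + n) x y - picard n x y))
    (Rabs (u x y - picard n x y))).
  { apply (is_lim_seq_abs _ (Finite _)).
    apply is_lim_seq_minus'; [|apply is_lim_seq_const].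
    apply (is_lim_seq_incr_n (fun n => picard n x y) n), Hlim. }
  refine (is_lim_seq_le _ _ (Finite _) (Finite _) _ HL
    (is_lim_seq_const (2 * C * (/ 2) ^ n))).
  intros p; apply Hmono; lia. }
exists u.
assert (Hc : cont2 u).
{ apply cont2_pt; intros x y e.
  destruct (Hsmall (e / 3)) as [n Hn]; [pose proof (cond_pos e); lra|].
  assert (He3 : 0 < e / 3) by (pose proof (cond_pos e); lra).
  destruct (pt_cont2 _ x y (picard_cont n) (mkposreal _ He3)) as [d Hd].
  exists d; intros s t Hs Ht. specialize (Hd s t Hs Ht). simpl in Hd.
  pose proof (Hu n s t) as H1. pose proof (Hu n x y) as H2.
  rewrite Rabs_minus_sym in H2.
  replace (u s t - u x y) with ((u s t - picard n s t) +
    ((picard n s t - picard n x y) + (picard n x y - u x y))) by ring.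
  eapply Rle_lt_trans; [apply Rabs_triang|].
  pose proof (Rabs_triang (picard n s t - picard n x y) (picard n x y - u x y)). lra. }
split; [exact Hc|]. intros x y.
(* Both [u] and [picard_op u] are within [C * (/ 2) ^ n] of the iterate of index [S n]. *)
apply cond_eq; intros e He.
destruct (Hsmall (e / 2)) as [n Hn]; [lra|].
pose proof (Hu (S n) x y) as H1.
pose proof (picard_op_contract _ _ _ Hc (picard_cont n) (Hu n) x y) as H2.
rewrite Rabs_minus_sym in H2.
replace (u x y - picard_op u x y) with
  ((u x y - picard (S n) x y) + (picard_op (picard n) x y - picard_op u x y))
  by (simpl; ring).
eapply Rle_lt_trans; [apply Rabs_triang|].
replace ((/ 2) ^ S n) with (/ 2 * (/ 2) ^ n) in H1 by reflexivity.
specialize (Hpow n). lra.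
Qed.

End Picard.

(** The quantifiers matter: [T] is chosen before the boundary values, so one box serves several
    Goursat problems with the same [q]. *)
Lemma goursat_exists (q : R -> R -> R) :
  (forall T, Cinf T q) ->
  exists T, 0 < T /\ forall h1 h2 : R -> R,
    (forall T', Cinf T' (fun x _ => h1 x)) ->
    (forall T', Cinf T' (fun _ y => h2 y)) -> h1 0 = h2 0 ->
    exists u, moutard T q u /\
      (forall x, Rabs x < T -> u x 0 = h1 x) /\
      (forall y, Rabs y < T -> u 0 y = h2 y).
Proof.
intros Hq.
assert (Hqc : cont2 q) by (intros T; apply Hq).
destruct (cont2_bounded q 1 Hqc) as [Q [HQ0 HQ]].
(* This gives [T <= / 2], hence the box lies in the square where [Q] bounds [q], and also the
   contraction condition [T * T * Q <= / 2]. *)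
set (T := / (2 * (Q + 1))).
assert (HTQ : T * (Q + 1) = / 2) by (unfold T; field; lra).
assert (HT : 0 < T) by (apply Rinv_0_lt_compat; lra).
assert (HT2 : T <= / 2) by nra.
exists T; split; [exact HT|]. intros h1 h2 H1 H2 H12.
(* The solution of G_xy = 0 with the prescribed values on both axes; [h1 0 = h2 0] is what makes it
   fit on the second one. *)
set (G := fun x y => h1 x + h2 y - h1 0).
assert (HG : forall T', Cinf T' G).
{ intros T' N; apply Ck_minus; [apply Ck_plus; [apply H1|apply H2]|apply Ck_const]. }
destruct (picard_fixpoint T Q q G HT) as [u [Hu Eu]].
- nra.
- exact Hqc.
- intros T'; apply HG.
- intros x y Hx Hy; apply HQ; lra.
- set (F := fun s t => q s t * u s t).
  assert (EuT : forall x y, box T x y -> G x y + I1 (I2 F) x y = u x y).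
  { intros x y [Hx Hy]. rewrite (Eu x y). unfold picard_op.
    rewrite !clamp_id by lra. reflexivity. }
  assert (HF0 : Ck T 0 F) by (apply Ck_mult; [apply Hq|apply Hu]).
  assert (HP : partials T u (fun x y => D true G x y + I2 F x y)
                            (fun x y => D false G x y + I1 F x y)).
  { apply partials_ext with (fun x y => G x y + I1 (I2 F) x y)
      (fun x y => D true G x y + I2 F x y) (fun x y => D false G x y + I1 F x y);
      [exact EuT|reflexivity|reflexivity|].
    apply partials_plus; [apply Cinf_partials, HG|].
    intros x y Hb; split.
    - apply (I1_derive1 T 0); [apply Ck_I2|]; assumption.
    - apply (I1_derive2 T); try assumption; [apply Ck_I2, HF0|].
      intros s t Hst; apply (I2_derive2 T 0); assumption. }
  (* Bootstrap: the partials of [u] given by [HP] contain only integrals of [q * u], so [u] of class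
     N makes them of class N and [u] of class N + 1. *)
  assert (HuN : Cinf T u).
  { intros N; induction N as [|N IH]; [apply Hu|].
    assert (HF : Ck T N F) by (apply Ck_mult; [apply Hq|exact IH]).
    apply (Ck_intro _ _ _ _ _ HP); apply Ck_plus;
      try (apply Ck_D, HG); [apply Ck_I2, HF|apply Ck_I1, HF]. }
  (* A first partial of [G] depends on one variable only, so the mixed derivatives of [u] come from
     the integral term alone. *)
  assert (HGc : forall x, D true G x = fun y => Derive h1 x).
  { intros x. apply functional_extensionality; intros y. unfold D, G.
    apply is_derive_unique.
    assert (Hh : is_derive h1 x (Derive h1 x)).
    { apply (Cinf_partials (Rabs x + 1) (fun x _ => h1 x) (H1 _) x 0).
      pose proof (Rabs_pos x); split; rewrite ?Rabs_R0; lra. }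
    auto_derive; [exists (Derive h1 x); exact Hh|].
    apply Rmult_1_l. }
  assert (HGc2 : forall y, (fun x => D false G x y) = fun x => Derive h2 y).
  { intros y. apply functional_extensionality; intros x. unfold D, G.
    apply is_derive_unique.
    assert (Hh : is_derive h2 y (Derive h2 y)).
    { apply (Cinf_partials (Rabs y + 1) (fun _ y => h2 y) (H2 _) 0 y).
      pose proof (Rabs_pos y); split; rewrite ?Rabs_R0; lra. }
    auto_derive; [exists (Derive h2 y); exact Hh|].
    apply Rmult_1_l. }
  exists u; split; [split; [exact HuN|]|split].
  + intros x y Hb. split.
    * apply is_derive_unique.
      apply is_derive_ext_loc with (fun s => Derive h2 y + I1 F s y).
      -- apply (locally_2d_1d_const_y
           (fun s t => Derive h2 t + I1 F s t = D false u s t)).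
         apply (box_locally T); [|exact Hb]. intros s t Hst.
         rewrite (proj2 (partials_D _ _ _ _ s t HP Hst)).
         f_equal. exact (eq_sym (f_equal (fun f => f s) (HGc2 t))).
      -- replace (q x y * u x y) with (0 + F x y) by (unfold F; ring).
         refine (is_derive_plus (fun _ => Derive h2 y) (fun s => I1 F s y) _ _ _ _ _).
         ++ apply (is_derive_const (Derive h2 y)).
         ++ apply (I1_derive1 T 0); assumption.
    * apply is_derive_unique.
      apply is_derive_ext_loc with (fun t => Derive h1 x + I2 F x t).
      -- apply (locally_2d_1d_const_x
           (fun s t => Derive h1 s + I2 F s t = D true u s t)).
         apply (box_locally T); [|exact Hb]. intros s t Hst.
         rewrite (proj1 (partials_D _ _ _ _ s t HP Hst)), HGc. reflexivity.
      -- replace (q x y * u x y) with (0 + F x y) by (unfold F; ring).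
         refine (is_derive_plus (fun _ => Derive h1 x) (I2 F x) _ _ _ _ _).
         ++ apply (is_derive_const (Derive h1 x)).
         ++ apply (I2_derive2 T 0); assumption.
  + intros x Hx. rewrite <- EuT by (split; [|rewrite Rabs_R0]; assumption).
    unfold G, I1.
    rewrite (RInt_ext _ (fun _ => 0)).
    * rewrite RInt_const, <- H12. unfold scal; simpl; unfold mult; simpl. ring.
    * intros s _. apply (RInt_point (V := R_CompleteNormedModule)).
  + intros y Hy. rewrite <- EuT by (split; [rewrite Rabs_R0|]; assumption).
    unfold G, I1. rewrite RInt_point. unfold zero; simpl; ring.
Qed.

(** * Difference quotients bounded uniformly in the mesh size *)

(* Lattice functions depending on the mesh size, which is the first argument. *)
Definition family := R -> nat -> nat -> R.

Definition sh (b : bool) (g : family) : family := fun e k l =>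
  if b then g e (S k) l else g e k (S l).

Definition dl (b : bool) (g : family) : family := fun e k l =>
  (sh b g e k l - g e k l) / e.

(* Quantifying over all [T' < T] makes these notions stable under shifts: a shift
   only moves the grid on [0,T']^2 into a slightly larger square. *)
Definition evg (T : R) (P : R -> nat -> nat -> Prop) : Prop :=
  forall T', T' < T -> at_right 0 (fun e =>
    forall k l, INR k * e <= T' -> INR l * e <= T' -> P e k l).

Definition bnd (T : R) (g : family) : Prop :=
  forall T', T' < T -> exists c, at_right 0 (fun e =>
    forall k l, INR k * e <= T' -> INR l * e <= T' -> Rabs (g e k l) <= c).

(** Discrete counterpart of a C^N bound, uniform as the mesh tends to 0. The constants may depend on
    the smaller square and on the word of directions. *)
Fixpoint Bc (T : R) (N : nat) (g : family) : Prop :=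
  bnd T g /\ match N with O => True | S N => forall b, Bc T N (dl b g) end.

Lemma at_right_lt d : 0 < d -> at_right 0 (fun e => 0 < e < d).
Proof.
intros Hd. exists (mkposreal d Hd). intros e He H0. split; [exact H0|].
change (Rabs (e - 0) < d) in He. rewrite Rminus_0_r, Rabs_pos_eq in He; lra.
Qed.

Lemma at_right_and (P Q : R -> Prop) :
  at_right 0 P -> at_right 0 Q -> at_right 0 (fun e => P e /\ Q e).
Proof. apply filter_and. Qed.

Lemma at_right_imp (P Q : R -> Prop) :
  (forall e, 0 < e -> P e -> Q e) -> at_right 0 P -> at_right 0 Q.
Proof.
intros H [d Hd]. exists d; intros e He H0; apply H; auto.
Qed.

Lemma evg_imp T (P Q : R -> nat -> nat -> Prop) :
  (forall e k l, 0 < e -> P e k l -> Q e k l) -> evg T P -> evg T Q.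
Proof.
intros H HP T' HT. apply at_right_imp with (2 := HP T' HT). auto.
Qed.

Lemma evg_pos T (P : R -> nat -> nat -> Prop) :
  (forall e k l, 0 < e -> P e k l) -> evg T P.
Proof.
intros H T' _. apply at_right_imp with (2 := at_right_lt 1 Rlt_0_1). auto.
Qed.

Lemma evg_and T (P Q : R -> nat -> nat -> Prop) :
  evg T P -> evg T Q -> evg T (fun e k l => P e k l /\ Q e k l).
Proof.
intros HP HQ T' HT.
apply at_right_imp with (2 := at_right_and _ _ (HP T' HT) (HQ T' HT)).
intros e _ [H1 H2] k l Hk Hl; auto.
Qed.

Lemma evg_box T (P : R -> R -> Prop) :
  (forall x y, box T x y -> P x y) ->
  evg T (fun e k l => P (INR k * e) (INR l * e)).
Proof.
intros H T' HT. apply at_right_imp with (2 := at_right_lt 1 Rlt_0_1).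
intros e He _ k l Hk Hl. pose proof (pos_INR k). pose proof (pos_INR l).
apply H; split; rewrite Rabs_pos_eq; try nra.
Qed.

Lemma evg_shift (b : bool) T (P : R -> nat -> nat -> Prop) :
  evg T P -> evg T (fun e k l => if b then P e (S k) l else P e k (S l)).
Proof.
intros HP T' HT. set (T2 := (T' + T) / 2).
apply at_right_imp with (2 := at_right_and _ _ (HP T2 ltac:(unfold T2; lra))
  (at_right_lt (T2 - T') ltac:(unfold T2; lra))).
intros e He [H1 H2] k l Hk Hl.
destruct b; apply H1; rewrite ?S_INR; lra.
Qed.

Lemma bnd_sh T b g : bnd T g -> bnd T (sh b g).
Proof.
intros Hg T' HT. set (T2 := (T' + T) / 2).
destruct (Hg T2 ltac:(unfold T2; lra)) as [c Hc]. exists c.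
apply at_right_imp with (2 := at_right_and _ _ Hc
  (at_right_lt (T2 - T') ltac:(unfold T2; lra))).
intros e He [H1 H2] k l Hk Hl.
unfold sh; destruct b; apply H1; rewrite ?S_INR; lra.
Qed.

Lemma bnd_ext T g h : evg T (fun e k l => g e k l = h e k l) -> bnd T g -> bnd T h.
Proof.
intros He Hg T' HT. destruct (Hg T' HT) as [c Hc]. exists c.
apply at_right_imp with (2 := at_right_and _ _ Hc (He T' HT)).
intros e _ [H1 H2] k l Hk Hl. rewrite <- H2; auto.
Qed.

Lemma evg_dl T b g h : evg T (fun e k l => g e k l = h e k l) ->
  evg T (fun e k l => dl b g e k l = dl b h e k l).
Proof.
intros H. apply evg_imp with (2 := evg_and _ _ _ H (evg_shift b _ _ H)).
intros e k l _ [H1 H2]. unfold dl, sh. rewrite H1. destruct b; rewrite H2; reflexivity.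
Qed.

Lemma Bc_bnd T N g : Bc T N g -> bnd T g.
Proof. destruct N; intros H; apply H. Qed.

Lemma Bc_0 T g : bnd T g -> Bc T 0 g.
Proof. split; auto. Qed.

Lemma Bc_S T N g : Bc T (S N) g -> Bc T N g.
Proof.
revert g; induction N as [|N IH]; intros g [H1 H2].
- apply Bc_0, H1.
- split; [exact H1|]. intros b; apply IH, H2.
Qed.

Lemma Bc_ext T N g h :
  evg T (fun e k l => g e k l = h e k l) -> Bc T N g -> Bc T N h.
Proof.
revert g h; induction N as [|N IH]; intros g h He Hg.
- apply Bc_0, (bnd_ext T g); [exact He|apply Hg].
- split; [apply (bnd_ext T g); [exact He|apply Hg]|].
  intros b; apply (IH (dl b g)); [apply evg_dl, He|apply Hg].
Qed.

Lemma Bc_ext_pos T N (g h : family) :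
  (forall e k l, 0 < e -> g e k l = h e k l) -> Bc T N g -> Bc T N h.
Proof. intros H; apply Bc_ext, evg_pos, H. Qed.

Lemma dl_sh b b' g : dl b (sh b' g) = sh b' (dl b g).
Proof. destruct b, b'; reflexivity. Qed.

Lemma dl_dl b b' g : dl b (dl b' g) = dl b' (dl b g).
Proof.
extensionality e; extensionality k; extensionality l.
unfold dl, sh, Rdiv. destruct b, b'; ring.
Qed.

Lemma Bc_sh T N b g : Bc T N g -> Bc T N (sh b g).
Proof.
revert g; induction N as [|N IH]; intros g Hg.
- apply Bc_0, bnd_sh, Hg.
- split; [apply bnd_sh, Hg|]. intros b'. rewrite dl_sh. apply IH, Hg.
Qed.

Lemma bnd_const T c : bnd T (fun _ _ _ => c).
Proof.
intros T' _; exists (Rabs c).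
apply at_right_imp with (2 := at_right_lt 1 Rlt_0_1). intros; lra.
Qed.

Lemma Bc_const T N c : Bc T N (fun _ _ _ => c).
Proof.
revert c; induction N as [|N IH]; intros c; (split; [apply bnd_const|]); auto.
intros b. apply Bc_ext_pos with (2 := IH 0).
intros e k l He; unfold dl, sh; destruct b; field; lra.
Qed.

Lemma Bc_eps T N : Bc T N (fun e _ _ => e).
Proof.
assert (H : bnd T (fun e _ _ => e)).
{ intros T' _; exists 1. apply at_right_imp with (2 := at_right_lt 1 Rlt_0_1).
  intros e H0 H1 k l _ _. rewrite Rabs_pos_eq; lra. }
destruct N; split; auto. intros b. apply Bc_ext_pos with (2 := Bc_const T N 0).
intros e k l He; unfold dl, sh; destruct b; field; lra.
Qed.

Lemma bnd_plus T (g h : family) :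
  bnd T g -> bnd T h -> bnd T (fun e k l => g e k l + h e k l).
Proof.
intros Hg Hh T' HT. destruct (Hg T' HT) as [c Hc], (Hh T' HT) as [d Hd].
exists (c + d). apply at_right_imp with (2 := at_right_and _ _ Hc Hd).
intros e _ [H1 H2] k l Hk Hl. specialize (H1 k l Hk Hl); specialize (H2 k l Hk Hl).
pose proof (Rabs_triang (g e k l) (h e k l)). lra.
Qed.

Lemma bnd_mult T (g h : family) :
  bnd T g -> bnd T h -> bnd T (fun e k l => g e k l * h e k l).
Proof.
intros Hg Hh T' HT. destruct (Hg T' HT) as [c Hc], (Hh T' HT) as [d Hd].
exists (c * d). apply at_right_imp with (2 := at_right_and _ _ Hc Hd).
intros e _ [H1 H2] k l Hk Hl. specialize (H1 k l Hk Hl); specialize (H2 k l Hk Hl).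
rewrite Rabs_mult. apply Rmult_le_compat; auto using Rabs_pos.
Qed.

Lemma Bc_plus T N (g h : family) :
  Bc T N g -> Bc T N h -> Bc T N (fun e k l => g e k l + h e k l).
Proof.
revert g h; induction N as [|N IH]; intros g h Hg Hh;
  (split; [apply bnd_plus; eapply Bc_bnd; eassumption|]); auto.
intros b. apply Bc_ext_pos with (2 := IH _ _ (proj2 Hg b) (proj2 Hh b)).
intros e k l He; unfold dl, sh; destruct b; field; lra.
Qed.

(** The discrete product rule has a shifted factor, dl(g h) = dl g * h + sh g * dl h; this is why
    stability under [sh] is needed first. *)
Lemma Bc_mult T N (g h : family) :
  Bc T N g -> Bc T N h -> Bc T N (fun e k l => g e k l * h e k l).
Proof.
revert g h; induction N as [|N IH]; intros g h Hg Hh;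
  (split; [apply bnd_mult; eapply Bc_bnd; eassumption|]); auto.
intros b.
apply Bc_ext_pos with (2 := Bc_plus _ _ _ _
  (IH _ _ (proj2 Hg b) (Bc_S _ _ _ Hh))
  (IH _ _ (Bc_sh _ _ b _ (Bc_S _ _ _ Hg)) (proj2 Hh b))).
intros e k l He; unfold dl, sh; destruct b; field; lra.
Qed.

Lemma Bc_scal T N c (g : family) : Bc T N g -> Bc T N (fun e k l => c * g e k l).
Proof. apply Bc_mult, Bc_const. Qed.

Lemma Bc_minus T N (g h : family) :
  Bc T N g -> Bc T N h -> Bc T N (fun e k l => g e k l - h e k l).
Proof.
intros Hg Hh. apply Bc_ext_pos with (fun e k l => g e k l + -1 * h e k l).
- intros; ring.
- apply Bc_plus; [exact Hg|apply Bc_scal, Hh].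
Qed.

Definition bounded_below (T : R) (g : family) : Prop :=
  forall T', T' < T -> exists c, 0 < c /\ at_right 0 (fun e =>
    forall k l, INR k * e <= T' -> INR l * e <= T' -> c <= Rabs (g e k l)).

Lemma bounded_below_neq0 T g :
  bounded_below T g -> evg T (fun e k l => g e k l <> 0).
Proof.
intros H T' HT. destruct (H T' HT) as [c [Hc0 Hc]].
apply at_right_imp with (2 := Hc). intros e _ H1 k l Hk Hl H0.
specialize (H1 k l Hk Hl). rewrite H0, Rabs_R0 in H1. lra.
Qed.

(** Induction with the quotient rule dl(1/g) = - dl g * (1/g) * sh(1/g). It holds only where [g] and
    its shift are nonzero, that is, for small mesh, so equality is used in the sense of [evg]. *)
Lemma Bc_inv T N (g : family) :
  bounded_below T g -> Bc T N g -> Bc T N (fun e k l => / g e k l).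
Proof.
intros Hb.
assert (Hbd : bnd T (fun e k l => / g e k l)).
{ intros T' HT. destruct (Hb T' HT) as [c [Hc0 Hc]]. exists (/ c).
  apply at_right_imp with (2 := Hc). intros e _ H1 k l Hk Hl.
  rewrite Rabs_inv. apply Rinv_le_contravar; auto. }
pose proof (bounded_below_neq0 _ _ Hb) as H0.
induction N as [|N IH]; intros Hg; split; auto.
intros b. pose proof (IH (Bc_S _ _ _ Hg)) as Hi.
apply Bc_ext with (2 := Bc_scal _ _ (-1) _ (Bc_mult _ _ _ _ (proj2 Hg b)
  (Bc_mult _ _ _ _ Hi (Bc_sh _ _ b _ Hi)))).
apply evg_imp with (2 := evg_and _ _ _ H0 (evg_shift b _ _ H0)).
intros e k l He [H1 H2]. unfold dl, sh in *; destruct b; field; repeat split; auto; lra.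
Qed.

(** * Restrictions of smooth functions *)

Definition rs (F : R -> R -> R) : family := fun e k l => F (INR k * e) (INR l * e).

(** The operator [dl] with real instead of lattice arguments, so that a difference quotient of a
    smooth function can still be differentiated. *)
Definition Dlt (b : bool) (e : R) (F : R -> R -> R) (x y : R) : R :=
  ((if b then F (x + e) y else F x (y + e)) - F x y) / e.

(* Difference quotients along a word of directions: the generality needed for an
   induction in which the mean value theorem trades one difference quotient for
   a derivative. *)
Fixpoint Dw (w : list bool) (e : R) (F : R -> R -> R) : R -> R -> R :=
  match w with nil => F | cons b w => Dlt b e (Dw w e F) end.

Lemma is_derive_shift (f : R -> R) x e d :
  is_derive f (x + e) d -> is_derive (fun s => f (s + e)) x d.
Proof.
intros H. replace d with (scal 1 d) by apply Rmult_1_l.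
apply (is_derive_comp f (fun s => s + e)); [exact H|].
auto_derive; [exact I|reflexivity].
Qed.

Lemma partials_Dlt T b e F F1 F2 :
  0 < e -> partials T F F1 F2 ->
  partials (T - e) (Dlt b e F) (Dlt b e F1) (Dlt b e F2).
Proof.
intros He HP x y [Hx Hy].
assert (Hb : box T x y) by (split; lra).
assert (Hb1 : box T (x + e) y).
{ split; [|lra]. eapply Rle_lt_trans; [apply Rabs_triang|].
  rewrite (Rabs_pos_eq e); lra. }
assert (Hb2 : box T x (y + e)).
{ split; [lra|]. eapply Rle_lt_trans; [apply Rabs_triang|].
  rewrite (Rabs_pos_eq e); lra. }
assert (HD : forall f g x d d', is_derive f x d -> is_derive g x d' ->
  is_derive (fun s => (f s - g s) / e) x ((d - d') / e)).
{ intros f g z d d' Hf Hg.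
  apply is_derive_ext with (fun s => / e * (f s - g s)).
  - intros; apply Rmult_comm.
  - replace ((d - d') / e) with (/ e * (d - d')) by apply Rmult_comm.
    apply (is_derive_scal (fun s => f s - g s)).
    apply (is_derive_minus f g); assumption. }
unfold Dlt; destruct b; split.
- apply (HD (fun s => F (s + e) y) (fun s => F s y)); [|apply HP, Hb].
  apply (is_derive_shift (fun s => F s y)), HP, Hb1.
- apply (HD (F (x + e)) (F x)); apply HP; assumption.
- apply (HD (fun s => F s (y + e)) (fun s => F s y)); apply HP; assumption.
- apply (HD (fun t => F x (t + e)) (F x)); [|apply HP, Hb].
  apply (is_derive_shift (F x)), HP, Hb2.
Qed.

Lemma partials_Dw T w e F F1 F2 :
  0 < e -> partials T F F1 F2 ->
  partials (T - INR (length w) * e) (Dw w e F) (Dw w e F1) (Dw w e F2).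
Proof.
intros He HP; induction w as [|b w IH].
- simpl. replace (T - 0 * e) with T by ring. exact HP.
- change (length (cons b w)) with (S (length w)). rewrite S_INR.
  replace (T - (INR (length w) + 1) * e) with (T - INR (length w) * e - e) by ring.
  apply partials_Dlt; assumption.
Qed.

Lemma MVT_step (f df : R -> R) a e :
  0 < e -> (forall t, a <= t <= a + e -> is_derive f t (df t)) ->
  exists c, a <= c <= a + e /\ f (a + e) - f a = df c * e.
Proof.
intros He H. destruct (MVT_gen f a (a + e) df) as [c [Hc E]].
- intros t Ht. rewrite Rmin_left, Rmax_right in Ht by lra. apply H; lra.
- intros t Ht. rewrite Rmin_left, Rmax_right in Ht by lra.
  apply continuity_pt_filterlim, (ex_derive_continuous f t).
  exists (df t); apply H; lra.
- rewrite Rmin_left, Rmax_right in Hc by lra.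
  exists c; split; [exact Hc|]. rewrite E; ring.
Qed.

Definition sel {A} (b : bool) (x y : A) : A := if b then x else y.

Lemma Dlt_MVT T b e F F1 F2 x y T' :
  0 < e -> partials T F F1 F2 -> Rabs x <= T' -> Rabs y <= T' -> T' + e < T ->
  exists d, 0 <= d <= e /\
    Dlt b e F x y = sel b F1 F2 (if b then x + d else x) (if b then y else y + d).
Proof.
intros He HP Hx Hy HT.
assert (Hs : forall z t, Rabs z <= T' -> z <= t <= z + e -> Rabs t < T).
{ intros z t Hz Ht. apply Rabs_le_between in Hz. apply Rabs_lt_between; lra. }
destruct b.
- destruct (MVT_step (fun s => F s y) (fun s => F1 s y) x e He) as [c [Hc E]].
  { intros t Ht; apply HP; split; [apply (Hs x); auto|lra]. }
  exists (c - x); split; [lra|]. unfold Dlt, sel; simpl.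
  replace (x + (c - x)) with c by ring. rewrite E; field; lra.
- destruct (MVT_step (F x) (F2 x) y e He) as [c [Hc E]].
  { intros t Ht; apply HP; split; [lra|apply (Hs y); auto]. }
  exists (c - y); split; [lra|]. unfold Dlt, sel; simpl.
  replace (y + (c - y)) with c by ring. rewrite E; field; lra.
Qed.

Lemma Dlt_bound T b e F F1 F2 T' M :
  0 < e -> partials T F F1 F2 -> T' + e < T ->
  (forall x y, Rabs x <= T' + e -> Rabs y <= T' + e -> Rabs (sel b F1 F2 x y) <= M) ->
  forall x y, Rabs x <= T' -> Rabs y <= T' -> Rabs (Dlt b e F x y) <= M.
Proof.
intros He HP HT HM x y Hx Hy.
destruct (Dlt_MVT T b e F F1 F2 x y T' He HP Hx Hy HT) as [d [Hd ->]].
assert (Hs : forall z, Rabs z <= T' -> Rabs (z + d) <= T' + e).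
{ intros z Hz. eapply Rle_trans; [apply Rabs_triang|].
  rewrite (Rabs_pos_eq d); lra. }
apply HM; destruct b; auto; lra.
Qed.

(** The mean value theorem is used twice: the quotient equals the derivative at a point displaced by
    some [d <= e], and over that displacement the derivative changes by at most [M * d]. *)
Lemma Dlt_taylor T b e F F1 F2 F11 F12 F21 F22 T' M :
  0 < e -> partials T F F1 F2 ->
  partials T F1 F11 F12 -> partials T F2 F21 F22 -> T' + e < T ->
  (forall x y, Rabs x <= T' + e -> Rabs y <= T' + e -> Rabs (sel b F11 F22 x y) <= M) ->
  forall x y, Rabs x <= T' -> Rabs y <= T' ->
    Rabs ((Dlt b e F x y - sel b F1 F2 x y) / e) <= M.
Proof.
intros He HP HP1 HP2 HT HM x y Hx Hy.
assert (HM0 : 0 <= M).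
{ specialize (HM x y ltac:(lra) ltac:(lra)).
  pose proof (Rabs_pos (sel b F11 F22 x y)); lra. }
destruct (Dlt_MVT T b e F F1 F2 x y T' He HP Hx Hy HT) as [d [Hd ->]].
assert (E : Rabs (sel b F1 F2 (if b then x + d else x) (if b then y else y + d)
  - sel b F1 F2 x y) <= M * d).
{ destruct (Req_dec d 0) as [->|Hd0].
  { rewrite !Rplus_0_r. destruct b; rewrite Rminus_diag, Rabs_R0; lra. }
  assert (Hd' : 0 < d) by lra.
  assert (Hdt : forall b F F1 F2, partials T F F1 F2 ->
    (forall x y, Rabs x <= T' + e -> Rabs y <= T' + e -> Rabs (sel b F1 F2 x y) <= M) ->
    Rabs (F (if b then x + d else x) (if b then y else y + d) - F x y) <= M * d).
  { clear F F1 F2 F11 F12 F21 F22 HP HP1 HP2 HM b.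
    intros b F F1 F2 HP HM.
    assert (HB : Rabs (Dlt b d F x y) <= M).
    { apply (Dlt_bound T b d F F1 F2 T'); auto; [lra|].
      intros; apply HM; lra. }
    unfold Dlt in HB. unfold Rdiv in HB. rewrite Rabs_mult, Rabs_inv, (Rabs_pos_eq d) in HB by lra.
    apply (Rmult_le_compat_r d) in HB; [|lra].
    rewrite Rmult_assoc, Rinv_l, Rmult_1_r in HB by lra.
    destruct b; exact HB. }
  destruct b; [apply (Hdt true F1 F11 F12)|apply (Hdt false F2 F21 F22)]; auto. }
unfold Rdiv. rewrite Rabs_mult, Rabs_inv, (Rabs_pos_eq e) by lra.
apply (Rmult_le_reg_r e); [exact He|].
rewrite Rmult_assoc, Rinv_l, Rmult_1_r by lra.
apply Rle_trans with (1 := E). apply Rmult_le_compat_l; lra.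
Qed.

Definition bounded_on (T : R) (G : R -> R -> R -> R) : Prop :=
  forall T', T' < T -> exists c, at_right 0 (fun e =>
    forall x y, Rabs x <= T' -> Rabs y <= T' -> Rabs (G e x y) <= c).

(** Room for two things: points displaced by one mesh width stay in the square of half-width (T' +
    T)/2, and this square stays in the box that has lost [e] for each of the [n] letters of a
    word. *)
Lemma small_margin n T T' : T' < T -> at_right 0 (fun e =>
  0 < e /\ T' + e <= (T' + T) / 2 /\ (T' + T) / 2 + e < T - INR n * e).
Proof.
intros HT. assert (Hd : 0 < (T - T') / 2 / (INR n + 2)).
{ pose proof (pos_INR n). repeat apply Rdiv_lt_0_compat; lra. }
apply at_right_imp with (2 := at_right_lt _ Hd). intros e He [_ H].
pose proof (pos_INR n).
apply Rlt_div_r in H; [|lra]. split; [exact He|]. split; nra.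
Qed.

Lemma Dw_bounded T w F : Cinf T F -> bounded_on T (fun e => Dw w e F).
Proof.
revert F; induction w as [|b w IH]; intros F HF T' HT.
- destruct (Ck_bounded T 0 F T' (HF 0%nat) HT) as [M [_ HM]]. exists M.
  apply at_right_imp with (2 := at_right_lt 1 Rlt_0_1). intros; apply HM; assumption.
- destruct (IH (D b F) (Cinf_D T b F HF) ((T' + T) / 2) ltac:(lra)) as [c Hc].
  exists c. apply at_right_imp with (2 := at_right_and _ _ Hc
    (small_margin (length w) T T' HT)).
  intros e _ [H1 [He [H2 H3]]]. simpl.
  apply (Dlt_bound _ b e _ _ _ T' c He
    (partials_Dw T w e _ _ _ He (Cinf_partials T F HF))); [lra|].
  intros x y Hx Hy. destruct b; apply H1; lra.
Qed.

Lemma Dw_taylor T w b F : Cinf T F ->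
  bounded_on T (fun e x y => (Dlt b e (Dw w e F) x y - Dw w e (D b F) x y) / e).
Proof.
intros HF T' HT. pose proof (Cinf_D T b F HF) as HF1.
destruct (Dw_bounded T w (D b (D b F)) (Cinf_D T b _ HF1) ((T' + T) / 2) ltac:(lra))
  as [c Hc].
exists c. apply at_right_imp with (2 := at_right_and _ _ Hc
  (small_margin (length w) T T' HT)).
intros e _ [H1 [He [H2 H3]]] x y Hx Hy.
pose proof (partials_Dw T w e _ _ _ He (Cinf_partials T _ (Cinf_D T true F HF))) as P1.
pose proof (partials_Dw T w e _ _ _ He (Cinf_partials T _ (Cinf_D T false F HF))) as P2.
pose proof (Dlt_taylor _ b e _ _ _ _ _ _ _ T' c He
  (partials_Dw T w e _ _ _ He (Cinf_partials T F HF)) P1 P2 ltac:(lra)) as HT'.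
destruct b; apply HT'; auto; intros; apply H1; lra.
Qed.

Lemma bounded_on_rs T (G : R -> R -> R -> R) :
  bounded_on T G -> bnd T (fun e => rs (G e) e).
Proof.
intros H T' HT. destruct (H T' HT) as [c Hc]. exists c.
apply at_right_imp with (2 := Hc). intros e He H1 k l Hk Hl.
pose proof (pos_INR k); pose proof (pos_INR l).
apply H1; rewrite Rabs_pos_eq; nra.
Qed.

Lemma dl_rs b (G : R -> R -> R -> R) :
  dl b (fun e => rs (G e) e) = fun e => rs (Dlt b e (G e)) e.
Proof.
extensionality e; extensionality k; extensionality l.
unfold dl, sh, rs, Dlt. destruct b; rewrite S_INR, Rmult_plus_distr_r, Rmult_1_l;
reflexivity.
Qed.

Lemma Bc_Dw T N w F : Cinf T F -> Bc T N (fun e => rs (Dw w e F) e).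
Proof.
intros HF; revert w; induction N as [|N IH]; intros w;
  (split; [apply bounded_on_rs, Dw_bounded, HF|]); auto.
intros b. rewrite dl_rs. apply (IH (cons b w)).
Qed.

Lemma Bc_rs T N F : Cinf T F -> Bc T N (rs F).
Proof. apply (Bc_Dw T N nil). Qed.

(** A difference quotient of the remainder for [w] is the remainder for the longer word [cons b' w],
    so the bound of order zero for all words gives every order. *)
Lemma Bc_Dw_taylor T N w b F : Cinf T F ->
  Bc T N (fun e => rs (fun x y => (Dlt b e (Dw w e F) x y - Dw w e (D b F) x y) / e) e).
Proof.
intros HF; revert w; induction N as [|N IH]; intros w;
  (split; [apply bounded_on_rs, Dw_taylor, HF|]); auto.
intros b'. rewrite dl_rs. apply Bc_ext_pos with (2 := IH (cons b' w)).
intros e k l He. unfold rs, Dlt; simpl; unfold Dlt, Rdiv. destruct b, b'; ring.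
Qed.

(** * Convergence of order O(eps) with all difference quotients *)

(** Scalar form of [converges_Cinf_Oeps] with the factor [eps] divided out: convergence becomes
    boundedness of the rescaled error, to which the algebra of [Bc] applies. *)
Definition conv (T : R) (g : family) (F : R -> R -> R) : Prop :=
  forall N, Bc T N (fun e k l => (g e k l - rs F e k l) / e).

Lemma conv_ext T g h F G :
  evg T (fun e k l => g e k l = h e k l) ->
  (forall x y, box T x y -> F x y = G x y) -> conv T g F -> conv T h G.
Proof.
intros H1 H2 Hc N. apply Bc_ext with (2 := Hc N).
apply evg_imp with (2 := evg_and _ _ _ H1 (evg_box T _ H2)).
intros e k l _ [-> E]. unfold rs; rewrite E; reflexivity.
Qed.

Lemma conv_rs T F : conv T (rs F) F.
Proof.
intros N. apply Bc_ext_pos with (2 := Bc_const T N 0). intros e k l He; field; lra.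
Qed.

Lemma conv_Bc T N g F : Cinf T F -> conv T g F -> Bc T N g.
Proof.
intros HF Hc. apply Bc_ext_pos with (2 := Bc_plus _ _ _ _ (Bc_rs T N F HF)
  (Bc_mult _ _ _ _ (Bc_eps T N) (Hc N))).
intros e k l He; field; lra.
Qed.

Lemma conv_plus T g h F G :
  conv T g F -> conv T h G ->
  conv T (fun e k l => g e k l + h e k l) (fun x y => F x y + G x y).
Proof.
intros H1 H2 N. apply Bc_ext_pos with (2 := Bc_plus _ _ _ _ (H1 N) (H2 N)).
intros e k l He; unfold rs; field; lra.
Qed.

Lemma conv_minus T g h F G :
  conv T g F -> conv T h G ->
  conv T (fun e k l => g e k l - h e k l) (fun x y => F x y - G x y).
Proof.
intros H1 H2 N. apply Bc_ext_pos with (2 := Bc_minus _ _ _ _ (H1 N) (H2 N)).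
intros e k l He; unfold rs; field; lra.
Qed.

Lemma conv_mult T g h F G :
  Cinf T F -> Cinf T G -> conv T g F -> conv T h G ->
  conv T (fun e k l => g e k l * h e k l) (fun x y => F x y * G x y).
Proof.
intros HF HG H1 H2 N. apply Bc_ext_pos with (2 := Bc_plus _ _ _ _
  (Bc_mult _ _ _ _ (H1 N) (conv_Bc T N _ _ HG H2))
  (Bc_mult _ _ _ _ (Bc_rs T N F HF) (H2 N))).
intros e k l He; unfold rs; field; lra.
Qed.

(** A shift changes [g] by [e * dl b g] with a bounded quotient, hence only at order O(e). *)
Lemma conv_sh T b g F : Cinf T F -> conv T g F -> conv T (sh b g) F.
Proof.
intros HF H N. apply Bc_ext_pos with (2 := Bc_plus _ _ _ _
  (proj2 (conv_Bc T (S N) _ _ HF H) b) (H N)).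
intros e k l He; unfold dl; field; lra.
Qed.

(** The error splits into the difference quotient of the error of [g] and the Taylor remainder of
    [F]. The order lost in the first term is harmless because [conv] contains all orders. *)
Lemma conv_dl T b g F : Cinf T F -> conv T g F -> conv T (dl b g) (D b F).
Proof.
intros HF H N. apply Bc_ext_pos with (2 := Bc_plus _ _ _ _
  (proj2 (H (S N)) b) (Bc_Dw_taylor T N nil b F HF)).
intros e k l He. simpl.
replace (rs (fun x y => (Dlt b e F x y - D b F x y) / e) e k l) with
  ((dl b (rs F) e k l - rs (D b F) e k l) / e).
- unfold dl, sh; destruct b; field; lra.
- pose proof (dl_rs b (fun _ => F)) as E.
  change (dl b (rs F) = fun e => rs (Dlt b e F) e) in E. rewrite E. reflexivity.
Qed.

Lemma conv_close T g F T' : conv T g F -> T' < T ->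
  exists c, at_right 0 (fun e => forall k l, INR k * e <= T' -> INR l * e <= T' ->
    Rabs (g e k l - F (INR k * e) (INR l * e)) <= c * e).
Proof.
intros H HT. destruct (Bc_bnd _ _ _ (H 0%nat) T' HT) as [c Hc]. exists c.
apply at_right_imp with (2 := Hc). intros e He H1 k l Hk Hl.
specialize (H1 k l Hk Hl). unfold Rdiv in H1.
rewrite Rabs_mult, Rabs_inv, (Rabs_pos_eq e) in H1 by lra.
apply (Rmult_le_compat_r e) in H1; [|lra].
rewrite Rmult_assoc, Rinv_l, Rmult_1_r in H1 by lra. exact H1.
Qed.

Lemma conv_bounded_below T g F m :
  0 < m -> (forall x y, box T x y -> m <= Rabs (F x y)) -> conv T g F ->
  bounded_below T g.
Proof.
intros Hm HF H T' HT. destruct (conv_close T g F T' H HT) as [c Hc].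
exists (m / 2); split; [lra|].
assert (Hd : 0 < m / 2 / (Rabs c + 1)).
{ pose proof (Rabs_pos c). repeat apply Rdiv_lt_0_compat; lra. }
apply at_right_imp with (2 := at_right_and _ _ (at_right_and _ _ Hc (at_right_lt _ Hd))
  (evg_box T _ HF T' HT)).
intros e He [[H1 [_ H2]] H3] k l Hk Hl.
specialize (H1 k l Hk Hl); specialize (H3 k l Hk Hl). simpl in H3.
pose proof (Rabs_pos c). apply Rlt_div_r in H2; [|lra].
pose proof (Rle_abs c).
rewrite Rabs_minus_sym in H1.
pose proof (Rabs_triang_inv (F (INR k * e) (INR l * e)) (g e k l)). nra.
Qed.

Lemma conv_inv T g F m :
  0 < m -> (forall x y, box T x y -> m <= Rabs (F x y)) -> Cinf T F -> conv T g F ->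
  conv T (fun e k l => / g e k l) (fun x y => / F x y).
Proof.
intros Hm HF HFi H N.
assert (HF0 : forall x y, box T x y -> F x y <> 0).
{ intros x y Hb E. specialize (HF x y Hb). rewrite E, Rabs_R0 in HF. lra. }
pose proof (conv_bounded_below T g F m Hm HF H) as Hb.
apply Bc_ext with (2 := Bc_scal _ _ (-1) _ (Bc_mult _ _ _ _ (H N)
  (Bc_mult _ _ _ _ (Bc_inv _ _ _ Hb (conv_Bc T N g F HFi H))
    (Bc_rs T N _ (fun M => Ck_inv T M F HF0 (HFi M)))))).
apply evg_imp with (2 := evg_and _ _ _ (evg_pos T (fun e _ _ => 0 < e) (fun _ _ _ h => h))
  (evg_and _ _ _ (bounded_below_neq0 _ _ Hb) (evg_box T _ HF0))).
intros e k l He [_ [H1 H2]]. unfold rs. field. repeat split; auto; lra.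
Qed.

(** * Discrete evolution equations *)

(** Initial values for an evolution in direction [b], extended constantly in that direction so that
    [Bc] and [conv] apply to them. *)
Definition axis (b : bool) (z : family) : family := fun e k l =>
  if b then z e 0%nat l else z e k 0%nat.

Lemma bnd_potential T (z : family) :
  (forall b, bnd T (dl b z)) -> (forall e, z e 0%nat 0%nat = 0) -> bnd T z.
Proof.
intros Hz H0 T' HT.
destruct (Hz true T' HT) as [c1 H1], (Hz false T' HT) as [c2 H2].
exists (Rabs c1 * T' + Rabs c2 * T').
apply at_right_imp with (2 := at_right_and _ _ H1 H2).
clear H1 H2; intros e He [H1 H2].
assert (HS : forall k, INR k * e <= INR (S k) * e) by (intros k; rewrite S_INR; nra).
assert (Ha : forall a b c, Rabs ((a - b) / e) <= c -> Rabs a <= Rabs b + Rabs c * e).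
{ intros a b c H. unfold Rdiv in H.
  rewrite Rabs_mult, Rabs_inv, (Rabs_pos_eq e) in H by lra.
  apply (Rmult_le_compat_r e) in H; [|lra].
  rewrite Rmult_assoc, Rinv_l, Rmult_1_r in H by lra.
  pose proof (Rle_abs c). pose proof (Rabs_triang_inv a b). nra. }
assert (Hk : forall k, INR k * e <= T' -> Rabs (z e k 0%nat) <= Rabs c1 * (INR k * e)).
{ induction k as [|k IH]; intros Hk.
  - simpl INR. rewrite H0, Rabs_R0, Rmult_0_l, Rmult_0_r. lra.
  - specialize (IH (Rle_trans _ _ _ (HS k) Hk)).
    specialize (H1 k 0%nat (Rle_trans _ _ _ (HS k) Hk)).
    assert (HT0 : INR 0 * e <= T') by (pose proof (pos_INR (S k)); simpl (INR 0); nra).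
    apply Ha in H1; auto. unfold sh in H1. rewrite S_INR. lra. }
assert (Hl : forall k l, INR k * e <= T' -> INR l * e <= T' ->
  Rabs (z e k l) <= Rabs c1 * (INR k * e) + Rabs c2 * (INR l * e)).
{ intros k; induction l as [|l IH]; intros Hk' Hl.
  - specialize (Hk k Hk'). simpl (INR 0). lra.
  - specialize (IH Hk' (Rle_trans _ _ _ (HS l) Hl)).
    specialize (H2 k l Hk' (Rle_trans _ _ _ (HS l) Hl)).
    apply Ha in H2; auto. unfold sh in H2. rewrite (S_INR l). lra. }
intros k l Hk' Hl'. specialize (Hl k l Hk' Hl').
pose proof (Rabs_pos c1); pose proof (Rabs_pos c2). nra.
Qed.

(** All difference quotients of positive order of the rescaled error are bounded by hypothesis. The
    order zero is obtained by summation from the origin, where the error vanishes. *)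
Lemma conv_potential T g F :
  (forall b, conv T (dl b g) (D b F)) -> Cinf T F ->
  (forall e, g e 0%nat 0%nat = F 0 0) -> conv T g F.
Proof.
intros Hd HF H0.
assert (HB : forall b N, Bc T N (dl b (fun e k l => (g e k l - rs F e k l) / e))).
{ intros b N. apply Bc_ext_pos with (2 := Bc_minus _ _ _ _ (Hd b N)
    (conv_dl T b _ _ HF (conv_rs T F) N)).
  intros e k l He. unfold dl, sh; destruct b; field; lra. }
assert (Hb : bnd T (fun e k l => (g e k l - rs F e k l) / e)).
{ apply bnd_potential; [intros b; apply (Bc_bnd T 0), HB|].
  intros e. unfold rs. simpl INR. rewrite Rmult_0_l, H0. unfold Rdiv; ring. }
intros [|N]; split; auto.
Qed.

(** Discrete Gronwall inequality. With [A + 1] in place of [A] the majorant is at least 1, so the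
    source [H] is absorbed into the rate [C + H]. *)
Lemma growth_bound (z : nat -> R) e C H A T' :
  0 < e -> 0 <= C -> 0 <= H -> 0 <= A -> Rabs (z 0%nat) <= A ->
  (forall k, INR k * e <= T' -> Rabs ((z (S k) - z k) / e) <= C * Rabs (z k) + H) ->
  forall k, INR k * e <= T' -> Rabs (z k) <= (A + 1) * exp ((C + H) * T').
Proof.
intros He HC HH HA H0 Hs.
assert (Hk : forall k, INR k * e <= T' ->
  Rabs (z k) <= (A + 1) * exp ((C + H) * (INR k * e))).
{ induction k as [|k IH]; intros Hk.
  - simpl INR. rewrite Rmult_0_l, Rmult_0_r, exp_0. lra.
  - rewrite S_INR in *. specialize (IH ltac:(nra)). specialize (Hs k ltac:(nra)).
    unfold Rdiv in Hs. rewrite Rabs_mult, Rabs_inv, (Rabs_pos_eq e) in Hs by lra.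
    apply (Rmult_le_compat_r e) in Hs; [|lra].
    rewrite Rmult_assoc, Rinv_l, Rmult_1_r in Hs by lra.
    pose proof (Rabs_triang_inv (z (S k)) (z k)).
    replace ((C + H) * ((INR k + 1) * e)) with
      ((C + H) * (INR k * e) + (C + H) * e) by ring.
    rewrite exp_plus.
    pose proof (exp_ineq1_le ((C + H) * e)).
    pose proof (exp_ineq1_le ((C + H) * (INR k * e))).
    pose proof (pos_INR k).
    assert (0 <= (C + H) * (INR k * e)) by (repeat apply Rmult_le_pos; lra).
    set (X := exp ((C + H) * (INR k * e))) in *.
    apply Rle_trans with ((A + 1) * X * (1 + (C + H) * e)).
    + assert (1 <= (A + 1) * X) by nra.
      assert (C * e * Rabs (z k) <= C * e * ((A + 1) * X))
        by (apply Rmult_le_compat_l; nra).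
      assert (H * e * 1 <= H * e * ((A + 1) * X)) by (apply Rmult_le_compat_l; nra).
      nra.
    + rewrite (Rmult_assoc (A + 1)). apply Rmult_le_compat_l; [lra|].
      apply Rmult_le_compat_l; lra. }
intros k Hk'. apply Rle_trans with (1 := Hk k Hk').
apply Rmult_le_compat_l; [lra|].
destruct (Req_dec ((C + H) * (INR k * e)) ((C + H) * T')) as [E|E].
- rewrite E; apply Rle_refl.
- left; apply exp_increasing.
  assert ((C + H) * (INR k * e) <= (C + H) * T') by (apply Rmult_le_compat_l; lra). lra.
Qed.

Lemma bnd_nonneg T g T' : bnd T g -> T' < T ->
  exists c, 0 <= c /\ at_right 0 (fun e =>
    forall k l, INR k * e <= T' -> INR l * e <= T' -> Rabs (g e k l) <= c).
Proof.
intros H HT; destruct (H T' HT) as [c Hc]. exists (Rabs c); split; [apply Rabs_pos|].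
apply at_right_imp with (2 := Hc). intros e He H1 k l Hk Hl.
pose proof (Rle_abs c). specialize (H1 k l Hk Hl); lra.
Qed.

Lemma bnd_ode T b (c z h : family) :
  bnd T c -> bnd T h -> bnd T (axis b z) ->
  evg T (fun e k l => dl b z e k l = c e k l * z e k l + h e k l) -> bnd T z.
Proof.
intros Hc Hh Ha He T' HT.
destruct (bnd_nonneg _ _ _ Hc HT) as [C [HC0 HC]],
  (bnd_nonneg _ _ _ Hh HT) as [H [HH0 HH]],
  (bnd_nonneg _ _ _ Ha HT) as [A [HA0 HA]].
exists ((A + 1) * exp ((C + H) * T')).
apply at_right_imp with (2 := at_right_and _ _ (at_right_and _ _ HC HH)
  (at_right_and _ _ HA (He T' HT))).
intros e He0 [[H1 H2] [H3 H4]] k l Hk Hl.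
assert (H5 : forall k l, INR k * e <= T' -> INR l * e <= T' ->
  Rabs (dl b z e k l) <= C * Rabs (z e k l) + H).
{ intros k' l' Hk' Hl'. rewrite H4 by assumption.
  eapply Rle_trans; [apply Rabs_triang|]. rewrite Rabs_mult.
  specialize (H1 k' l' Hk' Hl'); specialize (H2 k' l' Hk' Hl').
  pose proof (Rabs_pos (z e k' l')). nra. }
assert (HT0 : INR 0 * e <= T') by (pose proof (pos_INR k); simpl (INR 0); nra).
destruct b.
- apply (growth_bound (fun k => z e k l) e C H A T'); auto.
  + exact (H3 0%nat l HT0 Hl).
  + intros k' Hk'. exact (H5 k' l Hk' Hl).
- apply (growth_bound (fun l => z e k l) e C H A T'); auto.
  + exact (H3 k 0%nat Hk HT0).
  + intros l' Hl'. exact (H5 k l' Hk Hl').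
Qed.

Lemma dl_axis b z : dl (negb b) (axis b z) = axis b (dl (negb b) z).
Proof. destruct b; reflexivity. Qed.

(** Along [b] the equation itself expresses the quotient. The transversal quotient solves an
    equation of the same kind with coefficient [sh (negb b) c] and a source containing [z] at the
    order already known; hence the induction runs over all [c], [z], [h]. *)
Lemma Bc_ode T N b (c z h : family) :
  (forall M, Bc T M c) -> Bc T N h -> Bc T N (axis b z) ->
  evg T (fun e k l => dl b z e k l = c e k l * z e k l + h e k l) -> Bc T N z.
Proof.
revert c z h; induction N as [|N IH]; intros c z h Hc Hh Ha He.
- apply Bc_0, (bnd_ode T b c z h); auto;
    [apply (Bc_bnd T 0), Hc|apply Hh|apply Ha].
- assert (Hz : Bc T N z) by (apply (IH c z h); auto using Bc_S).
  assert (Hzb : Bc T N (dl b z)).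
  { apply Bc_ext with (fun e k l => c e k l * z e k l + h e k l).
    - apply evg_imp with (2 := He). intros; symmetry; assumption.
    - apply Bc_plus; [apply Bc_mult; auto|apply Bc_S, Hh]. }
  assert (Hzn : Bc T N (dl (negb b) z)).
  { apply (IH (sh (negb b) c) _
      (fun e k l => dl (negb b) c e k l * z e k l + dl (negb b) h e k l)).
    - intros M; apply Bc_sh, Hc.
    - apply Bc_plus; [|apply Hh].
      apply Bc_mult; [apply (proj2 (Hc (S N)) (negb b))|exact Hz].
    - rewrite <- dl_axis. apply Ha.
    - rewrite dl_dl. apply evg_imp with (2 := evg_and _ _ _
        (evg_pos T (fun e _ _ => 0 < e) (fun _ _ _ h => h)) (evg_dl T (negb b) _ _ He)).
      intros e k l He0 [_ ->]. unfold dl, sh. destruct b; simpl; field; lra. }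
  split; [apply (Bc_bnd T N), Hz|].
  intros b'. destruct b, b'; assumption.
Qed.

(* Induction on [k + l]: [E] and both its difference quotients are at most
   [(A + 1) exp ((4 Q + P + 1) (k + l) e)]. *)
Lemma goursat_bound (E : nat -> nat -> R) e Q P A T' :
  0 < e <= 1 -> 0 <= Q -> 0 <= P -> 0 <= A ->
  Rabs (E 0%nat 0%nat) <= A ->
  (forall k, INR k * e <= T' -> Rabs ((E (S k) 0%nat - E k 0%nat) / e) <= A) ->
  (forall l, INR l * e <= T' -> Rabs ((E 0%nat (S l) - E 0%nat l) / e) <= A) ->
  (forall k l, INR k * e <= T' -> INR l * e <= T' ->
    Rabs ((E (S k) (S l) - E (S k) l - E k (S l) + E k l) / (e * e))
    <= Q * (Rabs (E (S k) l) + Rabs (E k (S l))) + P) ->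
  forall k l, INR k * e <= T' -> INR l * e <= T' ->
    Rabs (E k l) <= (A + 1) * exp ((4 * Q + P + 1) * (T' + T')).
Proof.
intros He HQ HP HA H0 H1 H2 H12.
(* On a diagonal with majorant X the two neighbours of a vertex are at most 2 X each, as [e <= 1],
   so the mixed quotient is at most (4 Q + P) X, using X >= 1. The extra 1 pays for the growth of
   [E] through its own first quotients. *)
set (L := 4 * Q + P + 1).
set (X := fun s : nat => (A + 1) * exp (L * (INR s * e))).
assert (HX1 : forall s, A + 1 <= X s).
{ intros s. unfold X. pose proof (exp_ineq1_le (L * (INR s * e))).
  assert (0 <= L * (INR s * e)).
  { pose proof (pos_INR s). unfold L; repeat apply Rmult_le_pos; lra. }
  nra. }
assert (HXS : forall s, X s * (1 + L * e) <= X (S s)).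
{ intros s. unfold X. rewrite S_INR.
  replace (L * ((INR s + 1) * e)) with (L * (INR s * e) + L * e) by ring.
  rewrite exp_plus, <- (Rmult_assoc (A + 1)).
  apply Rmult_le_compat_l; [|apply exp_ineq1_le].
  apply Rmult_le_pos; [lra|left; apply exp_pos]. }
assert (HXl : forall s, X s + e * X s <= X (S s)).
{ intros s. specialize (HXS s); specialize (HX1 s).
  assert (0 <= X s * e * (4 * Q + P)) by (apply Rmult_le_pos; [apply Rmult_le_pos|]; lra).
  unfold L in HXS; nra. }
assert (Hm : forall m n, (m <= n)%nat -> INR n * e <= T' -> INR m * e <= T').
{ intros m n Hmn Hn. apply le_INR in Hmn. nra. }
assert (Ht : forall a b c, Rabs ((a - b) / e) <= c -> Rabs a <= Rabs b + e * c).
{ intros a b c H. unfold Rdiv in H.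
  rewrite Rabs_mult, Rabs_inv, (Rabs_pos_eq e) in H by lra.
  apply (Rmult_le_compat_r e) in H; [|lra].
  rewrite Rmult_assoc, Rinv_l, Rmult_1_r in H by lra.
  pose proof (Rabs_triang_inv a b). lra. }
assert (Hmain : forall s k l, (k + l = s)%nat -> INR k * e <= T' -> INR l * e <= T' ->
  Rabs (E k l) <= X s /\ Rabs ((E (S k) l - E k l) / e) <= X s /\
  Rabs ((E k (S l) - E k l) / e) <= X s).
{ induction s as [|s IH]; intros k l Hs Hk Hl.
  - assert (k = 0%nat) as -> by lia. assert (l = 0%nat) as -> by lia.
    specialize (HX1 0%nat). specialize (H1 0%nat Hk). specialize (H2 0%nat Hl). lra.
  (* The mixed quotient on diagonal [s] carries the first quotients to diagonal [s + 1]; only those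
     along the axes are taken from the data. *)
  - assert (Hmix : forall k l, (k + l = s)%nat -> INR k * e <= T' -> INR l * e <= T' ->
      Rabs ((E (S k) (S l) - E (S k) l - E k (S l) + E k l) / (e * e))
        <= X s * L - X s).
    { clear k l Hs Hk Hl. intros k l Hs Hk Hl.
      destruct (IH k l Hs Hk Hl) as [I1 [I2 I3]].
      apply Ht in I2; apply Ht in I3.
      specialize (H12 k l Hk Hl). specialize (HX1 s).
      assert (Rabs (E (S k) l) <= 2 * X s) by nra.
      assert (Rabs (E k (S l)) <= 2 * X s) by nra.
      assert (P * 1 <= P * X s) by (apply Rmult_le_compat_l; lra).
      assert (Q * (Rabs (E (S k) l) + Rabs (E k (S l))) <= Q * (4 * X s))
        by (apply Rmult_le_compat_l; lra).
      unfold L; nra. }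
    split; [|split].
    + destruct k as [|k].
      * destruct l as [|l]; [lia|].
        destruct (IH 0%nat l ltac:(lia) Hk (Hm _ _ (Nat.le_succ_diag_r l) Hl))
          as [I1 [I2 I3]].
        apply Ht in I3. specialize (HXl s). lra.
      * destruct (IH k l ltac:(lia) (Hm _ _ (Nat.le_succ_diag_r k) Hk) Hl)
          as [I1 [I2 I3]].
        apply Ht in I2. specialize (HXl s). lra.
    + destruct l as [|l].
      * specialize (H1 k Hk). specialize (HX1 (S s)). lra.
      * pose proof (Hm _ _ (Nat.le_succ_diag_r l) Hl) as Hl'.
        destruct (IH k l ltac:(lia) Hk Hl') as [I1 [I2 I3]].
        pose proof (Hmix k l ltac:(lia) Hk Hl') as Hd.
        replace ((E (S k) (S l) - E (S k) l - E k (S l) + E k l) / (e * e)) with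
          (((E (S k) (S l) - E k (S l)) / e - (E (S k) l - E k l) / e) / e)
          in Hd by (field; lra).
        apply Ht in Hd. specialize (HXS s). specialize (HX1 s). nra.
    + destruct k as [|k].
      * specialize (H2 l Hl). specialize (HX1 (S s)). lra.
      * pose proof (Hm _ _ (Nat.le_succ_diag_r k) Hk) as Hk'.
        destruct (IH k l ltac:(lia) Hk' Hl) as [I1 [I2 I3]].
        pose proof (Hmix k l ltac:(lia) Hk' Hl) as Hd.
        replace ((E (S k) (S l) - E (S k) l - E k (S l) + E k l) / (e * e)) with
          (((E (S k) (S l) - E (S k) l) / e - (E k (S l) - E k l) / e) / e)
          in Hd by (field; lra).
        apply Ht in Hd. specialize (HXS s). specialize (HX1 s). nra. }
intros k l Hk Hl. destruct (Hmain _ k l eq_refl Hk Hl) as [Hb _].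
apply Rle_trans with (1 := Hb). unfold X. rewrite plus_INR.
apply Rmult_le_compat_l; [lra|].
assert (HL : L * ((INR k + INR l) * e) <= L * (T' + T')).
{ apply Rmult_le_compat_l; [unfold L; lra|lra]. }
destruct (Req_dec (L * ((INR k + INR l) * e)) (L * (T' + T'))) as [<-|Hne];
  [apply Rle_refl|left; apply exp_increasing; lra].
Qed.

Definition discrete_moutard (q : R -> R -> R) (u : family) : Prop :=
  forall e k l, u e (S k) (S l) + u e k l
    = (1 + / 2 * e ^ 2 * q (INR k * e) (INR l * e)) * (u e (S k) l + u e k (S l)).

(* The rescaled error [E = (u - F) / eps] is bounded by [goursat_bound].  Its
   difference quotient in one direction solves an ODE along the other one whose
   right-hand side involves the transversal quotient only through
   [eps * dl b E = sh b E - E]; so bounds on [E] up to order [N] give bounds on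
   [dl b E] up to order [N], that is, on [E] up to order [N + 1]. *)
Lemma conv_moutard T q u F :
  0 < T -> Cinf T q -> moutard T q F -> discrete_moutard q u ->
  conv T (axis true u) (fun _ y => F 0 y) ->
  conv T (axis false u) (fun x _ => F x 0) -> conv T u F.
Proof.
intros HT Hq [HF EF] Hu Ha1 Ha2.
pose proof (conv_rs T F) as Cr.
(* Right-hand side of the discrete equation in quotient form: for [u] the mixed difference quotient
   is exactly [m u]. *)
set (m := fun g : family => fun e k l => / 2 * rs q e k l * (sh true g e k l + sh false g e k l)).
set (E := fun e k l => (u e k l - rs F e k l) / e).
(* The consistency error over [e]. It is bounded at every order because both terms converge to
   [q * F] with order O(e). *)
set (rho := fun e k l => (m (rs F) e k l - dl false (dl true (rs F)) e k l) / e).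
assert (Hrho : forall N, Bc T N rho).
{ intros N.
  assert (C1 : conv T (m (rs F)) (fun x y => / 2 * q x y * (F x y + F x y))).
  { apply conv_mult.
    - intros M; apply Ck_mult; [apply Ck_const|apply Hq].
    - intros M; apply Ck_plus; apply HF.
    - apply (conv_mult T (fun _ _ _ => / 2) (rs q) (fun _ _ => / 2) q); auto.
      + intros M; apply Ck_const.
      + exact (conv_rs T (fun _ _ => / 2)).
      + apply conv_rs.
    - apply conv_plus; apply conv_sh; auto. }
  assert (C2 : conv T (dl false (dl true (rs F))) (D false (D true F))).
  { apply conv_dl; [apply Cinf_D, HF|]. apply conv_dl; auto. }
  apply Bc_ext with (2 := Bc_minus _ _ _ _ (C1 N) (C2 N)).
  apply evg_imp with (2 := evg_and _ _ _ (evg_pos T (fun e _ _ => 0 < e) (fun _ _ _ h => h))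
    (evg_box T _ (fun x y h => proj2 (EF x y h)))).
  intros e k l He [_ H2]. cbv beta in H2. unfold rho, rs. rewrite H2. field. lra. }
assert (Hmix : forall e k l, 0 < e -> dl false (dl true E) e k l = m E e k l + rho e k l).
{ intros e k l He. unfold rho, m, E, dl, sh.
  assert (Hu' : u e (S k) (S l) =
    (1 + / 2 * e ^ 2 * rs q e k l) * (u e (S k) l + u e k (S l)) - u e k l).
  { unfold rs. rewrite <- Hu. ring. }
  rewrite Hu'. field. lra. }
assert (HaE : forall b N, Bc T N (axis b E)).
{ intros b N. destruct b.
  - apply Bc_ext_pos with (2 := Ha1 N). intros e k l He. unfold axis, E, rs.
    simpl INR. rewrite Rmult_0_l. reflexivity.
  - apply Bc_ext_pos with (2 := Ha2 N). intros e k l He. unfold axis, E, rs.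
    simpl INR. rewrite Rmult_0_l. reflexivity. }
assert (HE0 : bnd T E).
{ intros T' HT'.
  destruct (bnd_nonneg T _ T' (Bc_bnd T 0 _ (Bc_rs T 0 _ Hq)) HT') as [Q [HQ0 HQ]].
  destruct (bnd_nonneg T _ T' (Bc_bnd T 0 _ (Hrho 0%nat)) HT') as [P [HP0 HP]].
  destruct (bnd_nonneg T _ T' (Bc_bnd T 0 _ (proj2 (HaE false 1%nat) true)) HT')
    as [A1 [HA10 HA1]].
  destruct (bnd_nonneg T _ T' (Bc_bnd T 0 _ (proj2 (HaE true 1%nat) false)) HT')
    as [A2 [HA20 HA2]].
  destruct (bnd_nonneg T _ T' (Bc_bnd T 0 _ (HaE true 0%nat)) HT') as [A3 [HA30 HA3]].
  exists ((A1 + A2 + A3 + 1) * exp ((4 * Q + P + 1) * (T' + T'))).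
  apply at_right_imp with (2 := at_right_and _ _ (at_right_and _ _
    (at_right_and _ _ HQ HP) (at_right_and _ _ HA1 HA2))
    (at_right_and _ _ HA3 (at_right_lt 1 Rlt_0_1))).
  intros e He [[[B1 B2] [B3 B4]] [B5 B6]] k l Hk Hl.
  assert (HT0 : INR 0 * e <= T') by (pose proof (pos_INR k); simpl (INR 0); nra).
  apply (goursat_bound (E e) e Q P (A1 + A2 + A3) T'); auto; try lra.
  - specialize (B5 0%nat 0%nat HT0 HT0). unfold axis in B5. lra.
  - intros k' Hk'. specialize (B3 k' 0%nat Hk' HT0). unfold dl, sh, axis in B3. lra.
  - intros l' Hl'. specialize (B4 0%nat l' HT0 Hl'). unfold dl, sh, axis in B4. lra.
  - intros k' l' Hk' Hl'.
    replace ((E e (S k') (S l') - E e (S k') l' - E e k' (S l') + E e k' l') / (e * e))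
      with (dl false (dl true E) e k' l') by (unfold dl, sh; field; lra).
    rewrite Hmix by assumption.
    eapply Rle_trans; [apply Rabs_triang|].
    apply Rplus_le_compat; [|apply B2; assumption].
    unfold m, sh. rewrite !Rabs_mult, (Rabs_pos_eq (/ 2)) by lra.
    specialize (B1 k' l' Hk' Hl').
    pose proof (Rabs_triang (E e (S k') l') (E e k' (S l'))).
    apply Rmult_le_compat; auto using Rabs_pos.
    + pose proof (Rabs_pos (rs q e k' l')); lra.
    + pose proof (Rabs_pos (rs q e k' l')); lra. }
set (c := fun e k l => / 2 * (e * rs q e k l)).
assert (Hc : forall N, Bc T N c).
{ intros N; apply Bc_scal, Bc_mult; [apply Bc_eps|apply Bc_rs, Hq]. }
assert (Hstep : forall b N, Bc T N E -> Bc T N (dl b E)).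
{ intros b N HE.
  apply (Bc_ode T N (negb b) c _ (fun e k l =>
    / 2 * (rs q e k l * (E e k l + sh (negb b) E e k l)) + rho e k l)).
  - exact Hc.
  - apply Bc_plus; [apply Bc_scal, Bc_mult|apply Hrho].
    + apply Bc_rs, Hq.
    + apply Bc_plus; [exact HE|apply Bc_sh, HE].
  - pose proof (dl_axis (negb b) E) as Hx. rewrite Bool.negb_involutive in Hx.
    rewrite <- Hx. apply (HaE (negb b) (S N)).
  - apply evg_pos. intros e k l He.
    replace (dl (negb b) (dl b E) e k l) with (dl false (dl true E) e k l)
      by (destruct b; [reflexivity|rewrite dl_dl; reflexivity]).
    rewrite Hmix by assumption. unfold m, c, dl, sh. destruct b; simpl; field; lra. }
intros N. fold E. induction N as [|N IH]; [apply Bc_0, HE0|].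
split; [exact HE0|]. intros b; apply Hstep, IH.
Qed.

(** * Uniqueness of the smooth objects *)

(** For both signs [A * exp (L * t) - s * f t] starts at [A >= 0] and has nonnegative derivative. *)
Lemma exp_domination (f df : R -> R) A L y :
  0 <= A -> 0 <= y -> f 0 = 0 ->
  (forall t, 0 <= t <= y -> is_derive f t (df t)) ->
  (forall t, 0 <= t <= y -> Rabs (df t) <= A * (L * exp (L * t))) ->
  Rabs (f y) <= A * exp (L * y).
Proof.
intros HA Hy H0 Hf Hd.
assert (Hs : forall s, s = 1 \/ s = -1 -> 0 <= A * exp (L * y) - s * f y).
{ intros s Hs.
  set (g := fun t => A * exp (L * t) - s * f t).
  assert (Hg : forall t, 0 <= t <= y -> is_derive g t (A * (L * exp (L * t)) - s * df t)).
  { intros t Ht. refine (is_derive_minus (fun t => A * exp (L * t)) (fun t => s * f t) _ _ _ _ _).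
    - auto_derive; [exact I|ring].
    - apply (is_derive_scal f), Hf, Ht. }
  destruct (MVT_gen g 0 y (fun t => A * (L * exp (L * t)) - s * df t)) as [c [Hc E]].
  - intros t Ht; rewrite Rmin_left, Rmax_right in Ht by lra; apply Hg; lra.
  - intros t Ht; rewrite Rmin_left, Rmax_right in Ht by lra.
    apply continuity_pt_filterlim, (ex_derive_continuous g t).
    eexists; apply Hg; lra.
  - rewrite Rmin_left, Rmax_right in Hc by lra.
    specialize (Hd c Hc). apply Rabs_le_between in Hd.
    assert (0 <= (A * (L * exp (L * c)) - s * df c) * (y - 0)).
    { apply Rmult_le_pos; [|lra]. destruct Hs as [-> | ->]; lra. }
    unfold g in E. rewrite H0, !Rmult_0_r, exp_0 in E. lra. }
pose proof (Hs 1 (or_introl eq_refl)). pose proof (Hs (-1) (or_intror eq_refl)).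
apply Rabs_le; lra.
Qed.

(* Bounds of the form [S 2^-m exp (4 K (x + y))] improve themselves: integrating
   the equations once gains the factor [2 K / (4 K) = 1/2]. *)
Lemma linear_goursat_unique r K S (e1 e2 d1 d2 : R -> R -> R) :
  0 < K ->
  (forall x y, in_square r x y -> Rabs (e1 x y) <= S /\ Rabs (e2 x y) <= S) ->
  (forall x y, in_square r x y ->
    is_derive (e1 x) y (d1 x y) /\ is_derive (fun s => e2 s y) x (d2 x y)) ->
  (forall x y, in_square r x y ->
    Rabs (d1 x y) <= K * (Rabs (e1 x y) + Rabs (e2 x y)) /\
    Rabs (d2 x y) <= K * (Rabs (e1 x y) + Rabs (e2 x y))) ->
  (forall x, 0 <= x <= r -> e1 x 0 = 0) ->
  (forall y, 0 <= y <= r -> e2 0 y = 0) ->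
  forall x y, in_square r x y -> e1 x y = 0 /\ e2 x y = 0.
Proof.
intros HK HS HD Hd H1 H2.
assert (HB : forall m x y, in_square r x y ->
  Rabs (e1 x y) <= Rabs S * (/ 2) ^ m * exp (4 * K * (x + y)) /\
  Rabs (e2 x y) <= Rabs S * (/ 2) ^ m * exp (4 * K * (x + y))).
{ induction m as [|m IH]; intros x y Hxy; pose proof Hxy as [Hx Hy].
  - destruct (HS x y Hxy). pose proof (Rle_abs S).
    pose proof (exp_ineq1_le (4 * K * (x + y))).
    assert (0 <= 4 * K * (x + y)) by (apply Rmult_le_pos; lra).
    pose proof (Rabs_pos S). simpl. rewrite Rmult_1_r. split; nra.
  - assert (HA : 0 <= Rabs S * (/ 2) ^ m).
    { apply Rmult_le_pos; [apply Rabs_pos|apply pow_le; lra]. }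
    assert (Hd' : forall s t, in_square r s t ->
      Rabs (d1 s t) <= Rabs S * (/ 2) ^ m * / 2 * (4 * K * exp (4 * K * (s + t))) /\
      Rabs (d2 s t) <= Rabs S * (/ 2) ^ m * / 2 * (4 * K * exp (4 * K * (s + t)))).
    { intros s t Hst. destruct (IH s t Hst), (Hd s t Hst).
      assert (K * (Rabs (e1 s t) + Rabs (e2 s t)) <=
        K * (2 * (Rabs S * (/ 2) ^ m * exp (4 * K * (s + t)))))
        by (apply Rmult_le_compat_l; lra).
      lra. }
    replace (Rabs S * (/ 2) ^ Datatypes.S m) with (Rabs S * (/ 2) ^ m * / 2) by (simpl; ring).
    rewrite Rmult_plus_distr_l, exp_plus.
    pose proof (exp_pos (4 * K * x)); pose proof (exp_pos (4 * K * y)).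
    split.
    + rewrite <- Rmult_assoc.
      apply (exp_domination (e1 x) (d1 x)); auto.
      * apply Rmult_le_pos; lra.
      * lra.
      * intros t Ht; apply HD; split; lra.
      * intros t Ht. eapply Rle_trans; [apply Hd'; split; lra|].
        rewrite (Rmult_plus_distr_l _ x t), exp_plus. right; ring.
    + rewrite (Rmult_comm (exp (4 * K * x))), <- Rmult_assoc.
      apply (exp_domination (fun s => e2 s y) (fun s => d2 s y)); auto.
      * apply Rmult_le_pos; lra.
      * lra.
      * intros t Ht; apply HD; split; lra.
      * intros t Ht. eapply Rle_trans; [apply Hd'; split; lra|].
        rewrite (Rmult_plus_distr_l _ t y), exp_plus. right; ring. }
intros x y Hxy.
assert (Hz : forall z, (forall m, Rabs z <= Rabs S * (/ 2) ^ m * exp (4 * K * (x + y))) -> z = 0).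
{ intros z Hz. apply Rminus_diag_uniq. apply cond_eq. intros e He. rewrite Rminus_0_r.
  set (C := Rabs S * exp (4 * K * (x + y))).
  assert (HC : 0 <= C) by (apply Rmult_le_pos; [apply Rabs_pos|left; apply exp_pos]).
  assert (He' : 0 < e / (C + 1)) by (apply Rdiv_lt_0_compat; lra).
  destruct (pow_lt_1_zero (/ 2)) with (y := e / (C + 1)) as [n Hn];
    [rewrite Rabs_pos_eq; lra|exact He'|].
  specialize (Hn n (Nat.le_refl n)).
  assert (Hp : 0 < (/ 2) ^ n) by (apply pow_lt; lra).
  rewrite Rabs_pos_eq in Hn by lra. apply Rlt_div_r in Hn; [|lra].
  rewrite Rminus_0_r. specialize (Hz n).
  replace (Rabs S * (/ 2) ^ n * exp (4 * K * (x + y))) with (C * (/ 2) ^ n) in Hz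
    by (unfold C; ring). nra. }
split; apply Hz; intros m; apply HB, Hxy.
Qed.

(** A Goursat system whose second unknown is zero and in which x is a dummy variable. *)
Lemma linear_ode_unique r K S (f df : R -> R) :
  0 < K -> (forall t, 0 <= t <= r -> Rabs (f t) <= S) ->
  (forall t, 0 <= t <= r -> is_derive f t (df t)) ->
  (forall t, 0 <= t <= r -> Rabs (df t) <= K * Rabs (f t)) ->
  f 0 = 0 -> forall t, 0 <= t <= r -> f t = 0.
Proof.
intros HK HS Hf Hd H0 t Ht.
assert (HS0 : 0 <= S) by (specialize (HS t Ht); pose proof (Rabs_pos (f t)); lra).
apply (linear_goursat_unique r K S (fun _ y => f y) (fun _ _ => 0)
  (fun _ y => df y) (fun _ _ => 0)) with (x := 0) (y := t); auto.
- intros x y [_ Hy]; rewrite Rabs_R0; auto.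
- intros x y [_ Hy]; split; [apply Hf, Hy|apply (is_derive_const 0)].
- intros x y [_ Hy]; rewrite Rabs_R0, Rplus_0_r. split; [auto|].
  apply Rmult_le_pos; [lra|apply Rabs_pos].
- split; lra.
Qed.

(* Endpoints are included: there the derivative is determined from one side. *)
Lemma derive_zero_on_segment r f x d :
  0 < r -> 0 <= x <= r -> is_derive f x d ->
  (forall t, 0 <= t <= r -> f t = 0) -> d = 0.
Proof.
intros Hr Hx Hd Hf. apply cond_eq; intros e He. rewrite Rminus_0_r.
apply is_derive_Reals in Hd. destruct (Hd e He) as [del Hdel].
pose proof (cond_pos del) as Hp.
(* A step of this length stays in the segment if taken to the right from the left half and to the
   left from the right half. *)
set (h := Rmin (del / 2) (r / 2)).
assert (Hh : 0 < h) by (apply Rmin_pos; lra).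
assert (Hh1 : h <= del / 2) by apply Rmin_l.
assert (Hh2 : h <= r / 2) by apply Rmin_r.
assert (Hgo : forall k, k <> 0 -> Rabs k = h -> 0 <= x + k <= r -> Rabs d < e).
{ intros k Hk Hkh Hxk. specialize (Hdel k Hk ltac:(lra)).
  rewrite (Hf (x + k) Hxk), (Hf x Hx) in Hdel.
  replace ((0 - 0) / k - d) with (- d) in Hdel by (field; exact Hk).
  rewrite Rabs_Ropp in Hdel. exact Hdel. }
destruct (Rle_dec x (r / 2)).
- apply (Hgo h); [lra|apply Rabs_pos_eq; lra|lra].
- apply (Hgo (- h)); [lra|rewrite Rabs_Ropp; apply Rabs_pos_eq; lra|lra].
Qed.

Lemma smooth_on_derive r F x y :
  smooth_on r F -> in_square r x y ->
  is_derive (fun s => F s y) x (D true F x y) /\ is_derive (F x) y (D false F x y).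
Proof.
intros HF Hxy. pose proof (locally_2d_singleton _ _ _ (HF x y Hxy) 1%nat) as H.
destruct H as (_ & H1 & H2 & _). split; apply Derive_correct; assumption.
Qed.

Lemma smooth_on_D r b F : smooth_on r F -> smooth_on r (D b F).
Proof.
intros HF x y Hxy. apply locally_2d_impl with (2 := HF x y Hxy).
apply locally_2d_forall. intros u v H m. destruct (H (S m)) as (_ & _ & _ & H1 & H2).
destruct b; assumption.
Qed.

Lemma smooth_on_bounded r F : smooth_on r F ->
  exists M, 0 <= M /\ forall x y, in_square r x y -> Rabs (F x y) <= M.
Proof.
intros HF. destruct (rect_bounded F 0 r 0 r) as [M [HM0 HM]].
- intros x y Hx Hy.
  exact (proj1 (locally_2d_singleton _ _ _ (HF x y (conj Hx Hy)) 0%nat)).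
- exists M; split; [exact HM0|]. intros x y [Hx Hy]; auto.
Qed.

Lemma smooth_on_D_unique r b F G x y :
  0 < r -> smooth_on r F -> smooth_on r G ->
  (forall x y, in_square r x y -> F x y = G x y) ->
  in_square r x y -> D b F x y = D b G x y.
Proof.
intros Hr HF HG E Hxy. pose proof Hxy as [Hx Hy].
destruct (smooth_on_derive r F x y HF Hxy) as [F1 F2],
  (smooth_on_derive r G x y HG Hxy) as [G1 G2].
apply Rminus_diag_uniq. destruct b.
- apply (derive_zero_on_segment r (fun s => F s y - G s y) x); auto.
  + refine (is_derive_minus (fun s => F s y) (fun s => G s y) _ _ _ _ _); assumption.
  + intros t Ht. apply Rminus_diag_eq, E; split; assumption.
- apply (derive_zero_on_segment r (fun s => F x s - G x s) y); auto.
  + refine (is_derive_minus (F x) (G x) _ _ _ _ _); assumption.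
  + intros t Ht. apply Rminus_diag_eq, E; split; assumption.
Qed.

Lemma Rabs_minus_le a b M N : Rabs a <= M -> Rabs b <= N -> Rabs (a - b) <= M + N.
Proof.
intros Ha Hb. eapply Rle_trans; [apply (Rabs_triang a (- b))|].
rewrite Rabs_Ropp. lra.
Qed.

Lemma smooth_on_derive_minus r F G x y :
  smooth_on r F -> smooth_on r G -> in_square r x y ->
  is_derive (fun s => F s y - G s y) x (D true F x y - D true G x y) /\
  is_derive (fun t => F x t - G x t) y (D false F x y - D false G x y).
Proof.
intros HF HG Hxy. destruct (smooth_on_derive r F x y HF Hxy) as [F1 F2],
  (smooth_on_derive r G x y HG Hxy) as [G1 G2]. split.
- refine (is_derive_minus (fun s => F s y) (fun s => G s y) _ _ _ _ _); assumption.
- refine (is_derive_minus (F x) (G x) _ _ _ _ _); assumption.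
Qed.

(** The pair formed by the difference w = u - v and D2 w is a linear Goursat system: the first
    evolves in y with rate D2 w, the second in x with rate q w. On x = 0 the second vanishes as the
    derivative of w along that axis. *)
Lemma moutard_unique r q u v :
  0 < r -> smooth_on r q -> smooth_on r u -> smooth_on r v ->
  (forall x y, in_square r x y -> D true (D false u) x y = q x y * u x y) ->
  (forall x y, in_square r x y -> D true (D false v) x y = q x y * v x y) ->
  (forall x, 0 <= x <= r -> u x 0 = v x 0) ->
  (forall y, 0 <= y <= r -> u 0 y = v 0 y) ->
  forall x y, in_square r x y -> u x y = v x y.
Proof.
intros Hr Hq Hu Hv Eu Ev H1 H2 x y Hxy.
pose proof (smooth_on_D r false u Hu) as Hu2.
pose proof (smooth_on_D r false v Hv) as Hv2.
destruct (smooth_on_bounded r q Hq) as [Q [HQ0 HQ]],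
  (smooth_on_bounded r u Hu) as [M1 [_ HM1]], (smooth_on_bounded r v Hv) as [M2 [_ HM2]],
  (smooth_on_bounded r _ Hu2) as [M3 [HM30 HM3]], (smooth_on_bounded r _ Hv2) as [M4 [HM40 HM4]].
apply Rminus_diag_uniq.
apply (linear_goursat_unique r (Q + 1) (Rmax (M1 + M2) (M3 + M4))
  (fun x y => u x y - v x y) (fun x y => D false u x y - D false v x y)
  (fun x y => D false u x y - D false v x y)
  (fun x y => D true (D false u) x y - D true (D false v) x y)); auto.
- lra.
- intros s t Hst. pose proof (Rmax_l (M1 + M2) (M3 + M4)).
  pose proof (Rmax_r (M1 + M2) (M3 + M4)).
  pose proof (Rabs_minus_le _ _ _ _ (HM1 s t Hst) (HM2 s t Hst)).
  pose proof (Rabs_minus_le _ _ _ _ (HM3 s t Hst) (HM4 s t Hst)). lra.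
- intros s t Hst; split.
  + apply (smooth_on_derive_minus r u v s t Hu Hv Hst).
  + apply (smooth_on_derive_minus r _ _ s t Hu2 Hv2 Hst).
- intros s t Hst. rewrite Eu, Ev by exact Hst.
  rewrite <- Rmult_minus_distr_l, Rabs_mult. specialize (HQ s t Hst).
  pose proof (Rabs_pos (u s t - v s t)).
  pose proof (Rabs_pos (D false u s t - D false v s t)). split; nra.
- intros s Hs; apply Rminus_diag_eq, H1, Hs.
- intros t Ht.
  apply (derive_zero_on_segment r (fun t => u 0 t - v 0 t) t); auto.
  + apply (smooth_on_derive_minus r u v 0 t Hu Hv). split; lra.
  + intros t' Ht'. apply Rminus_diag_eq, H2, Ht'.
Qed.

(** Linear ODE uniqueness along the first axis, then along each vertical line. With zero
    coefficients it recovers a function from its gradient; with [p1], [p2] it determines the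
    transformed normal field. *)
Lemma evolution_unique r p1 p2 u v u1 u2 v1 v2 :
  0 < r -> smooth_on r p1 -> smooth_on r p2 -> smooth_on r u -> smooth_on r v ->
  (forall x y, in_square r x y ->
    D true u x y = u1 x y + p1 x y * u x y /\ D false u x y = u2 x y + p2 x y * u x y) ->
  (forall x y, in_square r x y ->
    D true v x y = v1 x y + p1 x y * v x y /\ D false v x y = v2 x y + p2 x y * v x y) ->
  (forall x y, in_square r x y -> u1 x y = v1 x y /\ u2 x y = v2 x y) ->
  u 0 0 = v 0 0 -> forall x y, in_square r x y -> u x y = v x y.
Proof.
intros Hr Hp1 Hp2 Hu Hv Eu Ev E H0.
destruct (smooth_on_bounded r p1 Hp1) as [P1 [HP10 HP1]],
  (smooth_on_bounded r p2 Hp2) as [P2 [HP20 HP2]],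
  (smooth_on_bounded r u Hu) as [M1 [_ HM1]], (smooth_on_bounded r v Hv) as [M2 [_ HM2]].
assert (Ex : forall x, 0 <= x <= r -> u x 0 = v x 0).
{ intros x Hx. apply Rminus_diag_uniq.
  apply (linear_ode_unique r (P1 + 1) (M1 + M2) (fun x => u x 0 - v x 0)
    (fun x => D true u x 0 - D true v x 0)); auto; try lra.
  - intros t Ht; apply Rabs_minus_le; [apply HM1|apply HM2]; split; lra.
  - intros t Ht; apply (smooth_on_derive_minus r u v t 0 Hu Hv). split; lra.
  - intros t Ht. assert (Hs : in_square r t 0) by (split; lra).
    destruct (Eu t 0 Hs) as [-> _], (Ev t 0 Hs) as [-> _], (E t 0 Hs) as [-> _].
    replace (_ - _) with (p1 t 0 * (u t 0 - v t 0)) by ring. rewrite Rabs_mult.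
    apply Rmult_le_compat_r; [apply Rabs_pos|]. specialize (HP1 t 0 Hs); lra. }
intros x y [Hx Hy]. apply Rminus_diag_uniq.
apply (linear_ode_unique r (P2 + 1) (M1 + M2) (fun y => u x y - v x y)
  (fun y => D false u x y - D false v x y)); auto; try lra.
- intros t Ht; apply Rabs_minus_le; [apply HM1|apply HM2]; split; lra.
- intros t Ht; apply (smooth_on_derive_minus r u v x t Hu Hv). split; lra.
- intros t Ht. assert (Hs : in_square r x t) by (split; lra).
  destruct (Eu x t Hs) as [_ ->], (Ev x t Hs) as [_ ->], (E x t Hs) as [_ ->].
  replace (_ - _) with (p2 x t * (u x t - v x t)) by ring. rewrite Rabs_mult.
  apply Rmult_le_compat_r; [apply Rabs_pos|]. specialize (HP2 x t Hs); lra.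
- apply Rminus_diag_eq, Ex, Hx.
Qed.

(** The difference of the products is (p1 - p1') p2' + p1 (p2 - p2'), linear in the differences with
    coefficients bounded on the closed square; hence linear Goursat uniqueness applies to the
    nonlinear system. *)
Lemma riccati_unique r q p1 p2 p1' p2' :
  0 < r -> smooth_on r p1 -> smooth_on r p2 -> smooth_on r p1' -> smooth_on r p2' ->
  (forall x y, in_square r x y ->
    D true p2 x y = - q x y + p1 x y * p2 x y /\ D false p1 x y = - q x y + p1 x y * p2 x y) ->
  (forall x y, in_square r x y ->
    D true p2' x y = - q x y + p1' x y * p2' x y /\
    D false p1' x y = - q x y + p1' x y * p2' x y) ->
  (forall x, 0 <= x <= r -> p1 x 0 = p1' x 0) ->
  (forall y, 0 <= y <= r -> p2 0 y = p2' 0 y) ->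
  forall x y, in_square r x y -> p1 x y = p1' x y /\ p2 x y = p2' x y.
Proof.
intros Hr H1 H2 H1' H2' E E' A1 A2.
destruct (smooth_on_bounded r p1 H1) as [M1 [M10 HM1]],
  (smooth_on_bounded r p2 H2) as [M2 [M20 HM2]],
  (smooth_on_bounded r p1' H1') as [M3 [M30 HM3]],
  (smooth_on_bounded r p2' H2') as [M4 [M40 HM4]].
assert (HU : forall x y, in_square r x y -> p1 x y - p1' x y = 0 /\ p2 x y - p2' x y = 0).
{ apply (linear_goursat_unique r (M1 + M4 + 1) (M1 + M2 + M3 + M4)
    (fun x y => p1 x y - p1' x y) (fun x y => p2 x y - p2' x y)
    (fun x y => D false p1 x y - D false p1' x y)
    (fun x y => D true p2 x y - D true p2' x y)); auto.
  - lra.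
  - intros s t Hst.
    pose proof (Rabs_minus_le _ _ _ _ (HM1 s t Hst) (HM3 s t Hst)).
    pose proof (Rabs_minus_le _ _ _ _ (HM2 s t Hst) (HM4 s t Hst)). lra.
  - intros s t Hst; split.
    + apply (smooth_on_derive_minus r p1 p1' s t H1 H1' Hst).
    + apply (smooth_on_derive_minus r p2 p2' s t H2 H2' Hst).
  - intros s t Hst. destruct (E s t Hst) as [-> ->], (E' s t Hst) as [-> ->].
    replace (_ - _) with
      ((p1 s t - p1' s t) * p2' s t + p1 s t * (p2 s t - p2' s t)) by ring.
    specialize (HM1 s t Hst); specialize (HM4 s t Hst).
    assert (Rabs ((p1 s t - p1' s t) * p2' s t + p1 s t * (p2 s t - p2' s t)) <=
      (M1 + M4 + 1) * (Rabs (p1 s t - p1' s t) + Rabs (p2 s t - p2' s t))).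
    { eapply Rle_trans; [apply Rabs_triang|]. rewrite !Rabs_mult.
      pose proof (Rabs_pos (p1 s t - p1' s t)); pose proof (Rabs_pos (p2 s t - p2' s t)).
      nra. }
    auto.
  - intros s Hs; apply Rminus_diag_eq, A1, Hs.
  - intros s Hs; apply Rminus_diag_eq, A2, Hs. }
intros x y Hxy. destruct (HU x y Hxy). split; apply Rminus_diag_uniq; assumption.
Qed.

(** * Arithmetic of smooth functions and the axis values of [th] *)

Lemma Cinf_plus T F G : Cinf T F -> Cinf T G -> Cinf T (fun x y => F x y + G x y).
Proof. intros HF HG N; apply Ck_plus; auto. Qed.

Lemma Cinf_minus T F G : Cinf T F -> Cinf T G -> Cinf T (fun x y => F x y - G x y).
Proof. intros HF HG N; apply Ck_minus; auto. Qed.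

Lemma Cinf_mult T F G : Cinf T F -> Cinf T G -> Cinf T (fun x y => F x y * G x y).
Proof. intros HF HG N; apply Ck_mult; auto. Qed.

Lemma Cinf_opp T F : Cinf T F -> Cinf T (fun x y => - F x y).
Proof. intros HF N; apply Ck_opp; auto. Qed.

Lemma Cinf_inv T F : (forall x y, box T x y -> F x y <> 0) ->
  Cinf T F -> Cinf T (fun x y => / F x y).
Proof. intros H0 HF N; apply Ck_inv; auto. Qed.

(** Provides the values of [th] on an axis, where - th'/th must be the prescribed coefficient.
    Smoothness is a bootstrap through the equation h' = - p h. *)
Lemma exp_ode (p : R -> R) : (forall T, Cinf T (fun x _ => p x)) ->
  exists h, h 0 = 1 /\ (forall x, is_derive h x (- p x * h x)) /\
    forall T, Cinf T (fun x _ => h x).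
Proof.
intros Hp.
assert (Hc : forall x, continuous p x).
{ intros x. apply continuity_pt_filterlim.
  apply (continuity_pt_ext (fun x => p x)); [reflexivity|].
  apply continuity_pt_filterlim.
  apply (cont_slice (Rabs x + 1) 0 (fun _ y => p y) 0 x).
  - apply (Ck_swap _ 0 (fun x _ => p x)), Hp.
  - pose proof (Rabs_pos x). split; rewrite ?Rabs_R0; lra. }
set (h := fun x => exp (- RInt p 0 x)).
assert (Hd : forall x, is_derive h x (- p x * h x)).
{ intros x. unfold h.
  replace (- p x * exp (- RInt p 0 x)) with (scal (- p x) (exp (- RInt p 0 x)))
    by reflexivity.
  apply (is_derive_comp exp (fun x => - RInt p 0 x)); [apply is_derive_exp|].
  apply (is_derive_opp (RInt p 0)). apply is_derive_RInt with 0; [|apply Hc].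
  apply filter_forall. intros y. apply (RInt_correct p).
  apply (ex_RInt_continuous (V := R_CompleteNormedModule)). auto. }
exists h; split; [|split; [exact Hd|]].
- unfold h. rewrite RInt_point. change (exp (- 0) = 1). rewrite Ropp_0; apply exp_0.
- intros T N; induction N as [|N IH].
  + apply Ck_0; intros x y _.
    apply (continuity_1d_2d_pt_comp h (fun u _ => u)); [|apply continuity_2d_pt_id1].
    apply continuity_pt_filterlim, (ex_derive_continuous h).
    eexists; apply Hd.
  + apply (Ck_intro T N _ (fun x _ => - p x * h x) (fun _ _ => 0)).
    * intros x y _; split; [apply Hd|apply (is_derive_const (h x))].
    * apply Ck_mult; [apply (Ck_opp T N (fun x _ => p x)), Hp|exact IH].
    * apply Ck_const.
Qed.

(** * The smooth Moutard and Weingarten transforms *)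

Definition logder (b : bool) (th : R -> R -> R) (x y : R) : R :=
  - D b th x y * / th x y.

Section SmoothTransform.

Context (T : R) (q th : R -> R -> R).
Context (Hth : moutard T q th) (th0 : forall x y, box T x y -> th x y <> 0).

Lemma logder_Cinf b : Cinf T (logder b th).
Proof.
apply Cinf_mult; [apply Cinf_opp, Cinf_D, Hth|apply Cinf_inv; [exact th0|apply Hth]].
Qed.

Lemma logder_riccati x y : box T x y ->
  D true (logder false th) x y = - q x y + logder true th x y * logder false th x y /\
  D false (logder true th) x y = - q x y + logder true th x y * logder false th x y.
Proof.
intros Hb. pose proof Hth as [HC HE].
pose proof (partials_inv T _ _ _ th0 (Cinf_partials T th HC)) as PI.
assert (PN : forall b, partials T (fun x y => - D b th x y)
  (fun x y => 0 - D true (D b th) x y) (fun x y => 0 - D false (D b th) x y)).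
{ intros b. apply partials_ext with (fun x y => 0 - D b th x y)
    (fun x y => 0 - D true (D b th) x y) (fun x y => 0 - D false (D b th) x y);
    [intros; ring|reflexivity|reflexivity|].
  apply partials_minus; [apply partials_const|apply Cinf_partials, Cinf_D, HC]. }
split.
- etransitivity;
    [exact (proj1 (partials_D T _ _ _ x y (partials_mult T _ _ _ _ _ _ (PN false) PI) Hb))|].
  cbv beta. rewrite (proj1 (HE x y Hb)). unfold logder. field. auto.
- etransitivity;
    [exact (proj2 (partials_D T _ _ _ x y (partials_mult T _ _ _ _ _ _ (PN true) PI) Hb))|].
  cbv beta. rewrite (proj2 (HE x y Hb)). unfold logder. field. auto.
Qed.

Lemma transform_partials n M :
  moutard T q n ->
  partials T M (fun x y => D true th x y * n x y - th x y * D true n x y)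
    (fun x y => th x y * D false n x y - D false th x y * n x y) ->
  partials T (fun x y => M x y * / th x y)
    (fun x y => - D true n x y + logder true th x y * (M x y * / th x y - n x y))
    (fun x y => D false n x y + logder false th x y * (M x y * / th x y + n x y)).
Proof.
intros [Hn _] HM.
pose proof (partials_inv T _ _ _ th0 (Cinf_partials T th (proj1 Hth))) as PI.
apply partials_ext with (4 := partials_mult T _ _ _ _ _ _ HM PI);
  [reflexivity| |]; intros x y Hb; unfold logder; field; auto.
Qed.

(** The new normal field has the potential 2 p1 p2 - q. It appears on differentiating the formula
    for [D false np] in x and inserting the Moutard and Riccati equations. *)
Lemma transform_moutard n np :
  moutard T q n -> Cinf T np ->
  partials T np
    (fun x y => - D true n x y + logder true th x y * (np x y - n x y))
    (fun x y => D false n x y + logder false th x y * (np x y + n x y)) ->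
  forall x y, box T x y -> D true (D false np) x y =
    (2 * (logder true th x y * logder false th x y) - q x y) * np x y.
Proof.
intros [Hn En] Hnp HP x y Hb.
assert (PF : partials T (D false np)
  (fun x y => D true (D false n) x y +
    (D true (logder false th) x y * (np x y + n x y) + logder false th x y *
      ((- D true n x y + logder true th x y * (np x y - n x y)) + D true n x y)))
  (D false (D false np))).
{ intros s t Hst. split; [|apply (Cinf_partials T _ (Cinf_D T false np Hnp) s t Hst)].
  apply is_derive_ext_loc with (fun s => D false n s t + logder false th s t * (np s t + n s t)).
  - apply (locally_2d_1d_const_y
      (fun s t => D false n s t + logder false th s t * (np s t + n s t) = D false np s t)).
    apply (box_locally T); [|exact Hst]. intros u v Huv.
    symmetry; apply (partials_D T np _ _ u v HP Huv).
  - apply (partials_plus T _ _ _ _ _ _ (Cinf_partials T _ (Cinf_D T false n Hn))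
      (partials_mult T _ _ _ _ _ _ (Cinf_partials T _ (logder_Cinf false))
        (partials_plus T _ _ _ _ _ _ HP (Cinf_partials T n Hn))) s t Hst). }
rewrite (proj1 (partials_D T _ _ _ x y PF Hb)).
rewrite (proj1 (En x y Hb)), (proj1 (logder_riccati x y Hb)). ring.
Qed.

End SmoothTransform.

(** One coordinate of the fact that f + n^+ x n has n^+ as Lelieuvre normal field; [b] and [c] stand
    for the next two coordinates in cyclic order. Inserting the first-order equations leaves a
    polynomial identity. *)
Lemma weingarten_partials T p1 p2 nb nc npb npc f :
  Cinf T nb -> Cinf T nc -> Cinf T npb -> Cinf T npc ->
  partials T npb (fun x y => - D true nb x y + p1 x y * (npb x y - nb x y))
    (fun x y => D false nb x y + p2 x y * (npb x y + nb x y)) ->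
  partials T npc (fun x y => - D true nc x y + p1 x y * (npc x y - nc x y))
    (fun x y => D false nc x y + p2 x y * (npc x y + nc x y)) ->
  partials T f (fun x y => D true nb x y * nc x y - nb x y * D true nc x y)
    (fun x y => nb x y * D false nc x y - D false nb x y * nc x y) ->
  partials T (fun x y => f x y + (npb x y * nc x y - npc x y * nb x y))
    (fun x y => D true npb x y * npc x y - D true npc x y * npb x y)
    (fun x y => npb x y * D false npc x y - npc x y * D false npb x y).
Proof.
intros Hnb Hnc Hnpb Hnpc Pb Pc Pf.
apply partials_ext with (4 := partials_plus T _ _ _ _ _ _ Pf (partials_minus T _ _ _ _ _ _
  (partials_mult T _ _ _ _ _ _ Pb (Cinf_partials T nc Hnc))
  (partials_mult T _ _ _ _ _ _ Pc (Cinf_partials T nb Hnb))));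
  [reflexivity| |]; intros x y Hb;
  destruct (partials_D T _ _ _ x y Pb Hb) as [B1 B2],
    (partials_D T _ _ _ x y Pc Hb) as [C1 C2]; rewrite ?B1, ?B2, ?C1, ?C2; ring.
Qed.

(** * Discrete solutions *)

(** The equation of an elementary square solved for its far corner. The outer recursion runs over
    rows and the inner one along a row, which makes all calls structural. *)
Fixpoint goursat_row (q : R -> R -> R) (h1 h2 : nat -> R) (e : R) (l : nat) : nat -> R :=
  match l with
  | O => h1
  | S l' => fix row k := match k with
    | O => h2 l
    | S k' => (1 + / 2 * e ^ 2 * q (INR k' * e) (INR l' * e)) *
        (goursat_row q h1 h2 e l' (S k') + row k') - goursat_row q h1 h2 e l' k'
    end
  end.

Definition dgoursat (q : R -> R -> R) (h1 h2 : R -> nat -> R) : family :=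
  fun e k l => goursat_row q (h1 e) (h2 e) e l k.

Lemma dgoursat_moutard q h1 h2 : discrete_moutard q (dgoursat q h1 h2).
Proof. intros e k l. unfold dgoursat. simpl. ring. Qed.

Lemma dgoursat_axis1 q h1 h2 e k : dgoursat q h1 h2 e k 0%nat = h1 e k.
Proof. reflexivity. Qed.

Lemma dgoursat_axis2 q h1 h2 e l :
  h1 e 0%nat = h2 e 0%nat -> dgoursat q h1 h2 e 0%nat l = h2 e l.
Proof. intros H; destruct l; [exact H|reflexivity]. Qed.

(* Potentials of [tau1 u * v - u * tau1 v] and [u * tau2 v - tau2 u * v], integrated
   along the first axis and then in the second direction. *)
Fixpoint dpotential_axis (c : R) (u v : nat -> R) (k : nat) : R :=
  match k with
  | O => c
  | S k' => dpotential_axis c u v k' + (u k * v k' - u k' * v k)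
  end.

Fixpoint dpotential (c : R) (u v : family) (e : R) (k l : nat) : R :=
  match l with
  | O => dpotential_axis c (fun k => u e k 0%nat) (fun k => v e k 0%nat) k
  | S l' => dpotential c u v e k l' + (u e k l' * v e k l - u e k l * v e k l')
  end.

Lemma dpotential_0 c u v e : dpotential c u v e 0 0 = c.
Proof. reflexivity. Qed.

Lemma dpotential_2 c u v e k l :
  dpotential c u v e k (S l) = dpotential c u v e k l +
    (u e k l * v e k (S l) - u e k (S l) * v e k l).
Proof. reflexivity. Qed.

(** Discrete closedness. Around an elementary square the increments sum to (u1 + u2)(v + v12) - (u +
    u12)(v1 + v2), where indices denote shifts; this is zero because [u] and [v] solve the equation
    with the same factor. *)
Lemma dpotential_1 c q u v e k l :
  discrete_moutard q u -> discrete_moutard q v ->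
  dpotential c u v e (S k) l = dpotential c u v e k l +
    (u e (S k) l * v e k l - u e k l * v e (S k) l).
Proof.
intros Hu Hv; induction l as [|l IH]; [reflexivity|].
rewrite !dpotential_2, IH. specialize (Hu e k l); specialize (Hv e k l).
set (a := 1 + / 2 * e ^ 2 * q (INR k * e) (INR l * e)) in *.
assert (Hu' : u e (S k) (S l) = a * (u e (S k) l + u e k (S l)) - u e k l) by lra.
assert (Hv' : v e (S k) (S l) = a * (v e (S k) l + v e k (S l)) - v e k l) by lra.
rewrite Hu', Hv'. ring.
Qed.

(** The quotients of the discrete potential are exactly the smooth expressions with [D] replaced by
    [dl], so their convergence is that of products. *)
Lemma conv_dpotential T q u v U V Phi c :
  discrete_moutard q u -> discrete_moutard q v ->
  Cinf T U -> Cinf T V -> conv T u U -> conv T v V -> Cinf T Phi -> Phi 0 0 = c ->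
  partials T Phi (fun x y => D true U x y * V x y - U x y * D true V x y)
    (fun x y => U x y * D false V x y - D false U x y * V x y) ->
  conv T (dpotential c u v) Phi.
Proof.
intros Eu Ev HU HV Cu Cv HPhi H0 HP.
apply conv_potential; [|exact HPhi|intros e; rewrite H0; apply dpotential_0].
intros [|].
- apply conv_ext with (fun e k l => dl true u e k l * v e k l - u e k l * dl true v e k l)
    (fun x y => D true U x y * V x y - U x y * D true V x y).
  + apply evg_pos; intros e k l He. unfold dl, sh.
    rewrite (dpotential_1 c q u v e k l Eu Ev). field; lra.
  + intros x y Hb; symmetry; apply (partials_D T Phi _ _ x y HP Hb).
  + apply conv_minus; apply conv_mult; auto using Cinf_D, conv_dl.
- apply conv_ext with (fun e k l => u e k l * dl false v e k l - dl false u e k l * v e k l)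
    (fun x y => U x y * D false V x y - D false U x y * V x y).
  + apply evg_pos; intros e k l He. unfold dl, sh.
    rewrite dpotential_2. field; lra.
  + intros x y Hb; symmetry; apply (partials_D T Phi _ _ x y HP Hb).
  + apply conv_minus; apply conv_mult; auto using Cinf_D, conv_dl.
Qed.

Lemma small_factor T P : Cinf T P -> forall T', T' < T -> at_right 0 (fun e =>
  forall k l, INR k * e <= T' -> INR l * e <= T' -> / 2 <= 1 + e * rs P e k l).
Proof.
intros HP T' HT. destruct (bnd_nonneg T _ T' (Bc_bnd T 0 _ (Bc_rs T 0 P HP)) HT)
  as [c [Hc0 Hc]].
assert (Hd : 0 < / 2 / (c + 1)) by (apply Rdiv_lt_0_compat; lra).
apply at_right_imp with (2 := at_right_and _ _ Hc (at_right_lt _ Hd)).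
intros e He [H1 [_ H2]] k l Hk Hl. specialize (H1 k l Hk Hl).
apply Rlt_div_r in H2; [|lra]. apply Rabs_le_between in H1. nra.
Qed.

(** The recursion is an implicit Euler step for H' = - P H, with [P] taken at the old point. The
    rescaled error solves an explicit equation with coefficient - P / (1 + e P); its source collects
    P^2 H / (1 + e P) and the Taylor remainder of [H]. *)
Lemma conv_implicit_ode T b z P H :
  Cinf T P -> Cinf T H ->
  (forall x y, box T x y -> D b H x y = - P x y * H x y) ->
  (forall e k l, sh b z e k l = z e k l / (1 + e * rs P e k l)) ->
  (forall e k l, axis b z e k l = axis b (rs H) e k l) -> conv T z H.
Proof.
intros HP HH HD Hz Ha N.
set (s := fun e k l => / (1 + e * rs P e k l)).
assert (Hlow : bounded_below T (fun e k l => 1 + e * rs P e k l)).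
{ intros T' HT. exists (/ 2); split; [lra|].
  apply at_right_imp with (2 := small_factor T P HP T' HT).
  intros e He H1 k l Hk Hl. specialize (H1 k l Hk Hl). rewrite Rabs_pos_eq; lra. }
assert (Hs : forall N, Bc T N s).
{ intros M. apply (Bc_inv T M _ Hlow). apply Bc_plus; [apply Bc_const|].
  apply Bc_mult; [apply Bc_eps|apply Bc_rs, HP]. }
assert (HPs : forall N, Bc T N (fun e k l => rs P e k l * s e k l)).
{ intros M; apply Bc_mult; [apply Bc_rs, HP|apply Hs]. }
apply (Bc_ode T N b (fun e k l => -1 * (rs P e k l * s e k l)) _
  (fun e k l => rs P e k l * (rs P e k l * s e k l) * rs H e k l -
    (dl b (rs H) e k l - rs (D b H) e k l) / e)).
- intros M; apply Bc_scal, HPs.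
- apply Bc_minus.
  + apply Bc_mult; [|apply Bc_rs, HH]. apply Bc_mult; [apply Bc_rs, HP|apply HPs].
  + apply (conv_dl T b _ _ HH (conv_rs T H) N).
- apply Bc_ext_pos with (2 := Bc_const T N 0). intros e k l He.
  specialize (Ha e k l). unfold axis in *. destruct b; rewrite Ha; field; lra.
- apply evg_imp with (2 := evg_and _ _ _ (evg_pos T (fun e _ _ => 0 < e) (fun _ _ _ h => h))
    (evg_and _ _ _ (bounded_below_neq0 _ _ Hlow) (evg_box T _ HD))).
  intros e k l He [_ [H1 H2]]. cbv beta in H2.
  specialize (Hz e k l).
  replace (rs (D b H) e k l) with (- rs P e k l * rs H e k l) by (symmetry; exact H2).
  unfold s. unfold dl at 1 2. unfold sh in *.
  destruct b; rewrite Hz; field; auto with real; split; try lra; exact H1.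
Qed.

(** The quotient of consecutive values is 1 + e p, the value prescribed for the discrete coefficient
    on the axis. *)
Fixpoint dexp_axis (p : R -> R) (e : R) (k : nat) : R :=
  match k with O => 1 | S k' => dexp_axis p e k' / (1 + e * p (INR k' * e)) end.

(** * Assembly in three-space *)

Inductive coord := X1 | X2 | X3.

Definition co (i : coord) (v : R3) : R :=
  match i with X1 => c1 v | X2 => c2 v | X3 => c3 v end.

(** With cyclic successors all coordinates of a cross product have one formula, so vector identities
    reduce to a single scalar one. *)
Definition nxt (i : coord) : coord :=
  match i with X1 => X2 | X2 => X3 | X3 => X1 end.

Definition vec (F : coord -> R) : R3 := (F X1, F X2, F X3).

Lemma co_vec i F : co i (vec F) = F i.
Proof. destruct i; reflexivity. Qed.

Lemma vec_ext v w : (forall i, co i v = co i w) -> v = w.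
Proof.
intros H. pose proof (H X1); pose proof (H X2); pose proof (H X3).
destruct v as [[a b] c], w as [[a' b'] c']. unfold co, c1, c2, c3 in *; simpl in *.
congruence.
Qed.

Lemma co_plus i (v w : R3) : co i (plus v w) = co i v + co i w.
Proof. destruct i; reflexivity. Qed.

Lemma co_minus i (v w : R3) : co i (minus v w) = co i v - co i w.
Proof. destruct i; reflexivity. Qed.

Lemma co_scal i a (v : R3) : co i (scal a v) = a * co i v.
Proof. destruct i; reflexivity. Qed.

Lemma co_cross i v w :
  co i (cross v w) = co (nxt i) v * co (nxt (nxt i)) w - co (nxt (nxt i)) v * co (nxt i) w.
Proof. destruct i; reflexivity. Qed.

Lemma co_partial1 i F x y :
  co i (partial_vec 1 0 F x y) = D true (fun s t => co i (F s t)) x y.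
Proof. destruct i; reflexivity. Qed.

Lemma co_partial2 i F x y :
  co i (partial_vec 0 1 F x y) = D false (fun s t => co i (F s t)) x y.
Proof. destruct i; reflexivity. Qed.

Lemma co_partial12 i F x y :
  co i (partial_vec 1 1 F x y) = D true (D false (fun s t => co i (F s t))) x y.
Proof. destruct i; reflexivity. Qed.

Lemma smooth_on_vec_co r F :
  smooth_on_vec r F <-> forall i, smooth_on r (fun x y => co i (F x y)).
Proof.
split.
- intros (H1 & H2 & H3) i; destruct i; assumption.
- intros H; repeat split; [exact (H X1)|exact (H X2)|exact (H X3)].
Qed.

Lemma smooth1_vec_co h : smooth1_vec h -> forall i, smooth1 (fun x => co i (h x)).
Proof. intros (H1 & H2 & H3) i; destruct i; assumption. Qed.

Lemma coord_choice {B : Type} (P : coord -> B -> Prop) :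
  (forall i, exists b, P i b) -> exists f, forall i, P i (f i).
Proof.
intros H. destruct (H X1) as [b1 H1], (H X2) as [b2 H2], (H X3) as [b3 H3].
exists (fun i => match i with X1 => b1 | X2 => b2 | X3 => b3 end).
intros i; destruct i; assumption.
Qed.

(** The norm of a nested product is a nested square root, estimated twice by sqrt(x^2 + y^2) <= x +
    y. *)
Lemma norm_R3_le (v : R3) M : (forall i, Rabs (co i v) <= M) -> norm v <= 3 * M.
Proof.
intros H. pose proof (H X1); pose proof (H X2); pose proof (H X3).
destruct v as [[a b] c]. unfold co, c1, c2, c3 in *; simpl in *.
assert (Hs : forall x y, 0 <= x -> 0 <= y -> sqrt (x ^ 2 + y ^ 2) <= x + y).
{ intros x y Hx Hy. rewrite <- (sqrt_pow2 (x + y)) by lra.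
  apply sqrt_le_1_alt. nra. }
change (sqrt (sqrt (Rabs a ^ 2 + Rabs b ^ 2) ^ 2 + Rabs c ^ 2) <= 3 * M).
eapply Rle_trans; [apply Hs; [apply sqrt_pos|apply Rabs_pos]|].
pose proof (Hs (Rabs a) (Rabs b) (Rabs_pos a) (Rabs_pos b)). lra.
Qed.

(* [th] generates the coefficients [p1], [p2] of the transform, and [M = th * n^+];
   [f] and [M] are potentials of the same bilinear form. *)
Record smooth_solution (A : A_data) (W : W_data) (T : R)
    (n : coord -> R -> R -> R) (th : R -> R -> R) (f M : coord -> R -> R -> R) : Prop := {
  ss_pos : 0 < T;
  ss_n : forall i, moutard T (q12 A) (n i);
  ss_n_axis1 : forall i x, Rabs x < T -> n i x 0 = co i (curve1 A x);
  ss_n_axis2 : forall i y, Rabs y < T -> n i 0 y = co i (curve2 A y);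
  ss_th : moutard T (q12 A) th;
  ss_th_low : forall x y, box T x y -> / 2 <= Rabs (th x y);
  ss_th_axis1 : exists h, (forall S, Cinf S (fun x _ => h x)) /\ h 0 = 1 /\
    (forall x, is_derive h x (- p1_axis W x * h x)) /\
    forall x, Rabs x < T -> th x 0 = h x;
  ss_th_axis2 : exists h, (forall S, Cinf S (fun x _ => h x)) /\ h 0 = 1 /\
    (forall y, is_derive h y (- p2_axis W y * h y)) /\
    forall y, Rabs y < T -> th 0 y = h y;
  ss_f : forall i, Cinf T (f i) /\ f i 0 0 = co i (f0 A) /\
    let u := n (nxt i) in let v := n (nxt (nxt i)) in
    partials T (f i) (fun x y => D true u x y * v x y - u x y * D true v x y)
      (fun x y => u x y * D false v x y - D false u x y * v x y);
  ss_M : forall i, Cinf T (M i) /\ M i 0 0 = co i (np0 W) /\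
    partials T (M i) (fun x y => D true th x y * n i x y - th x y * D true (n i) x y)
      (fun x y => th x y * D false (n i) x y - D false th x y * n i x y) }.

Lemma moutard_le T q u T' : T' <= T -> moutard T q u -> moutard T' q u.
Proof.
intros HT [Hu E]; split.
- intros N; apply (Ck_le T); auto.
- intros x y [Hx Hy]; apply E; split; lra.
Qed.

(** Four Goursat problems with the same [q12] on one box, three for the normal field and one for
    [th], followed by quadratures for the surface and for [M]. *)
Lemma smooth_solution_exists A W :
  exists T n th f M, smooth_solution A W T n th f M.
Proof.
destruct (goursat_exists (q12 A)) as [T0 [HT0 HG]].
{ intros T; apply smooth2_Cinf, q12_smooth. }
destruct (coord_choice (fun i u => moutard T0 (q12 A) u /\
  (forall x, Rabs x < T0 -> u x 0 = co i (curve1 A x)) /\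
  (forall y, Rabs y < T0 -> u 0 y = co i (curve2 A y)))) as [n Hn].
{ intros i. apply HG.
  - intros T. apply (smooth1_Cinf T (fun x => co i (curve1 A x))), smooth1_vec_co, curve1_smooth.
  - intros T. apply (smooth1_Cinf' T (fun x => co i (curve2 A x))), smooth1_vec_co, curve2_smooth.
  - rewrite (curves_meet A); reflexivity. }
destruct (exp_ode (p1_axis W)) as [h1 [H10 [H1d H1c]]].
{ intros T; apply smooth1_Cinf, p1_axis_smooth. }
destruct (exp_ode (p2_axis W)) as [h2 [H20 [H2d H2c]]].
{ intros T; apply smooth1_Cinf, p2_axis_smooth. }
destruct (HG h1 h2 H1c) as [th [Hth [Hth1 Hth2]]].
{ intros T N; apply (Ck_swap T N (fun x _ => h2 x)), H2c. }
{ congruence. }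
assert (Hth0 : th 0 0 = 1) by (rewrite Hth1, H10; [|rewrite Rabs_R0]; auto).
(* Continuity at the origin, where [th] equals 1, gives the radius on which [th] stays within 1/2 of
   1; the box is shrunk to it. *)
destruct (Ck_cont T0 0 th 0 0 (proj1 Hth 0%nat)
  ltac:(split; rewrite Rabs_R0; exact HT0) (mkposreal (/ 2) ltac:(lra))) as [d Hd].
simpl in Hd.
set (T := Rmin T0 d).
assert (HT : 0 < T) by (apply Rmin_pos; [exact HT0|apply cond_pos]).
assert (HTT : T <= T0) by apply Rmin_l.
assert (HTd : T <= d) by apply Rmin_r.
assert (HnT : forall i, moutard T (q12 A) (n i)).
{ intros i; apply (moutard_le T0); [exact HTT|apply Hn]. }
assert (HthT : moutard T (q12 A) th) by (apply (moutard_le T0); assumption).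
destruct (coord_choice _ (fun i => moutard_potential T (q12 A) (n (nxt i)) (n (nxt (nxt i)))
  (co i (f0 A)) HT (HnT _) (HnT _))) as [f Hf].
destruct (coord_choice _ (fun i => moutard_potential T (q12 A) th (n i)
  (co i (np0 W)) HT HthT (HnT _))) as [M HM].
exists T, n, th, f, M. split; auto.
- intros i x Hx; apply Hn; lra.
- intros i y Hy; apply Hn; lra.
- intros x y [Hx Hy].
  specialize (Hd x y ltac:(rewrite Rminus_0_r; lra) ltac:(rewrite Rminus_0_r; lra)).
  rewrite Hth0 in Hd. apply Rabs_lt_between in Hd. rewrite Rabs_pos_eq; lra.
- exists h1; refine (conj H1c (conj H10 (conj H1d _))). intros x Hx; apply Hth1; lra.
- exists h2; refine (conj H2c (conj H20 (conj H2d _))). intros x Hx; apply Hth2; lra.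
Qed.

(** * The smooth A-surface and its Weingarten transform *)

Section Smooth.

Context (A : A_data) (W : W_data) (T : R).
Context (n : coord -> R -> R -> R) (th : R -> R -> R) (f M : coord -> R -> R -> R).
Context (HS : smooth_solution A W T n th f M).

Let HT : 0 < T := ss_pos _ _ _ _ _ _ _ HS.
Let q := q12 A.

Lemma th_neq0 x y : box T x y -> th x y <> 0.
Proof.
intros Hb E. pose proof (ss_th_low _ _ _ _ _ _ _ HS x y Hb) as H.
rewrite E, Rabs_R0 in H. lra.
Qed.

Let p1 := logder true th.
Let p2 := logder false th.

Definition trans (i : coord) (x y : R) : R := M i x y * / th x y.

Definition wein (i : coord) (x y : R) : R :=
  f i x y + (trans (nxt i) x y * n (nxt (nxt i)) x y
             - trans (nxt (nxt i)) x y * n (nxt i) x y).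

Lemma n_Cinf i : Cinf T (n i).
Proof. apply (ss_n _ _ _ _ _ _ _ HS). Qed.

Lemma th_Cinf : Cinf T th.
Proof. apply (ss_th _ _ _ _ _ _ _ HS). Qed.

Lemma trans_Cinf i : Cinf T (trans i).
Proof.
apply Cinf_mult; [apply (ss_M _ _ _ _ _ _ _ HS)|].
apply Cinf_inv; [exact th_neq0|apply th_Cinf].
Qed.

Lemma wein_Cinf i : Cinf T (wein i).
Proof.
apply Cinf_plus; [apply (ss_f _ _ _ _ _ _ _ HS)|].
apply Cinf_minus; apply Cinf_mult; auto using trans_Cinf, n_Cinf.
Qed.

Lemma trans_partials i : partials T (trans i)
  (fun x y => - D true (n i) x y + p1 x y * (trans i x y - n i x y))
  (fun x y => D false (n i) x y + p2 x y * (trans i x y + n i x y)).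
Proof.
apply (transform_partials T q th (ss_th _ _ _ _ _ _ _ HS) th_neq0).
- apply (ss_n _ _ _ _ _ _ _ HS).
- apply (ss_M _ _ _ _ _ _ _ HS).
Qed.

Lemma wein_partials i : partials T (wein i)
  (fun x y => D true (trans (nxt i)) x y * trans (nxt (nxt i)) x y
              - D true (trans (nxt (nxt i))) x y * trans (nxt i) x y)
  (fun x y => trans (nxt i) x y * D false (trans (nxt (nxt i))) x y
              - trans (nxt (nxt i)) x y * D false (trans (nxt i)) x y).
Proof.
apply (weingarten_partials T p1 p2 (n (nxt i)) (n (nxt (nxt i)))
  (trans (nxt i)) (trans (nxt (nxt i))) (f i));
  auto using n_Cinf, trans_Cinf, trans_partials.
apply (ss_f _ _ _ _ _ _ _ HS).
Qed.

Context (r : R).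
Context (Hr : 0 < r) (HrT : r < T).

Lemma square_box x y : in_square r x y -> box T x y.
Proof. intros [Hx Hy]; split; rewrite Rabs_pos_eq; lra. Qed.

Lemma segment_box x : 0 <= x <= r -> Rabs x < T.
Proof. intros Hx; rewrite Rabs_pos_eq; lra. Qed.

Lemma smooth_vec_of_Cinf (F : coord -> R -> R -> R) :
  (forall i, Cinf T (F i)) -> smooth_on_vec r (fun x y => vec (fun i => F i x y)).
Proof.
intros H; apply smooth_on_vec_co; intros i.
destruct i; apply (Cinf_smooth_on T); auto; apply H.
Qed.

Lemma q_smooth_on : smooth_on r (q12 A).
Proof. apply (Cinf_smooth_on T); [exact HrT|apply smooth2_Cinf, q12_smooth]. Qed.

Lemma D_vec (F : coord -> R -> R -> R) i b :
  D b (fun s t => co i (vec (fun j => F j s t))) = D b (F i).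
Proof. destruct i; reflexivity. Qed.

Lemma smooth_A_surface : A_surface_with_data r A
  (fun x y => vec (fun i => n i x y)) (fun x y => vec (fun i => f i x y)).
Proof.
split.
- split.
  + apply q_smooth_on.
  + apply smooth_vec_of_Cinf, n_Cinf.
  + apply smooth_vec_of_Cinf. intros i; apply (ss_f _ _ _ _ _ _ _ HS).
  + intros x y Hxy. apply vec_ext; intros i.
    rewrite co_partial12, co_scal, co_vec, D_vec.
    exact (proj1 (proj2 (ss_n _ _ _ _ _ _ _ HS i) x y (square_box x y Hxy))).
  + intros x y Hxy. apply vec_ext; intros i.
    rewrite co_partial1, co_cross, !co_partial1, !co_vec, !D_vec.
    destruct (ss_f _ _ _ _ _ _ _ HS i) as (_ & _ & HP).
    rewrite (proj1 (partials_D T _ _ _ x y HP (square_box x y Hxy))). ring.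
  + intros x y Hxy. apply vec_ext; intros i.
    rewrite co_partial2, co_cross, !co_partial2, !co_vec, !D_vec.
    destruct (ss_f _ _ _ _ _ _ _ HS i) as (_ & _ & HP).
    rewrite (proj2 (partials_D T _ _ _ x y HP (square_box x y Hxy))). ring.
- intros x Hx. apply vec_ext; intros i; rewrite co_vec.
  apply (ss_n_axis1 _ _ _ _ _ _ _ HS), segment_box, Hx.
- intros y Hy. apply vec_ext; intros i; rewrite co_vec.
  apply (ss_n_axis2 _ _ _ _ _ _ _ HS), segment_box, Hy.
- apply vec_ext; intros i; rewrite co_vec. apply (ss_f _ _ _ _ _ _ _ HS).
Qed.

Section Given.

Context (n' f' : R -> R -> R3).
Context (HA : A_surface_with_data r A n' f').

Lemma given_n i x y : in_square r x y -> co i (n' x y) = n i x y.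
Proof.
pose proof (Ad_surface _ _ _ _ HA) as HS'.
apply (moutard_unique r (q12 A) (fun x y => co i (n' x y)) (n i) Hr q_smooth_on).
- apply smooth_on_vec_co, (As_n_smooth _ _ _ _ HS').
- apply (Cinf_smooth_on T); [exact HrT|apply n_Cinf].
- intros s t Hst. rewrite <- co_partial12, (As_moutard _ _ _ _ HS' s t Hst). apply co_scal.
- intros s t Hst. exact (proj1 (proj2 (ss_n _ _ _ _ _ _ _ HS i) s t (square_box s t Hst))).
- intros s Hs. rewrite (Ad_axis1 _ _ _ _ HA s Hs). symmetry.
  apply (ss_n_axis1 _ _ _ _ _ _ _ HS), segment_box, Hs.
- intros t Ht. rewrite (Ad_axis2 _ _ _ _ HA t Ht). symmetry.
  apply (ss_n_axis2 _ _ _ _ _ _ _ HS), segment_box, Ht.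
Qed.

Lemma given_Dn b i x y : in_square r x y ->
  D b (fun s t => co i (n' s t)) x y = D b (n i) x y.
Proof.
apply smooth_on_D_unique; auto.
- apply smooth_on_vec_co, (As_n_smooth _ _ _ _ (Ad_surface _ _ _ _ HA)).
- apply (Cinf_smooth_on T); [exact HrT|apply n_Cinf].
- intros; apply given_n; assumption.
Qed.

(** By the Lelieuvre formulas both surfaces have the same gradient on the closed square, once
    [given_n] and [given_Dn] identify the normal fields and their derivatives. *)
Lemma given_f i x y : in_square r x y -> co i (f' x y) = f i x y.
Proof.
pose proof (Ad_surface _ _ _ _ HA) as HS'.
destruct (ss_f _ _ _ _ _ _ _ HS i) as (HfC & Hf0 & HP).
assert (H0 : smooth_on r (fun _ _ => 0)).
{ apply (Cinf_smooth_on T); [exact HrT|intros N; apply Ck_const]. }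
apply (evolution_unique r (fun _ _ => 0) (fun _ _ => 0) (fun x y => co i (f' x y)) (f i)
  (D true (fun x y => co i (f' x y))) (D false (fun x y => co i (f' x y)))
  (D true (f i)) (D false (f i))); auto.
- apply smooth_on_vec_co, (As_f_smooth _ _ _ _ HS').
- apply (Cinf_smooth_on T); auto.
- intros; split; ring.
- intros; split; ring.
- intros s t Hst.
  destruct (partials_D T _ _ _ s t HP (square_box s t Hst)) as [-> ->].
  rewrite <- co_partial1, <- co_partial2, (As_lelieuvre1 _ _ _ _ HS' s t Hst),
    (As_lelieuvre2 _ _ _ _ HS' s t Hst), !co_cross, !co_partial1, !co_partial2,
    !given_Dn, !given_n by exact Hst. split; ring.
- rewrite Hf0, (Ad_origin _ _ _ _ HA). reflexivity.
Qed.

Lemma given_weingarten :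
  weingarten_transform r A W n' f' (fun x y => vec (fun i => wein i x y)).
Proof.
exists (fun x y => vec (fun i => trans i x y)), p1, p2.
assert (Hp : forall b, Cinf T (logder b th)).
{ intros b; apply (logder_Cinf T q th); [apply (ss_th _ _ _ _ _ _ _ HS)|exact th_neq0]. }
pose proof (logder_riccati T q th (ss_th _ _ _ _ _ _ _ HS) th_neq0) as Hric.
assert (H00 : th 0 0 = 1).
{ destruct (ss_th_axis1 _ _ _ _ _ _ _ HS) as (h & _ & Hh & _ & Hx).
  rewrite Hx by (rewrite Rabs_R0; exact HT). exact Hh. }
split; [split|split; [|split; [|split; [|split]]]].
- apply smooth_vec_of_Cinf, trans_Cinf.
- apply (Cinf_smooth_on T); auto; apply Hp.
- apply (Cinf_smooth_on T); auto; apply Hp.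
- intros x y Hxy. apply vec_ext; intros i.
  rewrite co_plus, co_scal, co_minus, !co_partial1, D_vec, co_vec, given_Dn, given_n
    by exact Hxy.
  rewrite (proj1 (partials_D T _ _ _ x y (trans_partials i) (square_box x y Hxy))). ring.
- intros x y Hxy. apply vec_ext; intros i.
  rewrite co_minus, co_scal, co_plus, !co_partial2, D_vec, co_vec, given_Dn, given_n
    by exact Hxy.
  rewrite (proj2 (partials_D T _ _ _ x y (trans_partials i) (square_box x y Hxy))). ring.
- intros x y Hxy. exact (proj1 (Hric x y (square_box x y Hxy))).
- intros x y Hxy. exact (proj2 (Hric x y (square_box x y Hxy))).
- apply vec_ext; intros i. rewrite co_vec. unfold trans.
  destruct (ss_M _ _ _ _ _ _ _ HS i) as (_ & -> & _). rewrite H00. field.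
- intros x Hx. apply segment_box in Hx. unfold p1, logder.
  assert (Hb : box T x 0) by (split; [|rewrite Rabs_R0]; assumption).
  destruct (ss_th_axis1 _ _ _ _ _ _ _ HS) as (h & _ & _ & Hd & Hh).
  (* Valid at x = 0 as well: [th] agrees with [h] on both sides of every such point because the box
     is open. *)
  assert (E : D true th x 0 = - p1_axis W x * h x).
  { apply is_derive_unique. apply is_derive_ext_loc with h; [|apply Hd].
    apply (locally_2d_1d_const_y (fun s _ => h s = th s 0) x 0).
    apply (box_locally T); [|exact Hb]. intros s t [Hs _]; symmetry; apply Hh, Hs. }
  rewrite E, <- (Hh x Hx). field. apply th_neq0, Hb.
- intros y Hy. apply segment_box in Hy. unfold p2, logder.
  assert (Hb : box T 0 y) by (split; [rewrite Rabs_R0|]; assumption).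
  destruct (ss_th_axis2 _ _ _ _ _ _ _ HS) as (h & _ & _ & Hd & Hh).
  assert (E : D false th 0 y = - p2_axis W y * h y).
  { apply is_derive_unique. apply is_derive_ext_loc with h; [|apply Hd].
    apply (locally_2d_1d_const_x (fun _ t => h t = th 0 t) 0 y).
    apply (box_locally T); [|exact Hb]. intros s t [_ Ht]; symmetry; apply Hh, Ht. }
  rewrite E, <- (Hh y Hy). field. apply th_neq0, Hb.
- intros x y Hxy. apply vec_ext; intros i.
  rewrite co_plus, co_cross, !co_vec, !given_n, given_f by exact Hxy. reflexivity.
- exists (fun x y => 2 * (p1 x y * p2 x y) - q12 A x y).
  split.
  + apply (Cinf_smooth_on T); [exact HrT|].
    apply Cinf_minus; [|apply smooth2_Cinf, q12_smooth].
    apply (Cinf_mult T (fun _ _ => 2)); [intros N; apply Ck_const|].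
    apply Cinf_mult; apply Hp.
  + apply smooth_vec_of_Cinf, trans_Cinf.
  + apply smooth_vec_of_Cinf, wein_Cinf.
  + intros x y Hxy. apply vec_ext; intros i.
    rewrite co_partial12, co_scal, co_vec, D_vec.
    apply (transform_moutard T q th (ss_th _ _ _ _ _ _ _ HS) th_neq0 (n i) (trans i)).
    * apply (ss_n _ _ _ _ _ _ _ HS).
    * apply trans_Cinf.
    * apply trans_partials.
    * apply square_box, Hxy.
  + intros x y Hxy. apply vec_ext; intros i.
    rewrite co_partial1, co_cross, !co_partial1, !co_vec, !D_vec.
    apply (partials_D T _ _ _ x y (wein_partials i) (square_box x y Hxy)).
  + intros x y Hxy. apply vec_ext; intros i.
    rewrite co_partial2, co_cross, !co_partial2, !co_vec, !D_vec.
    apply (partials_D T _ _ _ x y (wein_partials i) (square_box x y Hxy)).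
Qed.

End Given.

End Smooth.

(** The coefficients are determined first, by the Riccati system; with them fixed, n^+ solves a
    linear evolution from the origin, and [fp] is explicit in n^+. *)
Lemma weingarten_transform_unique r A W n f fp fp' :
  0 < r -> smooth_on_vec r n ->
  weingarten_transform r A W n f fp -> weingarten_transform r A W n f fp' ->
  forall x y, in_square r x y -> fp' x y = fp x y.
Proof.
intros Hr Hn (np & p1 & p2 & HM & H0 & Ha1 & Ha2 & Hf & _)
  (np' & p1' & p2' & HM' & H0' & Ha1' & Ha2' & Hf' & _) x y Hxy.
assert (Hp : forall x y, in_square r x y -> p1 x y = p1' x y /\ p2 x y = p2' x y).
{ apply (riccati_unique r (q12 A)); auto; try apply HM; try apply HM'.
  - intros s t Hst; split; apply HM; exact Hst.
  - intros s t Hst; split; apply HM'; exact Hst.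
  - intros s Hs; rewrite Ha1, Ha1' by exact Hs; reflexivity.
  - intros s Hs; rewrite Ha2, Ha2' by exact Hs; reflexivity. }
assert (Hnp : forall i, co i (np x y) = co i (np' x y)).
{ intros i.
  assert (HE : forall np p1 p2, moutard_transform r (q12 A) n np p1 p2 ->
    forall x y, in_square r x y ->
    D true (fun s t => co i (np s t)) x y =
      (- D true (fun s t => co i (n s t)) x y - p1 x y * co i (n x y))
      + p1 x y * co i (np x y) /\
    D false (fun s t => co i (np s t)) x y =
      (D false (fun s t => co i (n s t)) x y + p2 x y * co i (n x y))
      + p2 x y * co i (np x y)).
  { clear. intros np p1 p2 HM x y Hxy.
    pose proof (f_equal (co i) (Mt_eq1 _ _ _ _ _ _ HM x y Hxy)) as E1.
    pose proof (f_equal (co i) (Mt_eq2 _ _ _ _ _ _ HM x y Hxy)) as E2.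
    rewrite co_plus, co_scal, co_minus, !co_partial1 in E1.
    rewrite co_minus, co_scal, co_plus, !co_partial2 in E2. split; lra. }
  pose proof (HE np p1 p2 HM) as E1.
  assert (E2 := HE np' p1' p2' HM').
  (* The second field is shown to obey the equations with the coefficients of the first, so that
     both have identical source terms. *)
  assert (E2' : forall x y, in_square r x y ->
    D true (fun s t => co i (np' s t)) x y =
      (- D true (fun s t => co i (n s t)) x y - p1 x y * co i (n x y))
      + p1 x y * co i (np' x y) /\
    D false (fun s t => co i (np' s t)) x y =
      (D false (fun s t => co i (n s t)) x y + p2 x y * co i (n x y))
      + p2 x y * co i (np' x y)).
  { intros s t Hst. specialize (E2 s t Hst). destruct (Hp s t Hst) as [-> ->]. exact E2. }
  apply (evolution_unique r p1 p2 (fun s t => co i (np s t)) (fun s t => co i (np' s t))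
    _ _ _ _ Hr (Mt_p1_smooth _ _ _ _ _ _ HM) (Mt_p2_smooth _ _ _ _ _ _ HM)
    (proj1 (smooth_on_vec_co _ _) (Mt_np_smooth _ _ _ _ _ _ HM) i)
    (proj1 (smooth_on_vec_co _ _) (Mt_np_smooth _ _ _ _ _ _ HM') i) E1 E2'); auto.
  rewrite H0, H0'; reflexivity. }
rewrite Hf, Hf' by exact Hxy. rewrite (vec_ext _ _ Hnp). reflexivity.
Qed.

(** * The canonical discrete A-surfaces and Weingarten transforms *)

Section Discrete.

Context (A : A_data) (W : W_data).

Definition dn (i : coord) : family := dgoursat (q12 A)
  (fun e k => co i (curve1 A (INR k * e))) (fun e l => co i (curve2 A (INR l * e))).

(* The discrete coefficients will be [b_i = th / tau_i th]. *)
Definition dth : family :=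
  dgoursat (q12 A) (dexp_axis (p1_axis W)) (dexp_axis (p2_axis W)).

Definition df (i : coord) : family :=
  dpotential (co i (f0 A)) (dn (nxt i)) (dn (nxt (nxt i))).

Definition dM (i : coord) : family := dpotential (co i (np0 W)) dth (dn i).

Definition dtrans (i : coord) : family := fun e k l => dM i e k l * / dth e k l.

Definition dwein (i : coord) : family := fun e k l =>
  df i e k l + (dtrans (nxt i) e k l * dn (nxt (nxt i)) e k l
                - dtrans (nxt (nxt i)) e k l * dn (nxt i) e k l).

Definition db1 : family := fun e k l => dth e k l / dth e (S k) l.
Definition db2 : family := fun e k l => dth e k l / dth e k (S l).

Lemma dn_axis1 i e k : dn i e k 0%nat = co i (curve1 A (INR k * e)).
Proof. apply dgoursat_axis1. Qed.

Lemma dn_axis2 i e l : dn i e 0%nat l = co i (curve2 A (INR l * e)).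
Proof.
apply (dgoursat_axis2 (q12 A)). cbv beta; simpl INR. rewrite !Rmult_0_l, (curves_meet A). reflexivity.
Qed.

Lemma dth_axis1 e k : dth e k 0%nat = dexp_axis (p1_axis W) e k.
Proof. apply dgoursat_axis1. Qed.

Lemma dth_axis2 e l : dth e 0%nat l = dexp_axis (p2_axis W) e l.
Proof. apply dgoursat_axis2. reflexivity. Qed.

Lemma dn_moutard i : discrete_moutard (q12 A) (dn i).
Proof. apply dgoursat_moutard. Qed.

Lemma dth_moutard : discrete_moutard (q12 A) dth.
Proof. apply dgoursat_moutard. Qed.

Section Convergence.

Context (T : R).
Context (n : coord -> R -> R -> R) (th : R -> R -> R) (f M : coord -> R -> R -> R).
Context (HS : smooth_solution A W T n th f M).

Let HT : 0 < T := ss_pos _ _ _ _ _ _ _ HS.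

Lemma q12_Cinf : Cinf T (q12 A).
Proof. apply smooth2_Cinf, q12_smooth. Qed.

Lemma conv_dn i : conv T (dn i) (n i).
Proof.
apply (conv_moutard T (q12 A) _ _ HT q12_Cinf (ss_n _ _ _ _ _ _ _ HS i) (dn_moutard i)).
- apply conv_ext with (rs (fun _ y => co i (curve2 A y))) (fun _ y => co i (curve2 A y)).
  + apply evg_pos; intros e k l _. unfold axis, rs. rewrite dn_axis2. reflexivity.
  + intros x y [_ Hy]. symmetry; apply (ss_n_axis2 _ _ _ _ _ _ _ HS), Hy.
  + apply conv_rs.
- apply conv_ext with (rs (fun x _ => co i (curve1 A x))) (fun x _ => co i (curve1 A x)).
  + apply evg_pos; intros e k l _. unfold axis, rs. rewrite dn_axis1. reflexivity.
  + intros x y [Hx _]. symmetry; apply (ss_n_axis1 _ _ _ _ _ _ _ HS), Hx.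
  + apply conv_rs.
Qed.

(** Unlike those of [dn], the axis values here are not samples of the limit: they are Euler
    approximations of an exponential and carry an error of their own. *)
Lemma conv_dth : conv T dth th.
Proof.
apply (conv_moutard T (q12 A) _ _ HT q12_Cinf (ss_th _ _ _ _ _ _ _ HS) dth_moutard).
- destruct (ss_th_axis2 _ _ _ _ _ _ _ HS) as (h & HhC & Hh0 & Hhd & Hh).
  apply conv_ext with (axis true dth) (fun _ y => h y).
  + apply evg_pos; reflexivity.
  + intros x y [_ Hy]; symmetry; apply Hh, Hy.
  + apply (conv_implicit_ode T false _ (fun _ y => p2_axis W y)).
    * apply smooth1_Cinf', p2_axis_smooth.
    * intros N; apply (Ck_swap T N (fun x _ => h x)), HhC.
    * intros x y _. apply is_derive_unique, Hhd.
    * intros e k l. unfold sh, axis, rs. rewrite !dth_axis2. reflexivity.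
    * intros e k l. unfold axis, rs. rewrite dth_axis2. simpl. rewrite Rmult_0_l, Hh0.
      reflexivity.
- destruct (ss_th_axis1 _ _ _ _ _ _ _ HS) as (h & HhC & Hh0 & Hhd & Hh).
  apply conv_ext with (axis false dth) (fun x _ => h x).
  + apply evg_pos; reflexivity.
  + intros x y [Hx _]; symmetry; apply Hh, Hx.
  + apply (conv_implicit_ode T true _ (fun x _ => p1_axis W x)).
    * apply smooth1_Cinf, p1_axis_smooth.
    * apply HhC.
    * intros x y _. apply is_derive_unique, Hhd.
    * intros e k l. unfold sh, axis, rs. rewrite !dth_axis1. reflexivity.
    * intros e k l. unfold axis, rs. rewrite dth_axis1. simpl. rewrite Rmult_0_l, Hh0.
      reflexivity.
Qed.

Lemma conv_df i : conv T (df i) (f i).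
Proof.
destruct (ss_f _ _ _ _ _ _ _ HS i) as (HfC & Hf0 & HP).
apply (conv_dpotential T (q12 A) _ _ (n (nxt i)) (n (nxt (nxt i))));
  auto using dn_moutard, conv_dn; apply (n_Cinf A W T n th f M HS).
Qed.

Lemma conv_dM i : conv T (dM i) (M i).
Proof.
destruct (ss_M _ _ _ _ _ _ _ HS i) as (HMC & HM0 & HP).
apply (conv_dpotential T (q12 A) _ _ th (n i));
  auto using dn_moutard, dth_moutard, conv_dn, conv_dth;
  [apply (th_Cinf A W T n th f M HS)|apply (n_Cinf A W T n th f M HS)].
Qed.

Lemma conv_dtrans i : conv T (dtrans i) (trans th M i).
Proof.
apply conv_mult.
- apply (ss_M _ _ _ _ _ _ _ HS).
- apply Cinf_inv; [apply (th_neq0 A W T n th f M HS)|apply (th_Cinf A W T n th f M HS)].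
- apply conv_dM.
- apply (conv_inv T dth th (/ 2)); [lra| | |apply conv_dth].
  + apply (ss_th_low _ _ _ _ _ _ _ HS).
  + apply (th_Cinf A W T n th f M HS).
Qed.

Lemma conv_dwein i : conv T (dwein i) (wein n th f M i).
Proof.
pose proof (n_Cinf A W T n th f M HS) as HnC.
pose proof (trans_Cinf A W T n th f M HS) as HtC.
apply conv_plus; [apply conv_df|].
apply conv_minus; apply conv_mult; auto using conv_dtrans, conv_dn.
Qed.

(** All denominators of the discrete construction at once. The lower bound on [th] passes to [dth]
    by convergence; the factors 1 + e p are close to 1. *)
Lemma grid_regular r : r < T -> at_right 0 (fun e => forall k l, in_grid e r k l ->
  dth e k l <> 0 /\ 1 + e * p1_axis W (INR k * e) <> 0 /\
  1 + e * p2_axis W (INR l * e) <> 0).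
Proof.
intros HrT.
assert (Hlow : bounded_below T dth).
{ apply (conv_bounded_below T dth th (/ 2)); [lra| |apply conv_dth].
  apply (ss_th_low _ _ _ _ _ _ _ HS). }
apply at_right_imp with (2 := at_right_and _ _ (bounded_below_neq0 _ _ Hlow r HrT)
  (at_right_and _ _
    (small_factor T _ (smooth1_Cinf T _ (p1_axis_smooth W)) r HrT)
    (small_factor T _ (smooth1_Cinf' T _ (p2_axis_smooth W)) r HrT))).
intros e He (H1 & H2 & H3) k l [Hk Hl].
specialize (H1 k l Hk Hl); specialize (H2 k l Hk Hl); specialize (H3 k l Hk Hl).
unfold rs in H2, H3. repeat split; lra.
Qed.

End Convergence.

Section Fixed.

Context (e r : R).
Context (He : 0 < e).
Context (Hreg : forall k l, in_grid e r k l ->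
  dth e k l <> 0 /\ 1 + e * p1_axis W (INR k * e) <> 0 /\
  1 + e * p2_axis W (INR l * e) <> 0).

Definition vdn (k l : nat) : R3 := vec (fun i => dn i e k l).
Definition vdf (k l : nat) : R3 := vec (fun i => df i e k l).
Definition vdtrans (k l : nat) : R3 := vec (fun i => dtrans i e k l).
Definition vdwein (k l : nat) : R3 := vec (fun i => dwein i e k l).

Lemma in_grid_pred1 k l : in_grid e r (S k) l -> in_grid e r k l.
Proof. intros [H1 H2]; split; [rewrite S_INR in H1; lra|exact H2]. Qed.

Lemma in_grid_pred2 k l : in_grid e r k (S l) -> in_grid e r k l.
Proof. intros [H1 H2]; split; [exact H1|rewrite S_INR in H2; lra]. Qed.

Lemma co_delta1 i g k l : co i (delta1 e g k l) = / e * (co i (g (S k) l) - co i (g k l)).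
Proof. unfold delta1; rewrite co_scal, co_minus; reflexivity. Qed.

Lemma co_delta2 i g k l : co i (delta2 e g k l) = / e * (co i (g k (S l)) - co i (g k l)).
Proof. unfold delta2; rewrite co_scal, co_minus; reflexivity. Qed.

Lemma canonical_A_surface : discrete_A_surface A e r vdn vdf.
Proof.
split.
- intros k _. apply vec_ext; intros i. unfold vdn. rewrite co_vec. apply dn_axis1.
- intros l _. apply vec_ext; intros i. unfold vdn. rewrite co_vec. apply dn_axis2.
- intros k l _. apply vec_ext; intros i. unfold vdn.
  rewrite co_plus, co_scal, co_plus, !co_vec. apply dn_moutard.
- intros k l _. apply vec_ext; intros i. unfold vdn, vdf.
  rewrite co_delta1, co_cross, !co_delta1, !co_vec. unfold df.
  rewrite (dpotential_1 _ (q12 A)) by apply dn_moutard. ring.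
- intros k l _. apply vec_ext; intros i. unfold vdn, vdf.
  rewrite co_delta2, co_cross, !co_delta2, !co_vec. unfold df.
  rewrite dpotential_2. ring.
- apply vec_ext; intros i. unfold vdf. rewrite co_vec. reflexivity.
Qed.

Lemma dth_step k l : dth e (S k) (S l) =
  a12 A e k l * (dth e (S k) l + dth e k (S l)) - dth e k l.
Proof. pose proof (dth_moutard e k l) as H. unfold a12. lra. Qed.

Lemma canonical_moutard_transform :
  discrete_moutard_transform A W e r vdn vdtrans (db1 e) (db2 e).
Proof.
assert (Hden : forall k l, in_grid e r (S k) (S l) ->
  dth e k l <> 0 /\ dth e (S k) l <> 0 /\ dth e k (S l) <> 0 /\ dth e (S k) (S l) <> 0).
{ intros k l H. pose proof (in_grid_pred1 _ _ H) as H1. pose proof (in_grid_pred2 _ _ H) as H2.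
  pose proof (in_grid_pred1 _ _ H2) as H3. repeat split; apply Hreg; assumption. }
(* The point of the substitution: the Moutard equation for [dth] turns the denominator of the
   evolution of [b1] and [b2] into a monomial in the four corner values. *)
assert (Hden2 : forall k l, in_grid e r (S k) (S l) ->
  (db1 e k l + db2 e k l) * a12 A e k l - db1 e k l * db2 e k l =
  dth e k l * dth e (S k) (S l) / (dth e (S k) l * dth e k (S l))).
{ intros k l H. destruct (Hden k l H) as (H1 & H2 & H3 & H4).
  rewrite dth_step. unfold db1, db2. field. auto. }
split.
- intros k l H. pose proof (in_grid_pred1 _ _ H) as H'.
  destruct (Hreg _ _ H) as [H1 _], (Hreg _ _ H') as [H2 _].
  apply vec_ext; intros i. unfold vdn, vdtrans.
  rewrite co_minus, co_scal, co_minus, !co_vec. unfold dtrans, dM, db1.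
  rewrite (dpotential_1 _ (q12 A)) by (apply dn_moutard || apply dth_moutard).
  field. auto.
- intros k l H. pose proof (in_grid_pred2 _ _ H) as H'.
  destruct (Hreg _ _ H) as [H1 _], (Hreg _ _ H') as [H2 _].
  apply vec_ext; intros i. unfold vdn, vdtrans.
  rewrite co_plus, co_scal, co_plus, !co_vec. unfold dtrans, dM, db2.
  rewrite dpotential_2. field. auto.
- intros k l H. destruct (Hden k l H) as (H1 & H2 & H3 & H4). unfold db1, db2.
  split; apply Rmult_integral_contrapositive_currified; auto using Rinv_neq_0_compat.
- intros k l H. rewrite (Hden2 k l H). destruct (Hden k l H) as (H1 & H2 & H3 & H4).
  repeat apply Rmult_integral_contrapositive_currified; auto.
  apply Rinv_neq_0_compat, Rmult_integral_contrapositive_currified; auto.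
- intros k l H. rewrite (Hden2 k l H). destruct (Hden k l H) as (H1 & H2 & H3 & H4).
  unfold db1. field. auto.
- intros k l H. rewrite (Hden2 k l H). destruct (Hden k l H) as (H1 & H2 & H3 & H4).
  unfold db2. field. auto.
- apply vec_ext; intros i. unfold vdtrans. rewrite co_vec. unfold dtrans, dM.
  rewrite dpotential_0, dth_axis1. simpl. field.
(* At the last grid point the successor lies outside the grid, where [Hreg] says nothing about
   [dth]; the recursion of [dexp_axis] still gives the quotient, since 1 + e p1 is nonzero at
   [k]. *)
- intros k H. destruct (Hreg _ _ H) as (H1 & H2 & _).
  unfold db1. rewrite !dth_axis1 in *. simpl. field. auto.
- intros l H. destruct (Hreg _ _ H) as (H1 & _ & H2).
  unfold db2. rewrite !dth_axis2 in *. simpl. field. auto.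
Qed.

Lemma canonical_weingarten : discrete_weingarten_transform A W e r vdn vdf vdwein.
Proof.
exists vdtrans, (db1 e), (db2 e). split; [apply canonical_moutard_transform|].
intros k l _. apply vec_ext; intros i. unfold vdwein, vdf, vdtrans, vdn.
rewrite co_plus, co_cross, !co_vec. reflexivity.
Qed.

(** Discrete Lelieuvre formula with the new normal field: the edge is orthogonal to n^+ at both of
    its ends. *)
Lemma dwein_edge1 k l : in_grid e r (S k) l ->
  minus (vdwein (S k) l) (vdwein k l) = cross (vdtrans (S k) l) (vdtrans k l).
Proof.
intros H. pose proof (in_grid_pred1 _ _ H) as H'.
destruct (Hreg _ _ H) as [H1 _], (Hreg _ _ H') as [H2 _].
apply vec_ext; intros i. unfold vdwein, vdtrans.
rewrite co_minus, co_cross, !co_vec. unfold dwein, dtrans, df, dM.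
rewrite !(dpotential_1 _ (q12 A)) by (apply dn_moutard || apply dth_moutard).
field. auto.
Qed.

Lemma dwein_edge2 k l : in_grid e r k (S l) ->
  minus (vdwein k (S l)) (vdwein k l) = cross (vdtrans k l) (vdtrans k (S l)).
Proof.
intros H. pose proof (in_grid_pred2 _ _ H) as H'.
destruct (Hreg _ _ H) as [H1 _], (Hreg _ _ H') as [H2 _].
apply vec_ext; intros i. unfold vdwein, vdtrans.
rewrite co_minus, co_cross, !co_vec. unfold dwein, dtrans, df, dM.
rewrite !dpotential_2. field. auto.
Qed.

(** All edges at a vertex are multiples of cross products with n^+ at that vertex, which therefore
    serves as normal of the vertex plane. *)
Lemma canonical_A_net : discrete_A_net e r vdwein.
Proof.
intros k l Hkl.
assert (Hedge : forall i j, in_grid e r i j -> adjacent k l i j ->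
  exists w s, minus (vdwein i j) (vdwein k l) = scal s (cross (vdtrans k l) w)).
{ assert (Hanti : forall v w : R3, cross v w = scal (-1) (cross w v)).
  { intros v w; apply vec_ext; intros i. rewrite co_scal, !co_cross. ring. }
  assert (Hopp : forall v w : R3, minus v w = scal (-1) (minus w v)).
  { intros v w; apply vec_ext; intros i. rewrite co_scal, !co_minus. ring. }
  assert (Hone : forall v : R3, v = scal 1 v).
  { intros v; apply vec_ext; intros i. rewrite co_scal. ring. }
  intros i j Hij [[-> [-> | ->]] | [-> [-> | ->]]].
  - exists (vdtrans k (S l)), 1. rewrite dwein_edge2 by exact Hij. apply Hone.
  - exists (vdtrans k j), 1. rewrite Hopp, dwein_edge2, <- Hanti by exact Hkl. apply Hone.
  - exists (vdtrans (S k) l), (-1). rewrite dwein_edge1 by exact Hij. apply Hanti.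
  - exists (vdtrans i l), (-1). rewrite Hopp, dwein_edge1 by exact Hkl. reflexivity. }
assert (Hdot : forall v w : R3, dot v w =
  co X1 v * co X1 w + co X2 v * co X2 w + co X3 v * co X3 w) by reflexivity.
(* Where n^+ vanishes all edges at the vertex are zero, and any nonzero vector is a normal. *)
destruct (classic (vdtrans k l = zero)) as [E|E].
- exists (1, 0, 0). split.
  + intros H. apply (f_equal c1) in H. revert H. exact R1_neq_R0.
  + intros i j Hij Hadj. destruct (Hedge i j Hij Hadj) as (w & s & ->).
    rewrite E, Hdot, !co_scal, !co_cross. cbn. unfold c1, c2, c3, zero. simpl.
    unfold zero; simpl. ring.
- exists (vdtrans k l). split; [exact E|].
  intros i j Hij Hadj. destruct (Hedge i j Hij Hadj) as (w & s & ->).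
  rewrite Hdot, !co_scal, !co_cross. simpl nxt. ring.
Qed.

Lemma discrete_A_surface_unique n f n' f' :
  discrete_A_surface A e r n f -> discrete_A_surface A e r n' f' ->
  forall k l, in_grid e r k l -> n k l = n' k l /\ f k l = f' k l.
Proof.
intros H H'.
assert (Hn : forall l k, in_grid e r k l -> n k l = n' k l).
{ induction l as [|l IHl].
  - intros k Hk. rewrite (dA_axis1 _ _ _ _ _ H k Hk), (dA_axis1 _ _ _ _ _ H' k Hk).
    reflexivity.
  - induction k as [|k IHk]; intros Hk.
    + rewrite (dA_axis2 _ _ _ _ _ H _ Hk), (dA_axis2 _ _ _ _ _ H' _ Hk). reflexivity.
    + pose proof (in_grid_pred1 _ _ Hk) as H1. pose proof (in_grid_pred2 _ _ Hk) as H2.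
      pose proof (in_grid_pred1 _ _ H2) as H3.
      pose proof (dA_moutard _ _ _ _ _ H k l Hk) as E.
      pose proof (dA_moutard _ _ _ _ _ H' k l Hk) as E'.
      rewrite IHk, (IHl _ H2), (IHl _ H3), <- E' in E by exact H1.
      apply vec_ext; intros i. apply (f_equal (co i)) in E. rewrite !co_plus in E. lra. }
assert (Hie : / e <> 0) by (apply Rinv_neq_0_compat; lra).
assert (Hf : forall l k, in_grid e r k l -> f k l = f' k l).
{ induction l as [|l IHl].
  - induction k as [|k IHk]; intros Hk.
    + rewrite (dA_origin _ _ _ _ _ H), (dA_origin _ _ _ _ _ H'). reflexivity.
    + pose proof (in_grid_pred1 _ _ Hk) as H1.
      pose proof (dA_lelieuvre1 _ _ _ _ _ H k _ Hk) as E.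
      pose proof (dA_lelieuvre1 _ _ _ _ _ H' k _ Hk) as E'.
      unfold delta1 at 2 in E. rewrite (Hn _ _ Hk), (Hn _ _ H1) in E.
      fold (delta1 e n' k 0) in E. rewrite <- E' in E.
      apply vec_ext; intros i. apply (f_equal (co i)) in E. rewrite !co_delta1 in E.
      apply Rmult_eq_reg_l in E; [|exact Hie]. rewrite (IHk H1) in E. lra.
  - intros k Hk. pose proof (in_grid_pred2 _ _ Hk) as H1.
    pose proof (dA_lelieuvre2 _ _ _ _ _ H k l Hk) as E.
    pose proof (dA_lelieuvre2 _ _ _ _ _ H' k l Hk) as E'.
    unfold delta2 at 2 in E. rewrite (Hn _ _ Hk), (Hn _ _ H1) in E.
    fold (delta2 e n' k l) in E. rewrite <- E' in E.
    apply vec_ext; intros i. apply (f_equal (co i)) in E. rewrite !co_delta2 in E.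
    apply Rmult_eq_reg_l in E; [|exact Hie]. rewrite (IHl k H1) in E. lra. }
intros k l Hkl; auto.
Qed.

(** The coefficients belong to edges, hence the guards with a successor. The induction runs over
    diagonals because each new value of [b1] or [b2] needs both coefficients at one vertex of the
    previous diagonal. *)
Lemma discrete_moutard_transform_unique n n' np np' b1 b2 b1' b2' :
  (forall k l, in_grid e r k l -> n k l = n' k l) ->
  discrete_moutard_transform A W e r n np b1 b2 ->
  discrete_moutard_transform A W e r n' np' b1' b2' ->
  forall k l, in_grid e r k l -> np k l = np' k l.
Proof.
intros Hn H H'.
assert (Hdiv : forall a b c : R, b <> 0 -> a / b = c -> a = c * b).
{ intros a b c Hb <-. field; exact Hb. }
assert (Hb : forall s k l, (k + l = s)%nat ->
  (in_grid e r (S k) l -> b1 k l = b1' k l) /\ (in_grid e r k (S l) -> b2 k l = b2' k l)).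
{ induction s as [|s IH]; intros k l Hs; split; intros Hg.
  - assert (l = 0%nat) as -> by lia. pose proof (in_grid_pred1 _ _ Hg) as H1.
    rewrite (dM_b1_axis _ _ _ _ _ _ _ _ H _ H1), (dM_b1_axis _ _ _ _ _ _ _ _ H' _ H1).
    reflexivity.
  - assert (k = 0%nat) as -> by lia. pose proof (in_grid_pred2 _ _ Hg) as H1.
    rewrite (dM_b2_axis _ _ _ _ _ _ _ _ H _ H1), (dM_b2_axis _ _ _ _ _ _ _ _ H' _ H1).
    reflexivity.
  - destruct l as [|l].
    + pose proof (in_grid_pred1 _ _ Hg) as H1.
      rewrite (dM_b1_axis _ _ _ _ _ _ _ _ H _ H1), (dM_b1_axis _ _ _ _ _ _ _ _ H' _ H1).
      reflexivity.
    + pose proof (in_grid_pred1 _ _ Hg) as H1. pose proof (in_grid_pred2 _ _ Hg) as H2.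
      destruct (IH k l ltac:(lia)) as [I1 I2]. specialize (I1 H2); specialize (I2 H1).
      pose proof (dM_b1 _ _ _ _ _ _ _ _ H k l Hg) as E.
      pose proof (dM_b1 _ _ _ _ _ _ _ _ H' k l Hg) as E'.
      rewrite I1, I2, <- E' in E.
      destruct (dM_b_neq0 _ _ _ _ _ _ _ _ H' k l Hg) as [Hz _].
      apply Hdiv in E; [|exact Hz]. rewrite E. field. exact Hz.
  - destruct k as [|k].
    + pose proof (in_grid_pred2 _ _ Hg) as H1.
      rewrite (dM_b2_axis _ _ _ _ _ _ _ _ H _ H1), (dM_b2_axis _ _ _ _ _ _ _ _ H' _ H1).
      reflexivity.
    + pose proof (in_grid_pred1 _ _ Hg) as H1. pose proof (in_grid_pred2 _ _ Hg) as H2.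
      destruct (IH k l ltac:(lia)) as [I1 I2]. specialize (I1 H2); specialize (I2 H1).
      pose proof (dM_b2 _ _ _ _ _ _ _ _ H k l Hg) as E.
      pose proof (dM_b2 _ _ _ _ _ _ _ _ H' k l Hg) as E'.
      rewrite I1, I2, <- E' in E.
      destruct (dM_b_neq0 _ _ _ _ _ _ _ _ H' k l Hg) as [_ Hz].
      apply Hdiv in E; [|exact Hz]. rewrite E. field. exact Hz. }
assert (Hnp : forall l k, in_grid e r k l -> np k l = np' k l).
{ induction l as [|l IHl].
  - induction k as [|k IHk]; intros Hk.
    + rewrite (dM_origin _ _ _ _ _ _ _ _ H), (dM_origin _ _ _ _ _ _ _ _ H'). reflexivity.
    + pose proof (in_grid_pred1 _ _ Hk) as H1.
      pose proof (dM_eq1 _ _ _ _ _ _ _ _ H k _ Hk) as E.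
      pose proof (dM_eq1 _ _ _ _ _ _ _ _ H' k _ Hk) as E'.
      destruct (Hb _ k 0%nat eq_refl) as [B _].
      rewrite (B Hk), (IHk H1), (Hn _ _ Hk), (Hn _ _ H1), <- E' in E.
      apply vec_ext; intros i. apply (f_equal (co i)) in E. rewrite !co_minus in E. lra.
  - intros k Hk. pose proof (in_grid_pred2 _ _ Hk) as H1.
    pose proof (dM_eq2 _ _ _ _ _ _ _ _ H k l Hk) as E.
    pose proof (dM_eq2 _ _ _ _ _ _ _ _ H' k l Hk) as E'.
    destruct (Hb _ k l eq_refl) as [_ B].
    rewrite (B Hk), (IHl k H1), (Hn _ _ Hk), (Hn _ _ H1), <- E' in E.
    apply vec_ext; intros i. apply (f_equal (co i)) in E. rewrite !co_plus in E. lra. }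
intros k l Hkl; auto.
Qed.

Lemma discrete_weingarten_unique n f fp :
  discrete_A_surface A e r n f -> discrete_weingarten_transform A W e r n f fp ->
  forall k l, in_grid e r k l -> fp k l = vdwein k l.
Proof.
intros HA (np & b1 & b2 & HM & Hfp) k l Hkl.
pose proof (discrete_A_surface_unique _ _ _ _ HA canonical_A_surface) as HU.
pose proof (discrete_moutard_transform_unique _ _ _ _ _ _ _ _
  (fun k l H => proj1 (HU k l H)) HM canonical_moutard_transform) as HV.
rewrite (Hfp k l Hkl), (HV k l Hkl). destruct (HU k l Hkl) as [-> ->].
apply vec_ext; intros i. unfold vdwein, vdf, vdtrans, vdn.
rewrite co_plus, co_cross, !co_vec. reflexivity.
Qed.

End Fixed.

End Discrete.

(** * From scalar families to vector-valued convergence *)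

Lemma Bc_iter T g b j : (forall N, Bc T N g) -> forall N, Bc T N (Nat.iter j (dl b) g).
Proof.
intros Hg; induction j as [|j IH]; [exact Hg|].
intros N. exact (proj2 (IH (S N)) b).
Qed.

Lemma iter_dl_div b j (g : family) :
  Nat.iter j (dl b) (fun e k l => g e k l / e) = fun e k l => Nat.iter j (dl b) g e k l / e.
Proof.
induction j as [|j IH]; [reflexivity|]. simpl. rewrite IH.
extensionality e; extensionality k; extensionality l.
unfold dl, sh, Rdiv; destruct b; ring.
Qed.

Lemma co_delta i0 e (G : R -> nat -> nat -> R3) i j k l :
  co i0 (delta e i j (G e) k l) =
  Nat.iter i (dl true) (Nat.iter j (dl false) (fun e k l => co i0 (G e k l))) e k l.
Proof.
assert (Hj : forall k l, co i0 (Nat.iter j (delta2 e) (G e) k l) =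
  Nat.iter j (dl false) (fun e k l => co i0 (G e k l)) e k l).
{ induction j as [|j IH]; intros k' l'; [reflexivity|]. simpl.
  rewrite co_delta2, !IH. unfold dl, sh. apply Rmult_comm. }
unfold delta. revert k l; induction i as [|i IH]; intros k l; [apply Hj|]. simpl.
rewrite co_delta1, !IH. unfold dl at 1, sh. apply Rmult_comm.
Qed.

(** A given discrete transform agrees with the canonical one on the grid only, so the stencil of a
    difference quotient must be known not to leave it. *)
Lemma delta_local e i j (g h : nat -> nat -> R3) k l :
  (forall k' l', (k' <= i + k)%nat -> (l' <= j + l)%nat -> g k' l' = h k' l') ->
  delta e i j g k l = delta e i j h k l.
Proof.
assert (Hj : forall j k l, (forall l', (l' <= j + l)%nat -> g k l' = h k l') ->
  Nat.iter j (delta2 e) g k l = Nat.iter j (delta2 e) h k l).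
{ clear. induction j as [|j IH]; intros k l H; [apply H; lia|].
  simpl. unfold delta2. rewrite !IH; [reflexivity| |]; intros; apply H; lia. }
unfold delta. revert k; induction i as [|i IH]; intros k H.
- apply Hj. intros l' Hl'. apply H; [lia|exact Hl'].
- simpl. unfold delta1. rewrite !IH; [reflexivity| |]; intros; apply H; lia.
Qed.

(** Since [r < T], the bounds of [conv] hold at every base point of the grid on [0,r]^2; the largest
    of the three coordinate constants, times 3, bounds the norm. *)
Lemma conv_converges T r (g : coord -> family) (F : coord -> R -> R -> R) :
  r < T -> (forall c, conv T (g c) (F c)) ->
  converges_Cinf_Oeps r (fun e k l => vec (fun c => g c e k l))
    (fun x y => vec (fun c => F c x y)).
Proof.
intros Hr Hc i j.
assert (Hb : forall c, exists M, at_right 0 (fun e => forall k l,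
  INR k * e <= r -> INR l * e <= r ->
  Rabs (Nat.iter i (dl true) (Nat.iter j (dl false)
    (fun e k l => g c e k l - rs (F c) e k l)) e k l) <= M * e)).
{ intros c.
  pose proof (Bc_iter T _ true i (Bc_iter T _ false j (Hc c))) as HB.
  rewrite iter_dl_div, iter_dl_div in HB.
  destruct (Bc_bnd _ _ _ (HB 0%nat) r Hr) as [M HM]. exists M.
  apply at_right_imp with (2 := HM). intros e He H k l Hk Hl.
  specialize (H k l Hk Hl). unfold Rdiv in H.
  rewrite Rabs_mult, Rabs_inv, (Rabs_pos_eq e) in H by lra.
  apply (Rmult_le_compat_r e) in H; [|lra].
  rewrite Rmult_assoc, Rinv_l, Rmult_1_r in H by lra. exact H. }
destruct (coord_choice _ Hb) as [M HM].
set (C := Rmax (M X1) (Rmax (M X2) (M X3))).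
assert (HC : forall c, M c <= C).
{ intros c; unfold C. destruct c.
  - apply Rmax_l.
  - eapply Rle_trans; [apply Rmax_l|apply Rmax_r].
  - eapply Rle_trans; [apply Rmax_r|apply Rmax_r]. }
exists (3 * C).
apply at_right_imp with (2 := at_right_and _ _ (HM X1) (at_right_and _ _ (HM X2) (HM X3))).
intros e He (H1 & H2 & H3) k l [Hk Hl]. rewrite plus_INR in Hk, Hl.
pose proof (pos_INR i); pose proof (pos_INR j).
assert (Hk' : INR k * e <= r) by nra. assert (Hl' : INR l * e <= r) by nra.
rewrite Rmult_assoc. apply norm_R3_le. intros c.
rewrite (co_delta c e (fun e k' l' => minus (vec (fun c => g c e k' l'))
  (vec (fun c => F c (INR k' * e) (INR l' * e))))).
replace (fun e k l => co c (minus (vec (fun c => g c e k l))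
  (vec (fun c => F c (INR k * e) (INR l * e))))) with
  (fun e k l => g c e k l - rs (F c) e k l).
- apply Rle_trans with (M c * e).
  + destruct c; auto.
  + apply Rmult_le_compat_r; [lra|apply HC].
- extensionality e'; extensionality k'; extensionality l'.
  rewrite co_minus, !co_vec. reflexivity.
Qed.

Theorem theorem3p15 (A : A_data) (W : W_data) :
  exists r : R, 0 < r /\
    (exists n f : R -> R -> R3, A_surface_with_data r A n f) /\
    at_right 0 (fun eps =>
      exists neps feps fpeps : nat -> nat -> R3,
        discrete_A_surface A eps r neps feps /\
        discrete_weingarten_transform A W eps r neps feps fpeps /\
        discrete_A_net eps r fpeps) /\
    forall n f : R -> R -> R3, A_surface_with_data r A n f ->
      exists fp : R -> R -> R3,
        weingarten_transform r A W n f fp /\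
        (forall fp' : R -> R -> R3, weingarten_transform r A W n f fp' ->
           forall x y, in_square r x y -> fp' x y = fp x y) /\
        (forall neps feps fpeps : R -> nat -> nat -> R3,
           at_right 0 (fun eps =>
             discrete_A_surface A eps r (neps eps) (feps eps) /\
             discrete_weingarten_transform A W eps r
               (neps eps) (feps eps) (fpeps eps)) ->
           converges_Cinf_Oeps r fpeps fp).
Proof.
destruct (smooth_solution_exists A W) as (T & n & th & f & M & HS).
pose proof (ss_pos _ _ _ _ _ _ _ HS) as HT.
(* Any radius strictly between 0 and [T] would do: the closed square must lie in the open box. *)
set (r := T / 2).
assert (Hr : 0 < r) by (unfold r; lra). assert (HrT : r < T) by (unfold r; lra).
pose proof (grid_regular A W T n th f M HS r HrT) as Hreg.
exists r; split; [exact Hr|]. split; [|split].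
- eexists; eexists. exact (smooth_A_surface A W T n th f M HS r HrT).
- apply at_right_imp with (2 := Hreg). intros e He H.
  exists (vdn A e), (vdf A e), (vdwein A W e).
  split; [apply canonical_A_surface|]. split.
  + apply canonical_weingarten; assumption.
  + apply canonical_A_net; assumption.
- intros n' f' HA.
  pose proof (given_weingarten A W T n th f M HS r Hr HrT n' f' HA) as HW.
  eexists; split; [exact HW|]. split.
  + intros fp' HW'.
    apply (weingarten_transform_unique r A W n' f'); auto.
    apply (As_n_smooth _ _ _ _ (Ad_surface _ _ _ _ HA)).
  + intros neps feps fpeps Hd i j.
    destruct (conv_converges T r (dwein A W) (wein n th f M) HrT
      (conv_dwein A W T n th f M HS) i j) as [c Hc].
    exists c. apply at_right_imp with (2 := at_right_and _ _ Hc (at_right_and _ _ Hreg Hd)).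
    intros e He (H1 & H2 & H3 & H4) k l Hkl.
    (* Inside the stencil, discrete uniqueness replaces the given transform by the canonical one. *)
    rewrite (delta_local e i j _ (fun k' l' => minus (vec (fun c => dwein A W c e k' l'))
      (vec (fun c => wein n th f M c (INR k' * e) (INR l' * e))))).
    * apply H1, Hkl.
    * intros k' l' Hk' Hl'.
      rewrite (discrete_weingarten_unique A W e r He H2 _ _ _ H3 H4); [reflexivity|].
      destruct Hkl as [Hk Hl]. apply le_INR in Hk', Hl'.
      split; (eapply Rle_trans; [apply Rmult_le_compat_r; [lra|]|]; eassumption).
Qed.
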